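(* Let $0<p<\infty$, $0<q\le\infty$ and let $v$ be a positive, measurable, locally integrable weight function on $\mathbb{R}^n$. Let $X=(x_{k,j},a_j)_{(k,j)\in I:=\mathbb{Z}^n\times\mathbb{Z}}$ be some well-spread set in $G=\mathbb{R}^n\rtimes\mathbb{R}_+^*$. (1) If $v$ satisfies the doubling condition, then $(L^{p,q}(v))_d=(L^{p,q}(v))_d(X,U)$ is independent of the choice of the neighbourhood $U$ of $e$ in $G$, and an equivalent quasi-norm on $(L^{p,q}(v))_d(X)$ is given by $$\|(\lambda_i)_{i\in I}|\ell^{p,q}(\tilde v)\|=\Big(\sum_{j\in\mathbb{Z}}\Big(\sum_{k\in\mathbb{Z}^n}|\lambda_{k,j}|^p\,\tilde v_{k,j}\Big)^{q/p}a_j^{-n}\Big)^{1/q},\qquad \tilde v_{k,j}=\int_{B(x_{k,j},a_j)}v(y)\,dy$$ (with the usual modification for $q=\infty$, i.e. $\sup_{j\in\mathbb{Z}}(\sum_{k\in\mathbb{Z}^n}|\lambda_{k,j}|^p\tilde v_{k,j})^{1/p}$). (2) Moreover, $W(L^\infty,L^{p,q}(v))$ is right translation invariant if and only if $v$ satisfies the doubling condition.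
   Context: $G=\mathbb{R}^n\rtimes\mathbb{R}_+^*$ is the $n$-dimensional $ax+b$ group with product $(x,a)\cdot(y,b)=(x+ay,ab)$, identity $e=(0,1)$ and left Haar measure $\frac{da}{a^{n+1}}dx$. $B(x,r)$ is the ball in $\mathbb{R}^n$ with centre $x$ and radius $r$. A positive measurable weight $v$ on $\mathbb{R}^n$ satisfies the doubling condition if there is a constant $C$ with $\int_{B(x,2r)}v(y)\,dy\le C\int_{B(x,r)}v(y)\,dy$ for all $x\in\mathbb{R}^n$, $r\in(0,\infty)$. A weight $v$ on $\mathbb{R}^n$ is extended to $G$ by $v(x,a)=v(x)$. $L^{p,q}(v)$ is the space of measurable functions $F$ on $G$ with finite quasi-norm $$\|F|L^{p,q}(v)\|=\Big(\int_0^\infty\Big(\int_{\mathbb{R}^n}|F(x,a)|^p\,v(x,a)\,dx\Big)^{q/p}\frac{da}{a^{n+1}}\Big)^{1/q}$$ (essential supremum over $a$ if $q=\infty$). Put $Y=L^{p,q}(v)$, $L_gF(h)=F(g^{-1}h)$, $R_gF(h)=F(hg)$ for $g,h\in G$; $\chi_S$ is the characteristic function of $S$. For a relatively compact neighbourhood $Q$ of $e$, $W(L^\infty,Y,Q)$ is the space of all $F\in L^\infty_{loc}(G)$ such that $K(F,Q,L^\infty)(g):=\|(L_g\chi_Q)F\|_\infty$ belongs to $Y$, with quasi-norm $\|K(F,Q,L^\infty)|Y\|$. $W(L^\infty,Y)$ is called right translation invariant if for every such $Q$ and every $g\in G$ the operator $R_g$ maps $W(L^\infty,Y,Q)$ boundedly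 into itself. A discrete family $X=(g_i)_{i\in I}$ in $G$ is relatively separated if for every compact $K\subset G$ there is a constant $C_K$ with $\sup_{j}\#\{i:g_iK\cap g_jK\ne\emptyset\}\le C_K$; it is well-spread if it is relatively separated and $G=\bigcup_ig_iV$ for some relatively compact neighbourhood $V$ of $e$. For a relatively compact neighbourhood $U$ of $e$, $Y_d(X,U)=\{(\lambda_i)_{i\in I}:\sum_i|\lambda_i|\chi_{g_iU}\in Y\}$ with quasi-norm $\|\sum_i|\lambda_i|\chi_{g_iU}|Y\|$; ''independent of $U$'' means that different $U$ yield the same space with equivalent quasi-norms, and this space is then denoted $Y_d(X)$ or $Y_d$.
   Formalization: The equivalence with the ℓ^{p,q}(ṽ) quasi-norm is stated under the added assumption that q = p or the scales (a_j) are relatively separated in the positive reals; without it the claim fails, e.g. when infinitely many j share one scale. *)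

(* Defs.v *)
From HB Require Import structures.
From mathcomp Require Import all_boot all_order all_algebra.
From mathcomp Require Import all_classical all_reals all_analysis.
From mathcomp Require Import measurable_realfun ess_sup_inf.
From mathcomp Require Import complex.

Set Implicit Arguments.
Unset Strict Implicit.
Unset Printing Implicit Defensive.

Import Order.TTheory GRing.Theory Num.Theory.
Import numFieldNormedType.Exports.

Local Open Scope classical_set_scope.
Local Open Scope ring_scope.

Definition rV_display : measure_display -> measure_display.
Proof. exact. Qed.

(* The sigma-algebra generated by the coordinates (as in the library for
   tuples); for [T = R] these are the Borel sets of [R^n]. *)
Section measurable_rV.
Context {d} {T : sigmaRingType d}.
Variable n : nat.

Let coors : 'I_n -> 'rV[T]_n -> T := fun i x => x ord0 i.

Let rV_set0 : g_sigma_preimage coors set0.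
Proof. exact: sigma_algebra0. Qed.

Let rV_setC A : g_sigma_preimage coors A -> g_sigma_preimage coors (~` A).
Proof. exact: sigma_algebraC. Qed.

Let rV_bigcup (F : _^nat) : (forall i, g_sigma_preimage coors (F i)) ->
  g_sigma_preimage coors (\bigcup_i (F i)).
Proof. exact: sigma_algebra_bigcup. Qed.

HB.instance Definition _ := @isMeasurable.Build (rV_display d)
  'rV[T]_n (g_sigma_preimage coors) rV_set0 rV_setC rV_bigcup.

End measurable_rV.

Section rV_cons.
Context {d} {T : measurableType d}.

Definition rV_cons n (z : T * 'rV[T]_n) : 'rV[T]_n.+1 :=
  \row_(i < n.+1) oapp (fun j => z.2 ord0 j) z.1 (unlift ord0 i).

Definition rV_uncons n (x : 'rV[T]_n.+1) : T * 'rV[T]_n :=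
  (x ord0 ord0, \row_(j < n) x ord0 (lift ord0 j)).

Lemma rV_consK n : cancel (@rV_cons n) (@rV_uncons n).
Proof.
move=> [a x]; rewrite /rV_uncons /rV_cons !mxE unlift_none /=; congr pair.
by apply/rowP => j; rewrite !mxE liftK.
Qed.

Lemma measurable_rV_coor n (i : 'I_n) :
  measurable_fun [set: 'rV[T]_n] (fun x => x ord0 i).
Proof.
move=> _ Y mY; rewrite setTI; apply: sub_sigma_algebra => /=.
rewrite -bigcup_seq/=; exists i => /=; first by rewrite mem_index_enum.
by exists Y => //; rewrite setTI.
Qed.

Lemma measurable_fun_rV d1 (T1 : measurableType d1) n (f : T1 -> 'rV[T]_n) :
  (forall i, measurable_fun [set: T1] (fun x => f x ord0 i)) ->
  measurable_fun [set: T1] f.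
Proof.
move=> mf; apply: (measurability (\big[setU/set0]_(i < n)
  preimage_set_system [set: 'rV[T]_n] (fun x => x ord0 i) measurable)) => //.
move=> A [B HB <-].
move: HB; rewrite -bigcup_seq/= => -[i _ [Y mY <-]].
by rewrite setTI; exact: mf.
Qed.

Lemma measurable_rV_cons n : measurable_fun setT (@rV_cons n).
Proof.
apply: measurable_fun_rV => i.
case: (unliftP ord0 i) => [j ->|->].
- rewrite (_ : (fun _ => _) = (fun z : T * 'rV[T]_n => z.2 ord0 j)).
    exact: (measurableT_comp (measurable_rV_coor j) measurable_snd).
  by apply/funext => z; rewrite mxE liftK.
- rewrite (_ : (fun _ => _) = (fun z : T * 'rV[T]_n => z.1)).
    exact: measurable_fst.
  by apply/funext => z; rewrite mxE unlift_none.
Qed.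

Lemma measurable_rV_uncons n : measurable_fun setT (@rV_uncons n).
Proof.
apply: measurable_fun_pair; first exact: measurable_rV_coor.
apply: measurable_fun_rV => j.
rewrite (_ : (fun _ => _) = (fun x : 'rV[T]_n.+1 => x ord0 (lift ord0 j))).
  exact: measurable_rV_coor.
by apply/funext => x; rewrite mxE.
Qed.

End rV_cons.

Section vol_succ.
Context {R : realType} (n : nat).
Variable mu : {sigma_finite_measure set 'rV[R]_n -> \bar R}.

Let prod_mu : {measure set (measurableTypeR R * 'rV[R]_n)%type -> \bar R} :=
  (lebesgue_measure \x mu)%E.

Let prod_mu_sigma_finite : sigma_finite setT prod_mu.
Proof.
have /sigma_finiteP[F [TF ndF Foo]] := sigma_finiteT (@lebesgue_measure R).
have /sigma_finiteP[G [TG ndG Goo]] := sigma_finiteT mu.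
exists (fun k => F k `*` G k).
  rewrite -setXTT TF TG predeqE => -[x y]; split.
    move=> [/= [k _ Fkx] [l _ Gly]]; exists (maxn k l) => //; split.
    - by move: x Fkx; exact/subsetPset/ndF/leq_maxl.
    - by move: y Gly; exact/subsetPset/ndG/leq_maxr.
  by move=> [k _ []/= ? ?]; split; exists k.
move=> k; have [? ?] := Foo k; have [? ?] := Goo k.
split; first exact: measurableX.
by rewrite /prod_mu/= product_measure1E// lte_mul_pinfty// ge0_fin_numE.
Qed.

Let mcons : measurable_fun setT (@rV_cons _ R n) := @measurable_rV_cons _ R n.

Definition vol_succ : set 'rV[R]_n.+1 -> \bar R :=
  pushforward prod_mu (@rV_cons _ R n).

Let mpre A : measurable A -> measurable (@rV_cons _ R n @^-1` A).
Proof. by move=> mA; rewrite -[X in measurable X]setTI; exact: mcons. Qed.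

Let vol_succ0 : vol_succ set0 = 0%E.
Proof. by rewrite /vol_succ /pushforward preimage_set0 measure0. Qed.

Let vol_succ_ge0 A : (0 <= vol_succ A)%E.
Proof. exact: measure_ge0. Qed.

Let vol_succ_sigma_additive : semi_sigma_additive vol_succ.
Proof.
move=> F mF tF mUF; rewrite /vol_succ /pushforward preimage_bigcup.
apply: measure_semi_sigma_additive.
- by move=> k; exact: mpre.
- apply/trivIsetP => /= i j _ _ ij; rewrite -preimage_setI.
  by move/trivIsetP : tF => /(_ _ _ _ _ ij) ->//; rewrite preimage_set0.
- by rewrite -preimage_bigcup; exact: mpre.
Qed.

HB.instance Definition _ := isMeasure.Build _ _ _ vol_succ
  vol_succ0 vol_succ_ge0 vol_succ_sigma_additive.

Let vol_succ_sigma_finite : sigma_finite setT vol_succ.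
Proof.
have [F TF mF] := prod_mu_sigma_finite.
exists (fun k => @rV_uncons _ R n @^-1` F k).
  by rewrite -preimage_bigcup -TF preimage_setT.
move=> k; have [mFk Fk_fin] := mF k; split.
  rewrite -[X in measurable X]setTI.
  by apply: (@measurable_rV_uncons _ R n).
rewrite /vol_succ /= /pushforward (_ : _ @^-1` _ = F k)//.
by apply/seteqP; split => z /=; rewrite rV_consK.
Qed.

HB.instance Definition _ := Measure_isSigmaFinite.Build _ _ _ vol_succ
  vol_succ_sigma_finite.

End vol_succ.

Fixpoint vol {R : realType} (n : nat) :
    {sigma_finite_measure set 'rV[R]_n -> \bar R} :=
  match n with
  | 0 => @dirac _ 'rV[R]_0 0 R
  | m.+1 => vol_succ (vol m)
  end.

(* [G] is the open half-space [axbG] of ['rV[R]_n * R]: it carries the subspace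
   topology and sigma-algebra, and functions on [G] are functions on the whole
   product whose values outside [axbG] are never used. *)
Section axb_group.
Context {R : realType} {n : nat}.
Local Notation GT := ('rV[R]_n * R)%type.
Implicit Types (g h : GT) (K Q V : set GT).

Definition axbG : set GT := [set g | 0 < g.2].
Definition axb1 : GT := (0, 1).
Definition axb_mul g h : GT := (g.1 + g.2 *: h.1, g.2 * h.2).
Definition axb_inv g : GT := (- (g.2^-1 *: g.1), g.2^-1).

Definition axb_L T g (F : GT -> T) h : T := F (axb_mul (axb_inv g) h).
Definition axb_R T g (F : GT -> T) h : T := F (axb_mul h g).

Definition axb_translate g K : set GT := axb_mul g @` K.

Definition axb_compact K := compact K /\ K `<=` axbG.

Definition rel_compact_nbhd1 Q :=
  nbhs axb1 Q /\ exists2 K, axb_compact K & Q `<=` K.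

(* Every compact set meets only finitely many [X i], so discreteness of the
   family is part of this notion. *)
Definition relatively_separated (I : Type) (X : I -> GT) :=
  forall K, axb_compact K -> exists C : nat, forall j,
    ([set i | axb_translate (X i) K `&` axb_translate (X j) K !=set0]
       #<= `I_C)%card.

Definition well_spread (I : Type) (X : I -> GT) :=
  [/\ forall i, axbG (X i), relatively_separated X &
      exists2 V, rel_compact_nbhd1 V &
        axbG = \bigcup_i axb_translate (X i) V].

Definition haar_density (g : GT) : R := if 0 < g.2 then g.2 ^- n.+1 else 0.

Definition haar (A : set GT) : \bar R :=
  (\int[vol n \x lebesgue_measure]_(g in A) (haar_density g)%:E)%E.

Lemma haar_density_ge0 g : 0 <= haar_density g.
Proof.
by rewrite /haar_density; case: ifPn => // g0; rewrite invr_ge0 exprn_ge0// ltW.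
Qed.

Lemma measurable_haar_density : measurable_fun [set: GT] haar_density.
Proof.
rewrite (_ : haar_density = (fun a : R => a `^ (- n.+1%:R)) \_ `]0, +oo[ \o snd).
  apply: measurableT_comp; last exact: measurable_snd.
  by apply/measurable_restrict => //; apply: measurable_funTS.
apply/funext => g; rewrite /haar_density /= patchE mem_setE in_itv/= andbT.
by case: ifPn => // g0; rewrite powRN powR_mulrn// ltW.
Qed.

Let haar0 : haar set0 = 0%E.
Proof. exact: integral_set0. Qed.

Let haar_ge0 A : (0 <= haar A)%E.
Proof. by apply: integral_ge0 => g _; rewrite lee_fin haar_density_ge0. Qed.

Let haar_sigma_additive : semi_sigma_additive haar.
Proof.
move=> /= F mF tF mUF; rewrite /haar; apply: cvg_toP.
  apply: ereal_nondecreasing_is_cvgn => k m km.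
  apply: lee_sum_nneg_natr => // i _ _; apply: integral_ge0 => /= g _.
  by rewrite lee_fin haar_density_ge0.
rewrite ge0_integral_bigcup//=.
- apply: (@measurable_funS _ _ _ _ setT) => //.
  by apply/measurable_EFinP; exact: measurable_haar_density.
- by move=> g _; rewrite lee_fin haar_density_ge0.
Qed.

HB.instance Definition _ := isMeasure.Build _ _ _
  haar haar0 haar_ge0 haar_sigma_additive.

End axb_group.
Arguments axbG {R n}.
Arguments haar {R n}.

(* Relative separation in the multiplicative group of positive reals.  It does
   not follow from [well_spread]: distributing the points of one scale over
   infinitely many indices [j], with [a j] equal, leaves the family unchanged
   but turns the inner l^p sum over that scale into an l^q sum over [j]. *)
Definition relatively_separated_scales (R : realType) (a : int -> R) :=
  forall K : set R, compact K -> K `<=` [set t | 0 < t] ->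
  exists C : nat, forall j,
    ([set i | (( *%R (a i)) @` K) `&` (( *%R (a j)) @` K) !=set0]
       #<= `I_C)%card.

Section weights.
Context {R : realType} {n : nat}.
Implicit Type v : 'rV[R]_n -> R.

(* The Euclidean ball; the norm of the library on ['rV[R]_n] is the maximum
   norm. *)
Definition eball (x : 'rV[R]_n) (r : R) : set 'rV[R]_n :=
  [set y | Num.sqrt (\sum_(i < n) (y ord0 i - x ord0 i) ^+ 2) < r].

Definition wmass v (A : set 'rV[R]_n) : \bar R :=
  (\int[vol n]_(y in A) (v y)%:E)%E.

Definition weight v :=
  [/\ forall x, 0 < v x, measurable_fun setT v &
      forall K, compact K -> (wmass v K < +oo)%E].

Definition doubling v := exists C : R, forall x r, 0 < r ->
  (wmass v (eball x (2 * r)) <= C%:E * wmass v (eball x r))%E.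

End weights.

Section spaces.
Context {R : realType} {n : nat}.
Local Notation GT := ('rV[R]_n * R)%type.
Local Notation normc := ComplexField.Normc.normc.
Variables (p : R) (q : \bar R) (v : 'rV[R]_n -> R).
Local Open Scope ereal_scope.

Definition Lpq_qnorm (F : GT -> \bar R) : \bar R :=
  let N a := \int[vol n]_x (`|F (x, a)| `^ p * (v x)%:E) in
  match q with
  | r%:E =>
      (\int[lebesgue_measure]_(a in `]0%R, +oo[)
         (N a `^ (r / p) * (a ^- n.+1)%:E)) `^ r^-1
  | _ => ess_sup (mrestr lebesgue_measure (measurable_itv `]0%R, +oo[))
           (fun a => N a `^ p^-1)
  end.

Definition Lpq : set (GT -> \bar R) :=
  [set F : GT -> \bar R | measurable_fun axbG F /\ Lpq_qnorm F < +oo].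

Definition Linf_loc : set (GT -> R[i]) :=
  [set F : GT -> R[i] | [/\
    measurable_fun axbG (fun g => complex.Re (F g)),
    measurable_fun axbG (fun g => complex.Im (F g)) &
    forall K, axb_compact K ->
      ess_sup haar (fun h => (\1_K h * normc (F h))%:E) < +oo]].

Definition control_fun (Q : set GT) (F : GT -> R[i]) (g : GT) : \bar R :=
  ess_sup haar (fun h => (axb_L g \1_Q h * normc (F h))%:E).

Definition wiener (Q : set GT) : set (GT -> R[i]) :=
  [set F | Linf_loc F /\ Lpq (control_fun Q F)].

Definition wiener_qnorm (Q : set GT) (F : GT -> R[i]) : \bar R :=
  Lpq_qnorm (control_fun Q F).

(* [Q] is Borel, since the amalgam quasi-norm involves its characteristic
   function. *)
Definition wiener_right_invariant :=
  forall Q, rel_compact_nbhd1 Q -> measurable Q -> forall g, axbG g ->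
    exists C : R, forall F, wiener Q F ->
      wiener Q (axb_R g F) /\
      wiener_qnorm Q (axb_R g F) <= C%:E * wiener_qnorm Q F.

Definition step_fun (I : choiceType) (X : I -> GT) (U : set GT)
    (lam : I -> R[i]) (g : GT) : \bar R :=
  \esum_(i in [set: I]) (normc (lam i) * \1_(axb_translate (X i) U) g)%:E.

Definition Lpq_d_qnorm (I : choiceType) (X : I -> GT) (U : set GT)
    (lam : I -> R[i]) : \bar R :=
  Lpq_qnorm (step_fun X U lam).

Definition Lpq_d (I : choiceType) (X : I -> GT) (U : set GT) :
    set (I -> R[i]) :=
  [set lam | Lpq (step_fun X U lam)].

Definition seq_qnorm (x : 'rV[int]_n -> int -> 'rV[R]_n) (a : int -> R)
    (lam : 'rV[int]_n * int -> R[i]) : \bar R :=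
  let N j := \esum_(k in [set: 'rV[int]_n])
    ((normc (lam (k, j)) `^ p)%:E * wmass v (eball (x k j) (a j))) in
  match q with
  | r%:E => (\esum_(j in [set: int]) (N j `^ (r / p) * (a j ^- n)%:E)) `^ r^-1
  | _ => ereal_sup [set N j `^ p^-1 | j in [set: int]]
  end.

Definition seq_space (x : 'rV[int]_n -> int -> 'rV[R]_n) (a : int -> R) :
    set ('rV[int]_n * int -> R[i]) :=
  [set lam | seq_qnorm x a lam < +oo].

End spaces.

Definition equivalent_qnormed (R : realType) (T : Type)
    (S1 : set T) (N1 : T -> \bar R) (S2 : set T) (N2 : T -> \bar R) :=
  S1 = S2 /\ exists c C : R, [/\ 0 < c, 0 < C &
    forall f, S1 f -> (c%:E * N1 f <= N2 f)%E /\ (N2 f <= C%:E * N1 f)%E].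

(* Main.v *)
From HB Require Import structures.
Require Import Defs.
From mathcomp Require Import all_boot all_order all_algebra.
From mathcomp Require Import all_classical all_reals all_analysis.
From mathcomp Require Import measurable_realfun ess_sup_inf.
From mathcomp Require Import complex ring lra.

(** Write [N_F(a) = \int |F(x,a)|^p v(x) dx], so that the norm of [F] is a weighted
    L^(q/p) norm of [N_F] on the half-line; replacing [N_F] by a finite sum of its
    dilates [a |-> N_F(t a)] increases this norm at most by a constant factor.

    (1) Boundedly many sets [g_i U] overlap and [v] is doubling, so [N] of the step
    function is squeezed between sums [\sum_i w_i 1_E(a / a_i)] with
    [w_i = |lambda_i|^p v(B(x_i, a_i))], where [E] is an interval around 1 depending
    only on [U]. Any such interval is covered by finitely many dilates of any other,
    whence the independence of [U]; bounded overlap of the scales (or [q = p]) turns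
    the half-line norm of this sum into the sequence norm.

    (2) If [v] is doubling, split [R^n] at height [a] into cubes of side [delta a]:
    the right-translated control function at [(x,a)] is at most the supremum of the
    essential suprema of [|F|] over the cubes (times short scale intervals) close to
    [x]; each is at most the original control function at every point of its cube,
    and doubling compares a cube with its enlargement.
    Conversely, right translation by [(z,1)] moves the indicator function of a box at
    [x] of side and height [r] to one at [x - r z]. Its norm is comparable to the
    mass of the box to the power [1/p], so [v(x - r z + small cube) <= C_z v(x + cube)],
    and finitely many [z] suffice to cover the doubled cube. *)

Set Implicit Arguments.
Unset Strict Implicit.
Unset Printing Implicit Defensive.
Import Order.TTheory GRing.Theory Num.Theory.
Import numFieldNormedType.Exports.
Local Open Scope classical_set_scope.
Local Open Scope ring_scope.

(** * Powers, sums and integrals of extended reals *)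

Section ereal_tools.
Context {R : realType}.
Local Open Scope ereal_scope.

(** Since [p] and [q / p] may be smaller than 1, no triangle inequality is available. Powers of sums
    and sums of powers are compared by counting nonzero terms, which treats small and large
    exponents alike. Dilations are cheap because the density [a ^- n.+1] is homogeneous: a dilation
    by [t] costs only a power of [t]. All inequalities are between extended reals, so finiteness
    passes through them. Membership in a space asks for measurability as well, and this is the
    delicate point for control functions: they are essential suprema over a moving set, and their
    superlevel sets are described by the measure of sections. In the converse of (2) the obstacle is
    that right translation by [(z, 1)] displaces by [a *: z] at height [a], hence by different
    amounts at different heights. The test function must therefore live on a window of scales so
    short, depending on [z], that this displacement is nearly constant; the neighbourhood of the
    identity is chosen just as small, so that forming the control function does not spread the test
    function beyond the given cube. *)

Lemma le_poweR (x y : \bar R) (r : R) : (0 <= r)%R -> 0 <= x -> x <= y -> x `^ r <= y `^ r.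
Proof.
move=> r0 x0 xy; apply: gt0_ler_poweR => //; rewrite in_itv/= leey andbT//.
exact: le_trans xy.
Qed.

Lemma poweRK (x : \bar R) (r : R) : r != 0%R -> 0 <= x -> (x `^ r) `^ r^-1 = x.
Proof. by move=> r0 x0; rewrite -poweRrM mulfV// poweRe1. Qed.

Lemma poweRVK (x : \bar R) (r : R) : r != 0%R -> 0 <= x -> (x `^ r^-1) `^ r = x.
Proof. by move=> r0 x0; rewrite -poweRrM mulVf// poweRe1. Qed.

(** The integral is a supremum over the simple functions below the integrand, and a larger integrand
    admits more of them. *)
Lemma ge0_le_integral_nm d (T : measurableType d) (mu : {measure set T -> \bar R})
    (D : set T) (f g : T -> \bar R) :
  (forall t, D t -> 0 <= f t) -> (forall t, D t -> f t <= g t) ->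
  \int[mu]_(x in D) f x <= \int[mu]_(x in D) g x.
Proof.
move=> f0 fg; rewrite !(integral_mkcond D) !ge0_integralTE.
- apply: le_ereal_sup => _ [h hf <-]; exists h => // z.
  by apply: le_trans (hf z) _; apply: lee_restrict.
- by move=> z; apply: erestrict_ge0 => t Dt; apply: le_trans (fg _ Dt); exact: f0.
- by move=> z; exact: erestrict_ge0.
Qed.

Lemma esum_ge1 (I : choiceType) (f : I -> \bar R) i : (forall i, 0 <= f i) -> f i <= \esum_(i in [set: I]) f i.
Proof.
move=> f0; rewrite -(esum_set1 (f0 i)) [leRHS](esumID [set i])// setTI leeDl//.
by apply: esum_ge0.
Qed.

Lemma measurable_fun_poweR d (T : measurableType d) (D : set T) (f : T -> \bar R)
    (r : R) : measurable_fun D f -> measurable_fun D (fun t => f t `^ r).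
Proof. by move=> mf; exact: (measurableT_comp (measurable_poweR r) mf). Qed.

Section esum_tools.
Variable I : countType.
Implicit Type f : I -> \bar R.

(** Enumeration by [pickle], with 0 at the numbers that encode nothing; it carries measurability and
    monotone convergence from series over to sums over a countable type. *)
Lemma esum_nneseries f : (forall i, 0 <= f i) ->
  \esum_(i in [set: I]) f i = \sum_(k <oo) oapp f 0 (pickle_inv k : option I).
Proof.
move=> f0.
rewrite nneseries_esumT; last by move=> k; case: pickle_inv => /=.
rewrite [RHS](esumID (range (@pickle I)))//; last by move=> k _; case: pickle_inv.
rewrite [X in _ = _ + X]esum1 ?adde0; last first.
  move=> k [_ /= nk]; have := pickle_invK (T := I) k.
  by case: pickle_inv => //= i ik; exfalso; apply: nk; exists i.
rewrite setTI esum_image; last by move=> i j _ _; exact: (pcan_inj pickleK_inv).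
by apply: eq_esum => i _; rewrite pickleK_inv.
Qed.

Lemma esum_mulrl f (c : \bar R) : 0 <= c -> (forall i, 0 <= f i) ->
  \esum_(i in [set: I]) (c * f i) = c * \esum_(i in [set: I]) f i.
Proof.
move=> c0 f0; have [c_oo|c_noo] := eqVneq c +oo.
  subst c.
  have [f_eq0|/existsNP[i /eqP fi]] := pselect (forall i, f i = 0).
    by rewrite !esum1 ?mule0// => i _; rewrite f_eq0 mule0.
  have fi0 : 0 < f i by rewrite lt_neqAle eq_sym fi f0.
  rewrite gt0_mulye; last by apply: lt_le_trans fi0 _; exact: esum_ge1.
  apply/eqP; rewrite eq_le leey/=.
  apply: le_trans (esum_ge1 (f := fun i => +oo * f i) i _); first by rewrite gt0_mulye.
  by move=> j; exact: mule_ge0.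
have cfin : c \is a fin_num by rewrite ge0_fin_numE// lt_neqAle c_noo leey.
rewrite -(fineK cfin) !esum_nneseries//; last first.
  by move=> i; apply: mule_ge0 => //; rewrite fineK.
rewrite -nneseriesZl; last by move=> k _; case: pickle_inv.
by apply: eq_eseriesr => k _; case: pickle_inv => //=; rewrite mule0.
Qed.

Lemma measurable_fun_esum d (T : measurableType d) (D : set T)
    (f : I -> T -> \bar R) : measurable D ->
  (forall i, measurable_fun D (f i)) -> (forall i t, 0 <= f i t) ->
  measurable_fun D (fun x => \esum_(i in [set: I]) f i x).
Proof.
move=> mD mf f0.
rewrite (_ : (fun _ => _) =
  fun x => \sum_(k <oo) oapp (f ^~ x) 0 (pickle_inv k : option I)); last first.
  by apply/funext => x; rewrite esum_nneseries.
apply: ge0_emeasurable_sum => //; first by move=> k x _ _; case: pickle_inv => /=.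
by move=> k _; case: pickle_inv => [i|] /=; [exact: mf|exact: measurable_cst].
Qed.

Lemma ge0_integral_esum d (T : measurableType d) (mu : {measure set T -> \bar R})
    (D : set T) (f : I -> T -> \bar R) : measurable D ->
  (forall i, measurable_fun D (f i)) -> (forall i t, 0 <= f i t) ->
  \int[mu]_(x in D) (\esum_(i in [set: I]) f i x) =
  \esum_(i in [set: I]) \int[mu]_(x in D) f i x.
Proof.
move=> mD mf f0.
under eq_integral do rewrite esum_nneseries//.
rewrite integral_nneseries//; last 2 first.
  by move=> k; case: pickle_inv => [i|] /=; [exact: mf|exact: measurable_cst].
  by move=> k x _; case: pickle_inv => /=.
rewrite esum_nneseries//; last by move=> i; apply: integral_ge0.
apply: eq_eseriesr => k _; case: pickle_inv => [i|] //=.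
by rewrite integral0.
Qed.

End esum_tools.

Lemma sume_cst (I : Type) (s : seq I) (M : \bar R) : 0 <= M ->
  \sum_(i <- s) M = (size s)%:R%:E * M.
Proof.
move=> M0; elim: s => [|i s ih]; first by rewrite big_nil mul0e.
rewrite big_cons ih /= -[(size s).+1]add1n natrD EFinD ge0_muleDl ?mul1e// lee_fin.
Qed.

Section esum_overlap.
Variable I : choiceType.
Implicit Type f : I -> \bar R.

Lemma esum_le_card f (N : nat) (M : \bar R) : (forall i, 0 <= f i) ->
  ([set i | f i != 0%R] #<= `I_N)%card -> 0 <= M -> (forall i, f i <= M) ->
  \esum_(i in [set: I]) f i <= N%:R%:E * M.
Proof.
move=> f0 cN M0 fM; set S := [set i | f i != 0%R] in cN.
have finS : finite_set S by apply/finite_set_leP; exists N.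
rewrite (esumID S)// [X in _ + X]esum1 ?adde0; last first.
  by move=> i [_ /= /negP]; rewrite negbK => /eqP.
rewrite setTI esum_fset// fsbig_finite//=.
have le1 : \sum_(i <- finmap.enum_fset (fset_set S)) f i <= \sum_(i <- finmap.enum_fset (fset_set S)) M by exact: lee_sum.
apply: le_trans le1 _.
rewrite sume_cst//.
by apply: lee_wpmul2r => //; rewrite lee_fin ler_nat; exact: geq_card_fset_set.
Qed.

(** Each of the at most [N] nonzero terms is bounded by the power of the whole sum. *)
Lemma esum_poweR_le f (N : nat) (r : R) : (0 < r)%R -> (forall i, 0 <= f i) ->
  ([set i | f i != 0%R] #<= `I_N)%card ->
  \esum_(i in [set: I]) (f i `^ r) <= N%:R%:E * (\esum_(i in [set: I]) f i) `^ r.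
Proof.
move=> r0 f0 cN; apply: esum_le_card => //.
- by move=> i; exact: poweR_ge0.
- apply: card_le_trans cN; apply: subset_card_le => i /=.
  by apply: contra_neq => ->; rewrite poweR0r// gt_eqF.
- exact: poweR_ge0.
- by move=> i; apply: le_poweR => //; [exact: ltW|exact: esum_ge1].
Qed.

Lemma poweR_esum_le f (N : nat) (r : R) : (0 < r)%R -> (forall i, 0 <= f i) ->
  ([set i | f i != 0%R] #<= `I_N)%card ->
  (\esum_(i in [set: I]) f i) `^ r <= (N%:R `^ r)%:E * \esum_(i in [set: I]) (f i `^ r).
Proof.
move=> r0 f0 cN; set S := \esum_(i in _) (f i `^ r).
have S0 : 0 <= S by apply: esum_ge0 => i _; exact: poweR_ge0.
(* Every [f i] is at most [S] to the power [r^-1], so the claim is the [r]-th power of a count of at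
   most [N] terms. *)
rewrite -[X in _ <= _ * X](@poweRVK S r) ?gt_eqF// -poweR_EFin -poweRM//; last first.
  exact: poweR_ge0.
apply: le_poweR; [exact: ltW|exact: esum_ge0|apply: esum_le_card => //].
  exact: poweR_ge0.
move=> i; rewrite -(@poweRK (f i) r) ?gt_eqF//; apply: le_poweR.
- by rewrite invr_ge0 ltW.
- exact: poweR_ge0.
- by apply: (esum_ge1 (f := fun i => f i `^ r)) => j; exact: poweR_ge0.
Qed.

End esum_overlap.

Lemma poweR_sum_le (I : eqType) (s : seq I) (f : I -> \bar R) (r : R) : (0 < r)%R ->
  (forall i, 0 <= f i) ->
  (\sum_(i <- s) f i) `^ r <= ((size s)%:R `^ r)%:E * \sum_(i <- s) (f i `^ r).
Proof.
move=> r0 f0; set S := \sum_(i <- s) (f i `^ r).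
have S0 : 0 <= S by apply: sume_ge0 => i _; exact: poweR_ge0.
rewrite -[X in _ <= _ * X](@poweRVK S r) ?gt_eqF// -poweR_EFin -poweRM//; last first.
  exact: poweR_ge0.
apply: le_poweR; [exact: ltW|exact: sume_ge0|].
have le1 : \sum_(i <- s) f i <= \sum_(i <- s) (S `^ r^-1); last first.
  by apply: le_trans le1 _; rewrite sume_cst// poweR_ge0.
rewrite !big_seq; apply: lee_sum => i si.
rewrite -[leLHS](@poweRK (f i) r) ?gt_eqF//; apply: le_poweR.
- by rewrite invr_ge0 ltW.
- exact: poweR_ge0.
- rewrite /S (big_rem i)//= leeDl// sume_ge0// => j _; exact: poweR_ge0.
Qed.

End ereal_tools.

(** * Lebesgue measure under translations and dilations *)

Section lebesgue_affine.
Context {R : realType}.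
Local Open Scope ereal_scope.
Local Notation leb := (@lebesgue_measure R).

Lemma lebesgue_measure_shift (c : R) (A : set R) : measurable A ->
  leb ((fun y => (y + c)%R) @^-1` A) = leb A.
Proof.
move=> mA.
change (pushforward leb (fun y : measurableTypeR R => (y + c : measurableTypeR R)%R) A = leb A).
apply/esym/lebesgue_measure_unique => //=.
  by move=> _; exact: measurable_funD.
move=> mf _ [[a b]] _ <-; rewrite /pushforward.
rewrite (_ : _ @^-1` _ = `](a - c)%R, (b - c)%R]%classic); last first.
  by apply/seteqP; split => y /=; rewrite !in_itv/= ltrBlDr lerBrDr.
rewrite !lebesgue_measure_itv/= !lte_fin ltrD2r -!EFinD.
by rewrite opprD opprK addrACA addNr addr0.
Qed.

Lemma lebesgue_measure_scale (t : R) (A : set R) : (0 < t)%R -> measurable A ->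
  leb (( *%R t) @^-1` A) = t^-1%:E * leb A.
Proof.
move=> t0 mA.
have tn0 : (0 <= t)%R by exact: ltW.
(* Lebesgue measure is characterised by its values on half-open intervals, which the pushforward
   multiplied by [t] shares. *)
suff <- : t%:E * pushforward leb (fun y : measurableTypeR R => (t * y : measurableTypeR R)%R) A = leb A.
  by rewrite muleA -EFinM mulVf ?mul1e// gt_eqF.
change (pushforward (mscale (NngNum tn0) leb) (fun y : measurableTypeR R => (t * y : measurableTypeR R)%R) A = leb A).
apply/esym/lebesgue_measure_unique => //=.
  by move=> _; exact: measurable_funM.
move=> mf _ [[a b]] _ <-; rewrite /pushforward /mscale /=.
rewrite (_ : _ @^-1` _ = `](a / t)%R, (b / t)%R]%classic); last first.
  by apply/seteqP; split => y /=; rewrite !in_itv/= ltr_pdivrMr// ler_pdivlMr// mulrC.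
rewrite !lebesgue_measure_itv/= !lte_fin ltr_pM2r ?invr_gt0//.
case: ifP => _; last by rewrite mule0.
by rewrite -!EFinD -EFinM -mulrBl mulrCA mulfV ?mulr1// gt_eqF.
Qed.

Lemma ge0_integral_scale (t : R) (f : R -> \bar R) : (0 < t)%R ->
  (forall a, (0 < a)%R -> 0 <= f a) -> measurable_fun (`]0%R, +oo[%classic : set (measurableTypeR R)) f ->
  \int[leb]_(a in `]0%R, +oo[) f (t * a)%R = t^-1%:E * \int[leb]_(a in `]0%R, +oo[) f a.
Proof.
move=> t0 f0 mf.
have tn0 : (0 <= t^-1)%R by rewrite invr_ge0 ltW.
have mt : measurable_fun [set: measurableTypeR R] (fun y : measurableTypeR R => (t * y : measurableTypeR R)%R).
  exact: measurable_funM.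
have f0' : forall a, `]0%R, +oo[%classic a -> 0 <= f a.
  by move=> a /=; rewrite in_itv/= andbT; exact: f0.
rewrite -(@ge0_integral_mscale _ _ _ leb _ _ (NngNum tn0))//.
transitivity (\int[pushforward leb (fun y : measurableTypeR R => (t * y : measurableTypeR R)%R)]_(a in `]0%R, +oo[) f a).
  rewrite ge0_integral_pushforward//; last by move=> a; rewrite inE; exact: f0'.
  rewrite (_ : _ @^-1` _ = `]0%R, +oo[%classic)//.
  by apply/seteqP; split => y /=; rewrite !in_itv/= !andbT pmulr_rgt0.
apply: eq_measure_integral => A mA _.
exact: lebesgue_measure_scale.
Qed.

End lebesgue_affine.

(** * The weighted norm on the half-line *)

Section mixed_norm.
Context {R : realType}.
Local Open Scope ereal_scope.
Local Notation leb := (@lebesgue_measure R).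
Local Notation Rpos := (`]0%R, +oo[%classic : set (measurableTypeR R)).
Variables (n : nat) (p : R) (q : \bar R).

(** Applied to the fibre integrals of a function on the group, this is its quasi-norm by conversion.
    The exponent [r / p] appears because [f] already stands for a [p]-th power. *)
Definition mixed_norm (f : R -> \bar R) : \bar R :=
  match q with
  | r%:E =>
      (\int[lebesgue_measure]_(a in `]0%R, +oo[)
         (f a `^ (r / p) * (a ^- n.+1)%:E)) `^ r^-1
  | _ => ess_sup (mrestr lebesgue_measure (measurable_itv `]0%R, +oo[))
           (fun a => f a `^ p^-1)
  end.

Lemma Rpos_gt0 (a : R) : Rpos a = (0 < a)%R :> Prop.
Proof. by rewrite /= in_itv/= andbT. Qed.

Lemma measurable_expfN (m : nat) : measurable_fun Rpos (fun a : R => (a ^- m)%:E).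
Proof.
apply/measurable_EFinP.
apply: (eq_measurable_fun (fun a : R => a `^ (- m%:R))%R).
  move=> a; rewrite inE Rpos_gt0 => a0.
  by rewrite powRN powR_mulrn// ltW.
by apply: measurable_funTS; exact: measurable_powR.
Qed.

Lemma measurable_dilate (t : R) (g : R -> \bar R) : (0 < t)%R -> measurable_fun Rpos g ->
  measurable_fun Rpos (fun a => g (t * a)%R).
Proof.
move=> t0 mg.
have mt : measurable_fun Rpos (fun a : measurableTypeR R => (t * a)%R : measurableTypeR R).
  by apply: measurable_funTS; exact: measurable_funM.
apply: (@measurable_comp _ _ _ _ _ _ Rpos) => //.
by move=> _ [a + <-]; rewrite !Rpos_gt0 => a0; rewrite mulr_gt0.
Qed.

#[global] Instance ae_Rpos_filter :
  Filter (nbhs (almost_everywhere (mrestr leb (measurable_itv `]0%R, +oo[)))) :=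
  ae_filter_ringOfSetsType _.

Lemma ae_Rpos : \forall a \ae mrestr leb (measurable_itv `]0%R, +oo[), (0 < a)%R.
Proof.
exists (~` Rpos); split.
- by apply: measurableC; exact: measurable_itv.
- by rewrite /mrestr setICl measure0.
- by move=> a /= a0 /=; rewrite in_itv/= andbT.
Qed.

Lemma ae_dilate (t : R) (P : R -> Prop) : (0 < t)%R ->
  (\forall a \ae mrestr leb (measurable_itv `]0%R, +oo[), P a) ->
  \forall a \ae mrestr leb (measurable_itv `]0%R, +oo[), P (t * a)%R.
Proof.
move=> t0 [N [mN N0 PN]].
have mt : measurable_fun [set: measurableTypeR R] (fun a : measurableTypeR R => (t * a)%R : measurableTypeR R).
  exact: measurable_funM.
have mtN : measurable (( *%R t) @^-1` N : set (measurableTypeR R)).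
  by rewrite -[X in measurable X]setTI; exact: mt.
exists (( *%R t) @^-1` N); split => //; last by move=> a /PN.
rewrite /mrestr; transitivity (leb (( *%R t) @^-1` (N `&` Rpos))).
  congr (leb _); apply/seteqP; split => a /=; rewrite !in_itv/= !andbT pmulr_rgt0//.
rewrite lebesgue_measure_scale//; last by apply: measurableI => //; exact: measurable_itv.
by rewrite [X in _ * X]N0 mule0.
Qed.

Lemma mrestr_Rpos_gt0 : 0 < mrestr leb (measurable_itv `]0%R, +oo[) [set: R].
Proof. by rewrite /mrestr setTI lebesgue_measure_itv/= ltry /= ltry. Qed.

Hypotheses (p0 : (0 < p)%R) (q0 : 0 < q).

Lemma mixed_norm_ge0 f : 0 <= mixed_norm f.
Proof.
rewrite /mixed_norm; case: q => [r||]; first exact: poweR_ge0.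
- by apply: (ess_sup_gee mrestr_Rpos_gt0); apply: aeW => a; exact: poweR_ge0.
- by apply: (ess_sup_gee mrestr_Rpos_gt0); apply: aeW => a; exact: poweR_ge0.
Qed.

Lemma le_mixed_norm f g : (forall a, (0 < a)%R -> 0 <= f a) ->
  (forall a, (0 < a)%R -> f a <= g a) -> mixed_norm f <= mixed_norm g.
Proof.
move=> f0 fg; rewrite /mixed_norm; case: q q0 => [r r0|_|//]; last first.
  apply: le_ess_sup; apply: filterS ae_Rpos => a a0.
  by apply: le_poweR; [rewrite invr_ge0 ltW|exact: f0|exact: fg].
rewrite lte_fin in r0.
apply: le_poweR; first by rewrite invr_ge0 ltW.
  apply: integral_ge0 => a; rewrite -/(Rpos a) Rpos_gt0 => a0.
  by apply: mule_ge0; [exact: poweR_ge0|rewrite lee_fin invr_ge0 exprn_ge0// ltW].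
apply: ge0_le_integral_nm => a; rewrite -/(Rpos a) Rpos_gt0 => a0.
  by apply: mule_ge0; [exact: poweR_ge0|rewrite lee_fin invr_ge0 exprn_ge0// ltW].
apply: lee_wpmul2r; first by rewrite lee_fin invr_ge0 exprn_ge0// ltW.
by apply: le_poweR; [rewrite divr_ge0// ltW|exact: f0|exact: fg].
Qed.

Lemma mixed_normZ (c : R) f : (0 <= c)%R -> (forall a, (0 < a)%R -> 0 <= f a) ->
  measurable_fun Rpos f ->
  mixed_norm (fun a => c%:E * f a) = (c `^ p^-1)%:E * mixed_norm f.
Proof.
move=> c0 f0 mf; rewrite /mixed_norm; case: q q0 => [r r0|_|//]; last first.
  rewrite -[RHS]ess_supZl ?powR_ge0//; last exact: mrestr_Rpos_gt0.
  apply: eq_ess_sup; apply: filterS ae_Rpos => a a0 /=.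
  by rewrite -poweR_EFin -poweRM// ?lee_fin// f0.
rewrite lte_fin in r0.
rewrite (_ : \int[_]_(a in _) _ = (c `^ (r / p))%:E * \int[leb]_(a in `]0%R, +oo[)
         (f a `^ (r / p) * (a ^- n.+1)%:E)).
  rewrite poweRM; last 2 first.
    by rewrite lee_fin powR_ge0.
    apply: integral_ge0 => a; rewrite -/(Rpos a) Rpos_gt0 => a0.
    by apply: mule_ge0; [exact: poweR_ge0|rewrite lee_fin invr_ge0 exprn_ge0// ltW].
  by rewrite poweR_EFin -powRrM mulrAC mulfV ?mul1r// gt_eqF.
rewrite -ge0_integralZl//.
- apply: eq_integral => a; rewrite inE Rpos_gt0 => a0.
  by rewrite muleA poweRM// ?lee_fin// f0.
- apply: emeasurable_funM => //; last exact: measurable_expfN.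
  exact: measurable_fun_poweR.
- move=> a; rewrite -/(Rpos a) Rpos_gt0 => a0.
  by apply: mule_ge0; [exact: poweR_ge0|rewrite lee_fin invr_ge0 exprn_ge0// ltW].
- by rewrite lee_fin powR_ge0.
Qed.

Lemma mixed_norm_le_dilates (ts : seq R) (C : R) : (forall t, t \in ts -> 0 < t)%R ->
  (0 <= C)%R -> exists2 C' : R, (0 < C')%R & forall f g,
  (forall a, (0 < a)%R -> 0 <= f a) -> (forall a, (0 < a)%R -> 0 <= g a) ->
  measurable_fun Rpos g ->
  (forall a, (0 < a)%R -> f a <= C%:E * \sum_(t <- ts) g (t * a)%R) ->
  mixed_norm f <= C'%:E * mixed_norm g.
Proof.
move=> ts0 C0.
suff [C' C'0 H] : exists2 C' : R, (0 <= C')%R & forall f g,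
  (forall a, (0 < a)%R -> 0 <= f a) -> (forall a, (0 < a)%R -> 0 <= g a) ->
  measurable_fun Rpos g ->
  (forall a, (0 < a)%R -> f a <= C%:E * \sum_(t <- ts) g (t * a)%R) ->
  mixed_norm f <= C'%:E * mixed_norm g.
  exists (C' + 1)%R; first by rewrite ltr_wpDl.
  move=> f g f0 g0 mg fg; apply: le_trans (H f g f0 g0 mg fg) _.
  by apply: lee_wpmul2r; [exact: mixed_norm_ge0|rewrite lee_fin lerDl].
rewrite /mixed_norm; case: q q0 => [r r0|_|//]; last first.
  exists (C `^ p^-1 * (size ts)%:R `^ p^-1 * (size ts)%:R)%R.
    by rewrite !mulr_ge0// powR_ge0.
  move=> f g f0 g0 mg fg; set M := (X in _ <= _ * X).
  have M0 : 0 <= M.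
    by apply: (ess_sup_gee mrestr_Rpos_gt0); apply: aeW => a; exact: poweR_ge0.
  apply/ess_supP.
  (* Dilations preserve null sets, so the essential bound on [g] holds for each of the finitely many
     dilates, off one common null set. *)
  have gM t : t \in ts -> \forall a \ae mrestr leb (measurable_itv `]0%R, +oo[),
      g (t * a)%R `^ p^-1 <= M.
    by move=> /ts0 t0; apply: (ae_dilate (P := fun a => g a `^ p^-1 <= M)) => //; exact: ess_sup_ge.
  have {}gM : \forall a \ae mrestr leb (measurable_itv `]0%R, +oo[),
      forall t, t \in ts -> g (t * a)%R `^ p^-1 <= M.
    elim: (ts) gM => [|t s ih] gM; first by apply: nearW => a t; rewrite in_nil.
    have h1 := gM t (mem_head _ _).
    have h2 := ih (fun t' h => gM t' (mem_behead (s := t :: s) h)).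
    apply: filterS2 h1 h2 => a h1 h2 t'; rewrite inE => /predU1P[->//|]; exact: h2.
  apply: filterS2 ae_Rpos gM => a a0 gM.
  have gt0 t : t \in ts -> 0 <= g (t * a)%R by move=> /ts0 t0; rewrite g0// mulr_gt0.
  apply: (@le_trans _ _ ((C%:E * \sum_(t <- ts) g (t * a)%R) `^ p^-1)).
    by apply: le_poweR; [rewrite invr_ge0 ltW|exact: f0|exact: fg].
  rewrite poweRM ?lee_fin//; last by rewrite big_seq sume_ge0.
  rewrite -mulrA EFinM -poweR_EFin -muleA lee_wpmul2l ?poweR_ge0//.
  (* [g] is controlled at positive arguments only; the value 0 for other [t] gives the nonnegativity
     at every index that the power estimate asks for. *)
  pose g' t := if t \in ts then g (t * a)%R else 0.
  rewrite (_ : \sum_(t <- ts) _ = \sum_(t <- ts) g' t); last first.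
    by rewrite !big_seq; apply: eq_bigr => t tts; rewrite /g' tts.
  apply: le_trans (poweR_sum_le _ _ _) _.
  - by rewrite invr_gt0.
  - by move=> t; rewrite /g'; case: ifPn => // /gt0.
  rewrite EFinM -muleA lee_wpmul2l ?lee_fin ?powR_ge0// -sume_cst//.
  by rewrite !big_seq; apply: lee_sum => t tts; rewrite /g' tts; exact: gM.
rewrite lte_fin in r0.
have s0 : (0 < r / p)%R by rewrite divr_gt0.
(* Passing from [a] to [t * a], the density gives [t ^+ n.+1] and the change of variable [t^-1];
   what remains is [t ^+ n]. The two other factors come from [C] and from the number of dilates. *)
pose A := (C `^ (r / p) * (size ts)%:R `^ (r / p) * \sum_(t <- ts) `|t| ^+ n)%R.
have A0 : (0 <= A)%R by rewrite !mulr_ge0 ?powR_ge0// sumr_ge0.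
exists (A `^ r^-1)%R; first exact: powR_ge0.
move=> f g f0 g0 mg fg.
pose G b := g b `^ (r / p) * (b ^- n.+1)%:E.
have G0 b : (0 < b)%R -> 0 <= G b.
  by move=> b0; apply: mule_ge0; [exact: poweR_ge0|rewrite lee_fin invr_ge0 exprn_ge0// ltW].
have mG : measurable_fun Rpos G.
  apply: emeasurable_funM => //; last exact: measurable_expfN.
  exact: measurable_fun_poweR.
have GR b : Rpos b -> 0 <= G b by rewrite Rpos_gt0; exact: G0.
rewrite -poweR_EFin -poweRM ?lee_fin//; last by apply: integral_ge0 => a; exact: GR.
apply: le_poweR; first by rewrite invr_ge0 ltW.
  apply: integral_ge0 => a; rewrite -/(Rpos a) Rpos_gt0 => a0.
  by apply: mule_ge0; [exact: poweR_ge0|rewrite lee_fin invr_ge0 exprn_ge0// ltW].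
pose G' t a := if t \in ts then (`|t| ^+ n.+1)%:E * G (t * a)%R else 0.
have mG' t : measurable_fun Rpos (G' t).
  rewrite /G'; have [tts|_] := boolP (t \in ts); last exact: measurable_cst.
  by apply: emeasurable_funM => //; apply: measurable_dilate => //; exact: ts0.
have G'0 t a : Rpos a -> 0 <= G' t a.
  rewrite Rpos_gt0 /G' => a0; case: ifPn => // tts.
  apply: mule_ge0; first by rewrite lee_fin exprn_ge0.
  by apply: G0; rewrite mulr_gt0// ts0.
apply: (@le_trans _ _ (\int[leb]_(a in `]0%R, +oo[)
   ((C `^ (r / p) * (size ts)%:R `^ (r / p))%:E * \sum_(t <- ts) G' t a))).
  apply: ge0_le_integral_nm => a; rewrite -/(Rpos a) Rpos_gt0 => a0.
    by apply: mule_ge0; [exact: poweR_ge0|rewrite lee_fin invr_ge0 exprn_ge0// ltW].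
  have a_ge0 : 0%R <= (a ^- n.+1)%:E by rewrite lee_fin invr_ge0 exprn_ge0// ltW.
  pose g' t := if t \in ts then g (t * a)%R else 0.
  have g'0 t : 0 <= g' t.
    by rewrite /g'; case: ifPn => // /ts0 t0; rewrite g0// mulr_gt0.
  have fg' : f a <= C%:E * \sum_(t <- ts) g' t.
    apply: le_trans (fg _ a0) _; rewrite lee_wpmul2l ?lee_fin//.
    by rewrite !big_seq; apply: lee_sum => t tts; rewrite /g' tts.
  apply: (@le_trans _ _ ((C%:E * \sum_(t <- ts) g' t) `^ (r / p) * (a ^- n.+1)%:E)).
    by rewrite lee_wpmul2r//; apply: le_poweR => //; [exact: ltW|exact: f0].
  rewrite poweRM ?lee_fin ?sume_ge0// EFinM -!muleA lee_wpmul2l// ?lee_fin ?powR_ge0//.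
  apply: (@le_trans _ _ (((size ts)%:R `^ (r / p))%:E * (\sum_(t <- ts) g' t `^ (r / p)) *
     (a ^- n.+1)%:E)).
    by rewrite lee_wpmul2r//; apply: poweR_sum_le.
  rewrite -muleA lee_wpmul2l ?lee_fin ?powR_ge0// ge0_sume_distrl; last first.
    by move=> t _; exact: poweR_ge0.
  rewrite !big_seq; apply: lee_sum => t tts; rewrite /g' /G' tts /G.
  rewrite muleCA; rewrite lee_wpmul2l ?poweR_ge0// -EFinM lee_fin.
  have t0 := ts0 _ tts.
  by rewrite gtr0_norm// exprMn invfM mulrA mulfV ?mul1r// expf_neq0// gt_eqF.
rewrite ge0_integralZl//; last 3 first.
- exact: emeasurable_sum.
- by move=> a Ra; apply: sume_ge0 => t _; exact: G'0.
- by rewrite lee_fin mulr_ge0// powR_ge0.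
rewrite [A%:E]EFinM -muleA lee_wpmul2l ?lee_fin ?mulr_ge0 ?powR_ge0//.
rewrite ge0_integral_sum//.
rewrite -sumEFin ge0_sume_distrl; last by move=> t _; rewrite lee_fin exprn_ge0.
rewrite !big_seq; apply: lee_sum => t tts.
have t0 := ts0 _ tts.
rewrite /G' tts; rewrite ge0_integralZl ?lee_fin ?exprn_ge0//; last 2 first.
- exact: (measurable_dilate t0 mG).
- by move=> a; rewrite -/(Rpos a) Rpos_gt0 => a0; apply: G0; rewrite mulr_gt0.
rewrite (ge0_integral_scale t0 G0 mG) muleA -EFinM gtr0_norm// exprSr -mulrA.
by rewrite mulfV ?mulr1// gt_eqF.
Qed.

End mixed_norm.

(** * Doubling weights and cubes *)

Section geometry.
Context {R : realType} {n : nat}.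
Local Notation GT := ('rV[R]_n * R)%type.
Implicit Types (v : 'rV[R]_n -> R) (x y : 'rV[R]_n).

Definition cube x (r : R) : set 'rV[R]_n :=
  [set y | forall i, `|y ord0 i - x ord0 i| < r].

Lemma sub_cube x x' (r d r' : R) : (forall i, `|x ord0 i - x' ord0 i| <= d) ->
  r + d <= r' -> cube x r `<=` cube x' r'.
Proof.
move=> xd rd y yx i; apply: lt_le_trans rd.
rewrite (_ : _ - _ = (y ord0 i - x ord0 i) + (x ord0 i - x' ord0 i)); last by ring.
by apply: (le_lt_trans (ler_normD _ _)); rewrite ltr_leD.
Qed.

Lemma eball_cube x (r : R) : eball x r `<=` cube x r.
Proof.
move=> y yr i; apply: le_lt_trans yr.
rewrite -sqrtr_sqr ler_wsqrtr// (bigD1 i)//= lerDl sumr_ge0// => j _.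
exact: sqr_ge0.
Qed.

(** [n.+1] is a crude majorant of the square root of [n] that keeps the inequality strict. *)
Lemma cube_eball x (r : R) : 0 < r -> cube x r `<=` eball x (n.+1%:R * r).
Proof.
move=> r0 y yr; rewrite /eball /=.
apply: (@le_lt_trans _ _ (Num.sqrt (\sum_(i < n) r ^+ 2))).
  apply: ler_wsqrtr; apply: ler_sum => i _.
  rewrite -[leLHS]real_normK ?num_real//; apply: lerXn2r; rewrite ?nnegrE ?(ltW r0)//.
  exact/ltW/yr.
have N0 : 0 < n.+1%:R * r by rewrite mulr_gt0.
rewrite sumr_const card_ord -[ltRHS](gtr0_norm N0) -sqrtr_sqr ltr_sqrt ?exprn_gt0//.
rewrite exprMn -[ltLHS]mulr_natl ltr_pM2r ?exprn_gt0//.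
by rewrite -natrX ltr_nat (leq_trans (ltnSn n))// -{1}(expn1 n.+1) leq_pexp2l.
Qed.

Lemma measurable_cube x (r : R) : measurable (cube x r).
Proof.
rewrite (_ : cube x r = \bigcap_(i in [set: 'I_n]) ((fun y => y ord0 i) @^-1` ball (x ord0 i) r)).
  apply: fin_bigcap_measurable; first exact: finite_finset.
  move=> i _; rewrite -[X in measurable X]setTI.
  by apply: (@measurable_rV_coor _ _ n i) => //; exact: measurable_ball.
apply/seteqP; split => [y yr i _ /=|y yr i].
  by rewrite /ball/= distrC; exact: yr.
by have := yr i Logic.I; rewrite /= /ball/= distrC.
Qed.

Local Open Scope ereal_scope.

Lemma wmass_ge0 v A : (forall x, 0 < v x)%R -> 0 <= wmass v A.
Proof. by move=> v0; apply: integral_ge0 => x _; rewrite lee_fin ltW. Qed.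

Lemma le_wmass v (A B : set 'rV[R]_n) : (forall x, 0 < v x)%R -> A `<=` B ->
  wmass v A <= wmass v B.
Proof.
move=> v0 AB; rewrite /wmass integral_mkcond [leRHS]integral_mkcond.
have ve0 x : 0 <= (v x)%:E by rewrite lee_fin ltW.
apply: ge0_le_integral_nm => x _; rewrite !patchE; first by case: ifP.
case: ifPn => [|_]; last by case: ifP.
by rewrite inE => /AB xB; rewrite mem_set.
Qed.

Lemma wmass_indic v (A : set 'rV[R]_n) :
  \int[vol n]_x ((\1_A x)%:E * (v x)%:E) = wmass v A.
Proof.
rewrite /wmass [RHS]integral_mkcond; apply: eq_integral => x _.
by rewrite patchE indicE; case: ifP => _; rewrite ?mul1e ?mul0e.
Qed.

Lemma doubling_iter v : (forall x, 0 < v x)%R -> doubling v -> forall k : nat,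
  exists2 C : R, (0 < C)%R & forall x r, (0 < r)%R ->
    wmass v (eball x (2 ^+ k * r)) <= C%:E * wmass v (eball x r).
Proof.
move=> v0 [C0 H0].
have [C C1 H] : exists2 C : R, (0 < C)%R & forall x r, (0 < r)%R ->
    wmass v (eball x (2 * r)) <= C%:E * wmass v (eball x r).
  exists (`|C0| + 1)%R => [|x r r0]; first by rewrite ltr_wpDl.
  apply: le_trans (H0 x r r0) _; apply: lee_wpmul2r; first exact: wmass_ge0.
  by rewrite lee_fin ler_wpDr// ler_norm.
elim=> [|k [Ck Ck0 ih]].
  by exists 1%R => // x r r0; rewrite expr0 mul1r mul1e.
exists (C * Ck)%R => [|x r r0]; first exact: mulr_gt0.
rewrite exprS -mulrA EFinM -muleA; apply: le_trans (H _ _ _) _.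
  by rewrite mulr_gt0// exprn_gt0.
by rewrite lee_wpmul2l ?lee_fin ?(ltW C1)//; exact: ih.
Qed.

Lemma exp2_ge (M : R) : exists k : nat, (M <= 2 ^+ k)%R.
Proof.
exists (Num.truncn M).+1; apply: ltW.
apply: lt_le_trans (truncnS_gt M) _.
by rewrite -natrX ler_nat ltnW// ltn_expl.
Qed.

Lemma doubling_cube_le v : (forall x, 0 < v x)%R -> doubling v -> forall M : R, (0 < M)%R ->
  exists2 C : R, (0 < C)%R & forall x r, (0 < r)%R ->
    wmass v (cube x (M * r)) <= C%:E * wmass v (eball x r).
Proof.
move=> v0 dv M M0; have [k Mk] := exp2_ge (n.+1%:R * M).
have [C C0 H] := doubling_iter v0 dv k; exists C => // x r r0.
apply: le_trans (H _ _ r0); apply: le_wmass => //.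
apply: (@subset_trans _ (eball x (n.+1%:R * (M * r)))).
  by apply: cube_eball; exact: mulr_gt0.
by move=> y /=; rewrite /eball/= => /lt_le_trans; apply; rewrite mulrA ler_wpM2r// ltW.
Qed.

Lemma doubling_le_cube v : (forall x, 0 < v x)%R -> doubling v -> forall e : R, (0 < e)%R ->
  exists2 C : R, (0 < C)%R & forall x r, (0 < r)%R ->
    wmass v (eball x r) <= C%:E * wmass v (cube x (e * r)).
Proof.
move=> v0 dv e e0; have [k ek] := exp2_ge e^-1.
have [C C0 H] := doubling_iter v0 dv k; exists C => // x r r0.
apply: (@le_trans _ _ (wmass v (eball x (2 ^+ k * (e * r))))).
  apply: le_wmass => // y /lt_le_trans; apply.
  by rewrite mulrA ler_peMl ?(ltW r0)// -ler_pdivrMr// div1r.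
apply: le_trans (H _ _ _) _; first exact: mulr_gt0.
by rewrite lee_wpmul2l ?lee_fin ?(ltW C0)//; apply: le_wmass => //; exact: eball_cube.
Qed.

Lemma doubling_cubes v : (forall x, 0 < v x)%R -> doubling v ->
  forall M e : R, (0 < M)%R -> (0 < e)%R ->
  exists2 C : R, (0 < C)%R & forall x r, (0 < r)%R ->
    wmass v (cube x (M * r)) <= C%:E * wmass v (cube x (e * r)).
Proof.
move=> v0 dv M e M0 e0.
have [C C0 H] := doubling_cube_le v0 dv M0.
have [C' C'0 H'] := doubling_le_cube v0 dv e0.
exists (C * C')%R => [|x r r0]; first exact: mulr_gt0.
apply: le_trans (H _ _ r0) _; rewrite EFinM -muleA.
by rewrite lee_wpmul2l ?lee_fin ?(ltW C0)//; exact: H'.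
Qed.

End geometry.

(** * Group operations, and boxes inside and around neighbourhoods of the identity *)

Section group_geometry.
Context {R : realType} {n : nat}.
Local Notation GT := ('rV[R]_n * R)%type.
Implicit Types (g h : GT) (U K : set GT).

Lemma nbhs_box g U : nbhs g U ->
  exists2 e : R, 0 < e & forall h, cube g.1 e h.1 -> `|h.2 - g.2| < e -> U h.
Proof.
move=> /nbhs_ballP[e /= e0 eU]; exists e => // h h1 h2; apply: eU; split => /=.
  by split => // i j; rewrite (ord1 i) /ball/= distrC; exact: h1.
by rewrite /ball/= distrC.
Qed.

Lemma axbG_mul g h : axbG g -> axbG h -> axbG (axb_mul g h).
Proof. by rewrite /axbG/= => g0 h0; rewrite mulr_gt0. Qed.

Lemma axb_mulA g h k : axb_mul g (axb_mul h k) = axb_mul (axb_mul g h) k.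
Proof. by rewrite /axb_mul /= scalerDr scalerA addrA mulrA. Qed.

Lemma axb_mulVg g : axbG g -> axb_mul (axb_inv g) g = axb1.
Proof.
rewrite /axbG/= => g0; rewrite /axb_mul /axb_inv /axb1 /= addNr mulVf//.
by rewrite gt_eqF.
Qed.

Lemma axb_mulgV g : axbG g -> axb_mul g (axb_inv g) = axb1.
Proof.
rewrite /axbG/= => g0; rewrite /axb_mul /axb_inv /axb1 /= scalerN scalerA.
by rewrite mulfV ?gt_eqF// scale1r subrr.
Qed.

Lemma axb_mul1g g : axb_mul axb1 g = g.
Proof. by case: g => x a; rewrite /axb_mul /axb1 /= add0r scale1r mul1r. Qed.

Lemma axb_mulKg g h : axbG g -> axb_mul (axb_inv g) (axb_mul g h) = h.
Proof. by move=> g0; rewrite axb_mulA axb_mulVg// axb_mul1g. Qed.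

Lemma axb_mulVKg g h : axbG g -> axb_mul g (axb_mul (axb_inv g) h) = h.
Proof. by move=> g0; rewrite axb_mulA axb_mulgV// axb_mul1g. Qed.

Lemma axb_translateP g K h : axbG g ->
  axb_translate g K h <-> K (axb_mul (axb_inv g) h).
Proof.
move=> g0; split=> [[k Kk <-]|Kh]; first by rewrite axb_mulKg.
by exists (axb_mul (axb_inv g) h) => //; rewrite axb_mulVKg.
Qed.

Lemma axb_divE g h : axb_mul (axb_inv g) h = (g.2^-1 *: (h.1 - g.1), h.2 / g.2).
Proof.
by rewrite /axb_mul /axb_inv /= scalerBr addrC mulrC.
Qed.

Lemma compact_bounded_on (T : topologicalType) (A : set T) (f : T -> R) : compact A ->
  {in A, continuous f} -> exists2 M : R, 0 < M & forall t, A t -> `|f t| < M.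
Proof.
move=> cA cf; have fA : compact (f @` A).
  by apply: continuous_compact cA; exact: continuous_in_subspaceT.
have [M [Mreal HM]] := compact_bounded fA.
exists (`|M| + 1) => [|t At]; first by rewrite ltr_wpDl.
have lt : M < `|M| + 2^-1 by rewrite (le_lt_trans (ler_norm M))// ltrDl invr_gt0.
apply: (le_lt_trans (HM _ lt (f t) _)); first by exists t.
rewrite ltrD2l; lra.
Qed.

Lemma compact_coor_bounds K : axb_compact K -> exists2 M : R, 1 < M &
  forall h, K h -> cube 0 M h.1 /\ M^-1 < h.2 < M.
Proof.
move=> [cK KG].
have [M1 M10 H1] : exists2 M : R, 0 < M & forall h, K h -> `|h.2| < M.
  by apply: (compact_bounded_on cK) => h _; exact: cvg_snd.
(* Inversion of the scale is continuous on a compact subset of the open half-space; this keeps the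
   scales away from 0. *)
have [M2 M20 H2] : exists2 M : R, 0 < M & forall h, K h -> `|h.2^-1| < M.
  apply: (compact_bounded_on cK) => h; rewrite inE => /KG h0.
  apply: (@continuous_comp _ _ _ snd (@GRing.inv R)); first exact: cvg_snd.
  by apply: inv_continuous; rewrite gt_eqF.
have H3 (i : 'I_n) : exists2 M : R, 0 < M & forall h, K h -> `|h.1 ord0 i| < M.
  apply: (compact_bounded_on cK) => h _.
  apply: (@continuous_comp _ _ _ fst (fun y : 'rV[R]_n => y ord0 i)); first exact: cvg_fst.
  exact: coord_continuous.
pose f i := sval (cid2 (H3 i)).
have f0 i : 0 < f i by rewrite /f; case: cid2.
have Hf i h : K h -> `|h.1 ord0 i| < f i by rewrite /f; case: cid2 => /= M _ HM; exact: HM.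
have S0 : 0 <= \sum_i f i by apply: sumr_ge0 => i _; exact: ltW.
exists (1 + M1 + M2 + \sum_i f i) => [|h Kh]; first lra.
have h0 : 0 < h.2 := KG _ Kh.
split=> [i|].
  rewrite mxE subr0; apply: (lt_le_trans (Hf i h Kh)).
  have : f i <= \sum_i f i by rewrite (bigD1 i)//= lerDl sumr_ge0// => j _; exact: ltW.
  lra.
apply/andP; split; last by have := H1 _ Kh; rewrite gtr0_norm//; lra.
rewrite invf_plt ?posrE//; last lra.
by have := H2 _ Kh; rewrite gtr0_norm ?invr_gt0//; lra.
Qed.

Lemma rel_compact_bounds U : rel_compact_nbhd1 U -> exists2 M : R, 1 < M &
  forall h, U h -> cube 0 M h.1 /\ M^-1 < h.2 < M.
Proof.
move=> [_ [K cK UK]]; have [M M1 H] := compact_coor_bounds cK.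
by exists M => // h /UK; exact: H.
Qed.

Lemma nbhs1_box U : nbhs axb1 U -> exists e c : R, [/\ 0 < e, 1 < c &
  forall h, cube 0 e h.1 -> c^-1 < h.2 < c -> U h].
Proof.
move=> /nbhs_box[e /= e0 H]; exists e, (1 + e); split => //; first by rewrite ltrDl.
move=> h h1 /andP[h2 h3]; apply: H => //.
have e10 : 0 < 1 + e by rewrite addr_gt0.
rewrite ltr_norml ltrBrDr ltrBlDr [e + 1]addrC h3 andbT.
(* It remains that [1 - e] is at most [(1 + e)^-1], which is [(1 - e) * (1 + e) <= 1]. *)
apply: le_lt_trans h2; rewrite -[(1+e)^-1]mul1r ler_pdivlMr//.
nra.
Qed.

(** For [1 < c], a neighbourhood of 1 in the multiplicative group of scales, symmetric on the
    logarithmic axis. *)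
Definition symitv (c : R) : set R := [set b | c^-1 < b < c].

Lemma measurable_symitv c : measurable (symitv c : set (measurableTypeR R)).
Proof.
rewrite (_ : symitv c = `]c^-1, c[%classic); first exact: measurable_itv.
by apply/seteqP; split => b /=; rewrite in_itv.
Qed.

Lemma exp_unbounded (c M : R) : 1 < c -> exists N : nat, M <= c ^+ N.
Proof.
move=> c1.
have bern (k : nat) : 1 + k%:R * (c - 1) <= c ^+ k.
  elim: k => [|k ih]; first by rewrite mul0r addr0 expr0.
  have k0 : 0 <= k%:R :> R by [].
  have c10 : 0 < c - 1 by rewrite subr_gt0.
  rewrite exprS -natr1; apply: (@le_trans _ _ (c * (1 + k%:R * (c - 1)))).
    have : 0 <= k%:R * (c - 1) * (c - 1) by rewrite !mulr_ge0// ltW.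
    move: (k%:R : R) => kk; lra.
  by rewrite ler_wpM2l// ltW// (lt_trans _ c1).
exists (Num.truncn (M / (c - 1))).+1; apply: le_trans (bern _).
have c10 : 0 < c - 1 by rewrite subr_gt0.
have := truncnS_gt (M / (c - 1)); rewrite ltr_pdivrMr//; move=> /ltW h; apply: (le_trans h); rewrite lerDr//.
Qed.

(** The dilates form a geometric progression: [M * b] lies between 1 and [M * M], hence between two
    consecutive powers of [c], and division by the smaller power lands in [symitv c]. *)
Lemma symitv_cover (c M : R) : 1 < c -> 1 < M -> exists ts : seq R,
  (forall t, t \in ts -> 0 < t) /\
  forall b, symitv M b -> exists2 t, t \in ts & symitv c (t * b).
Proof.
move=> c1 M1; have [N HN] := exp_unbounded (M * M) c1.
have c0 : 0 < c by rewrite (lt_trans _ c1).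
have M0 : 0 < M by rewrite (lt_trans _ M1).
have cV : c^-1 < 1 by rewrite invf_lt1.
exists [seq M / c ^+ j | j <- iota 0 N.+1]; split.
  by move=> _ /mapP[j _ ->]; rewrite divr_gt0// exprn_gt0.
move=> b /andP[bM Mb].
have Mb1 : 1 < M * b by rewrite mulrC -ltr_pdivrMr// div1r.
have ex : exists j, M * b < c ^+ j.+1.
  exists N; apply: (lt_le_trans (y := M * M)); first by rewrite ltr_pM2l.
  by apply: le_trans HN _; rewrite exprSr ler_peMr ?exprn_ge0// ltW.
have [j Hj jmin] := ex_minnP ex.
have jN : (j <= N)%N.
  apply: jmin; apply: (lt_le_trans (y := M * M)); first by rewrite ltr_pM2l.
  by apply: le_trans HN _; rewrite exprSr ler_peMr ?exprn_ge0// ltW.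
exists (M / c ^+ j).
  by apply/mapP; exists j => //; rewrite mem_iota ltnS.
have cj : 0 < c ^+ j by rewrite exprn_gt0.
(* Minimality of [j] excludes [M * b < c ^+ j]; for [j = 0] the bound is [1 < M * b]. *)
have lej : c ^+ j <= M * b.
  case: j {Hj jN cj} jmin => [|j] jmin; first by rewrite expr0 ltW.
  by rewrite leNgt; apply/negP => /jmin; rewrite ltnn.
rewrite /symitv/= mulrAC; apply/andP; split.
  by apply: (lt_le_trans cV); rewrite ler_pdivlMr// mul1r.
by rewrite ltr_pdivrMr// -exprS.
Qed.

End group_geometry.

(** * Weighted superpositions of dilated scale intervals *)

Section layers.
Context {R : realType}.
Local Open Scope ereal_scope.
Local Notation Rpos := (`]0%R, +oo[%classic : set (measurableTypeR R)).

Definition layers (I : choiceType) (w : I -> \bar R) (s : I -> R) (E : set R) (a : R) :=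
  \esum_(i in [set: I]) (w i * (\1_E (a / s i))%:E).

Variables (I : countType) (w : I -> \bar R) (s : I -> R).
Hypotheses (w0 : forall i, 0 <= w i) (s0 : forall i, (0 < s i)%R).

Lemma layers_term_ge0 (E : set R) a i : 0 <= w i * (\1_E (a / s i))%:E.
Proof. by apply: mule_ge0 => //; rewrite lee_fin. Qed.

Lemma layers_ge0 E a : 0 <= layers w s E a.
Proof. by apply: esum_ge0 => i _; exact: layers_term_ge0. Qed.

Lemma measurable_indic_dilate (E : set R) (t : R) : measurable (E : set (measurableTypeR R)) ->
  measurable_fun setT (fun a : measurableTypeR R => (\1_E (a / t))%:E : \bar R).
Proof.
move=> mE; apply/measurable_EFinP.
apply: (measurableT_comp (f := \1_E : measurableTypeR R -> R)).
  exact: measurable_indic.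
exact: measurable_funM.
Qed.

Lemma measurable_layers (E : set R) : measurable (E : set (measurableTypeR R)) ->
  measurable_fun Rpos (layers w s E : measurableTypeR R -> \bar R).
Proof.
move=> mE; apply: measurable_fun_esum.
- exact: measurable_itv.
- move=> i; apply: measurable_funeM; apply: measurable_funTS.
  exact: measurable_indic_dilate.
- by move=> i a; exact: layers_term_ge0.
Qed.

(** Holds term by term: the indicator of [E] at [b] is at most the sum over [ts] of the indicators
    of [J] at [t * b]. *)
Lemma layers_dilates (E J : set R) (ts : seq R) (a : R) :
  (forall b, E b -> exists2 t, t \in ts & J (t * b)%R) ->
  layers w s E a <= \sum_(t <- ts) layers w s J (t * a)%R.
Proof.
move=> EJ; rewrite -esum_sum; last by move=> i t _ _; exact: layers_term_ge0.
apply: le_esum => i _; rewrite -ge0_sume_distrr; last by move=> t _; rewrite lee_fin.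
apply: lee_wpmul2l => //.
rewrite indicE; have [|_] := boolP ((a / s i)%R \in E); last first.
  by rewrite sume_ge0// => t _; rewrite lee_fin.
rewrite inE => /EJ[t tts Jt]; rewrite (big_rem t)//= -mulrA indicE mem_set//=.
by rewrite leeDl// sume_ge0// => t' _; rewrite lee_fin.
Qed.

End layers.

(** * Step functions and sequence norms *)

Section fibers.
Context {R : realType} {n : nat}.
Local Notation GT := ('rV[R]_n * R)%type.
Local Notation normc := ComplexField.Normc.normc.
Local Open Scope ereal_scope.

Implicit Types (p : R) (v : 'rV[R]_n -> R) (F : GT -> \bar R) (U : set GT).

Lemma normc_ge0 (z : R[i]) : (0 <= normc z)%R.
Proof. by case: z => x y; exact: sqrtr_ge0. Qed.

Definition fiber_mass (p : R) (v : 'rV[R]_n -> R) (F : GT -> \bar R) (a : R) : \bar R :=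
  \int[vol n]_x (`|F (x, a)| `^ p * (v x)%:E).

Lemma fiber_mass_ge0 p v F a : (forall x, 0 < v x)%R -> 0 <= fiber_mass p v F a.
Proof.
move=> v0; apply: integral_ge0 => x _; apply: mule_ge0; first exact: poweR_ge0.
by rewrite lee_fin ltW.
Qed.

Lemma measurable_axbG : measurable (@axbG R n).
Proof.
rewrite (_ : axbG = (snd : GT -> R) @^-1` `]0%R, +oo[); last first.
  by apply/seteqP; split => g /=; rewrite in_itv/= andbT.
rewrite -[X in measurable X]setTI.
by apply: (@measurable_snd _ _ 'rV[R]_n (measurableTypeR R)) => //; exact: measurable_itv.
Qed.

Lemma measurable_fiber_mass p v F : (forall x, 0 < v x)%R -> measurable_fun setT v ->
  measurable_fun axbG F ->
  measurable_fun (`]0%R, +oo[%classic : set (measurableTypeR R)) (fiber_mass p v F).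
Proof.
move=> v0 mv mF.
(* [F] is arbitrary outside the half-space. Its extension by 0 is measurable on the whole product,
   as Tonelli asks, and has the same fibres at positive heights. *)
pose F' := F \_ axbG.
have mF' : measurable_fun setT F' by apply/(measurable_restrictT _ measurable_axbG).
apply: (eq_measurable_fun (fun a : measurableTypeR R => \int[vol n]_x (`|F' (x, a)| `^ p * (v x)%:E))).
  move=> a; rewrite inE/= in_itv/= andbT => a0.
  by apply: eq_integral => x _; rewrite /F' patchE mem_set.
apply: measurable_funTS.
apply: (measurable_fun_fubini_tonelli_G (m1 := vol n)
  (fun z : 'rV[R]_n * measurableTypeR R => `|F' z| `^ p * (v z.1)%:E)).
  apply: emeasurable_funM.
    by apply: measurable_fun_poweR; exact: measurableT_comp.
  by apply/measurable_EFinP; exact: (measurableT_comp mv measurable_fst).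
by move=> z; apply: mule_ge0; [exact: poweR_ge0|rewrite lee_fin ltW].
Qed.

Lemma measurable_axb_mull (g : GT) : measurable_fun setT (axb_mul g).
Proof.
apply: measurable_fun_pair.
  apply: measurable_fun_rV => i.
  rewrite (_ : (fun _ => _) = (fun h : GT => g.1 ord0 i + g.2 * h.1 ord0 i)%R); last first.
    by apply/funext => h; rewrite !mxE.
  apply: measurable_funD => //; apply: measurable_funM => //.
  exact: (measurableT_comp (measurable_rV_coor i) measurable_fst).
by apply: measurable_funM => //; exact: measurable_snd.
Qed.

Lemma measurable_axb_mulr (g : GT) : measurable_fun setT (axb_mul ^~ g).
Proof.
apply: measurable_fun_pair.
  apply: measurable_fun_rV => i.
  rewrite (_ : (fun _ => _) = (fun h : GT => h.1 ord0 i + h.2 * g.1 ord0 i)%R); last first.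
    by apply/funext => h; rewrite !mxE.
  apply: measurable_funD.
    exact: (measurableT_comp (measurable_rV_coor i) measurable_fst).
  by apply: measurable_funM => //; exact: measurable_snd.
by apply: measurable_funM => //; exact: measurable_snd.
Qed.

Lemma measurable_translate (g : GT) U : axbG g -> measurable U ->
  measurable (axb_translate g U).
Proof.
move=> g0 mU; rewrite (_ : axb_translate g U = axb_mul (axb_inv g) @^-1` U).
  by rewrite -[X in measurable X]setTI; exact: measurable_axb_mull.
by apply/seteqP; split => h /axb_translateP; exact.
Qed.

Lemma measurable_step_fun (I : countType) (X : I -> GT) U lam : (forall i, axbG (X i)) ->
  measurable U -> measurable_fun setT (step_fun X U lam).
Proof.
move=> X0 mU; apply: measurable_fun_esum => // [i|i h].
  apply/measurable_EFinP; apply: measurable_funM => //.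
  by apply: measurable_indic; exact: measurable_translate.
by rewrite lee_fin mulr_ge0// normc_ge0.
Qed.

Lemma step_fun_ge0 (I : choiceType) (X : I -> GT) U lam g : 0 <= step_fun X U lam g.
Proof. by apply: esum_ge0 => i _; rewrite lee_fin mulr_ge0// normc_ge0. Qed.

Section step_fun_fibers.
Variables (I : countType) (X : I -> GT) (p : R) (v : 'rV[R]_n -> R).
Hypotheses (p0 : (0 < p)%R) (v0 : forall x, (0 < v x)%R) (mv : measurable_fun setT v).
Hypotheses (X0 : forall i, axbG (X i)) (sepX : relatively_separated X).

Definition weights (lam : I -> R[i]) (i : I) : \bar R :=
  (normc (lam i) `^ p)%:E * wmass v (eball (X i).1 (X i).2).

Lemma weights_ge0 lam i : 0 <= weights lam i.
Proof. by apply: mule_ge0; [rewrite lee_fin powR_ge0|exact: wmass_ge0]. Qed.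

(** The value that the fibre integral of the step function would have if the translates of [U] were
    disjoint. *)
Let sections (U : set GT) (lam : I -> R[i]) (a : R) : \bar R :=
  \esum_(i in [set: I]) ((normc (lam i) `^ p)%:E *
     wmass v [set x | axb_translate (X i) U (x, a)]).

Lemma measurable_section (A : set GT) (a : R) : measurable A ->
  measurable [set x | A (x, a)].
Proof.
move=> mA; rewrite -[X in measurable X]setTI.
apply: (measurable_fun_pair (f := id) (g := cst a)) => //.
Qed.

(** At most [N] translates overlap at any point, so the [p]-th power of the sum and the sum of the
    [p]-th powers differ there by at most a factor [N] or its [p]-th power; integrating over the
    fibre turns the sum of powers into [sections]. *)
Lemma fiber_mass_sections U : rel_compact_nbhd1 U -> measurable U ->
  exists2 C : R, (0 < C)%R & forall lam a,
    fiber_mass p v (step_fun X U lam) a <= C%:E * sections U lam a /\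
    sections U lam a <= C%:E * fiber_mass p v (step_fun X U lam) a.
Proof.
move=> [_ [K cK UK]] mU; have [N HN] := sepX cK.
exists (N%:R `^ p + N%:R + 1)%R => [|lam a].
  by rewrite ltr_wpDl// addr_ge0// powR_ge0.
pose f i g : \bar R := (normc (lam i) * \1_(axb_translate (X i) U) g)%:E.
have f0 i g : 0 <= f i g by rewrite lee_fin mulr_ge0// normc_ge0.
have fp i g : f i g `^ p = (normc (lam i) `^ p)%:E * (\1_(axb_translate (X i) U) g)%:E.
  rewrite /f EFinM poweRM ?lee_fin ?normc_ge0//; congr (_ * _).
  rewrite indicE; case: (g \in _) => /=; rewrite ?powR1//.
  by rewrite powR0// gt_eqF.
(* If [g] lies in the translate by [X j], every translate containing [g] meets that one in [g], so
   relative separation at [j] bounds their number, uniformly in [j]. *)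
have cf g : ([set i | f i g != 0%R] #<= `I_N)%card.
  have sub : [set i | f i g != 0%R] `<=` [set i | axb_translate (X i) U g].
    move=> i /=; apply: contra_neqP => nU.
    by rewrite /f indicE memNset// mulr0.
  apply: card_le_trans (subset_card_le sub) _.
  have [[j Uj]|noj] := pselect (exists j, axb_translate (X j) U g); last first.
    have -> : [set i | axb_translate (X i) U g] = set0.
      by apply/seteqP; split => i //= Ui; apply: noj; exists i.
    exact: card_ge0.
  apply: card_le_trans (HN j); apply: subset_card_le => i /= Ui.
  have tUK k : axb_translate (X k) U g -> axb_translate (X k) K g.
    by move=> [u Uu <-]; exists u => //; exact: UK.
  by exists g; split; exact: tUK.
have mf i : measurable_fun setT (fun x => (f i (x, a) `^ p) * (v x)%:E).
  under eq_fun do rewrite fp.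
  apply: emeasurable_funM; last exact/measurable_EFinP.
  apply: measurable_funeM; apply/measurable_EFinP.
  rewrite (_ : (fun x => _) = \1_[set x | axb_translate (X i) U (x, a)]).
    by apply: measurable_indic; apply: measurable_section; exact: measurable_translate.
  by apply/funext => x; rewrite !indicE; congr (_%:R)%R; apply/idP/idP; rewrite !inE.
have fv0 i x : 0 <= (f i (x, a) `^ p) * (v x)%:E.
  by apply: mule_ge0; [exact: poweR_ge0|rewrite lee_fin ltW].
have secE : sections U lam a =
    \int[vol n]_x (\esum_(i in [set: I]) ((f i (x, a) `^ p) * (v x)%:E)).
  rewrite ge0_integral_esum//; apply: eq_esum => i _.
  under eq_integral do rewrite fp -muleA.
  rewrite ge0_integralZl ?lee_fin ?powR_ge0//.
  - by rewrite -wmass_indic; congr (_ * _); apply: eq_integral.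
  - apply: emeasurable_funM; last exact/measurable_EFinP.
    apply/measurable_EFinP.
    rewrite (_ : (fun x => _) = \1_[set x | axb_translate (X i) U (x, a)]).
      by apply: measurable_indic; apply: measurable_section; exact: measurable_translate.
    by apply/funext => x; rewrite !indicE; congr (_%:R)%R; apply/idP/idP; rewrite !inE.
  - by move=> x _; apply: mule_ge0; rewrite lee_fin// ltW.
have mS : measurable_fun setT (fun x => `|step_fun X U lam (x, a)| `^ p * (v x)%:E).
  apply: emeasurable_funM; last exact/measurable_EFinP.
  apply: measurable_fun_poweR; apply: measurableT_comp => //.
  have mpair : measurable_fun setT (fun x : 'rV[R]_n => (x, a) : 'rV[R]_n * measurableTypeR R).
    exact: (measurable_fun_pair (f := id) (g := cst a)).
  by apply: (measurableT_comp (measurable_step_fun lam X0 mU) mpair).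
have S0 x : 0 <= `|step_fun X U lam (x, a)| `^ p * (v x)%:E.
  by apply: mule_ge0; [exact: poweR_ge0|rewrite lee_fin ltW].
have SE x : `|step_fun X U lam (x, a)| = \esum_(i in [set: I]) f i (x, a).
  by rewrite gee0_abs// step_fun_ge0.
have esumM x : \esum_(i in [set: I]) ((f i (x, a) `^ p) * (v x)%:E) =
    (\esum_(i in [set: I]) (f i (x, a) `^ p)) * (v x)%:E.
  rewrite muleC -esum_mulrl.
  - by apply: eq_esum => i _; rewrite muleC.
  - by rewrite lee_fin ltW.
  - by move=> i; exact: poweR_ge0.
have Np0 : (0 <= N%:R `^ p)%R by exact: powR_ge0.
have sec0 : 0 <= sections U lam a.
  by apply: esum_ge0 => i _; apply: mule_ge0; [rewrite lee_fin powR_ge0|exact: wmass_ge0].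
split.
- apply: (@le_trans _ _ ((N%:R `^ p)%:E * sections U lam a)); last first.
    by apply: lee_wpmul2r => //; rewrite lee_fin -addrA lerDl addr_ge0.
  rewrite secE -ge0_integralZl//.
  + apply: ge0_le_integral_nm => // x _.
    rewrite esumM muleA; apply: lee_wpmul2r; first by rewrite lee_fin ltW.
    by rewrite SE; exact: poweR_esum_le.
  + exact: measurable_fun_esum.
  + by move=> x _; apply: esum_ge0.
- apply: (@le_trans _ _ (N%:R%:E * fiber_mass p v (step_fun X U lam) a)); last first.
    apply: lee_wpmul2r; first exact: fiber_mass_ge0.
    by rewrite lee_fin addrAC lerDr addr_ge0.
  rewrite secE -ge0_integralZl//.
  apply: ge0_le_integral_nm => [x _|x _]; first by apply: esum_ge0.
  rewrite esumM muleA; apply: lee_wpmul2r; first by rewrite lee_fin ltW.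
  by rewrite SE; exact: esum_poweR_le.
Qed.

Hypothesis dv : doubling v.
Local Notation scales := (fun i => (X i).2).

(** [U] lies in a box around the identity. The section of a translate at height [a] is thus
    contained in a cube of radius [M] times the scale of its base point, and is empty unless [a]
    over that scale is in [symitv M]; doubling replaces the cube by the ball. *)
Lemma fiber_mass_le_layers U : rel_compact_nbhd1 U -> measurable U ->
  exists M C : R, [/\ (1 < M)%R, (0 < C)%R & forall lam a,
    fiber_mass p v (step_fun X U lam) a <=
      C%:E * layers (weights lam) scales (symitv M) a].
Proof.
move=> cU mU; have [C0 C00 H0] := fiber_mass_sections cU mU.
have [M M1 HM] := rel_compact_bounds cU.
have M0 : (0 < M)%R by rewrite (lt_trans _ M1).
have [C1 C10 H1] := doubling_cube_le v0 dv M0.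
exists M, (C0 * C1)%R; split => // [|lam a]; first exact: mulr_gt0.
apply: le_trans (H0 lam a).1 _; rewrite EFinM -muleA.
apply: lee_wpmul2l; first by rewrite lee_fin ltW.
rewrite /layers -esum_mulrl; last 2 first.
- by rewrite lee_fin ltW.
- by move=> i; apply: mule_ge0; [exact: weights_ge0|rewrite lee_fin].
apply: le_esum => i _; rewrite /weights -muleA [leRHS]muleCA.
apply: lee_wpmul2l; first by rewrite lee_fin powR_ge0.
rewrite indicE; have [_|aM] := boolP ((a / (X i).2)%R \in symitv M).
  rewrite mule1; apply: le_trans (H1 _ _ (X0 i)); apply: le_wmass => // x /=.
  move=> [u /HM[u1 _] [<- _]] j; rewrite !mxE addrAC subrr add0r normrM.
  rewrite gtr0_norm ?(X0 i)// mulrC ltr_pM2r ?(X0 i)//.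
  by have := u1 j; rewrite mxE subr0.
rewrite !mule0 (_ : [set x | _] = set0) /wmass ?integral_set0//.
apply/seteqP; split => x //= [u /HM[_ u2] [_ ua]].
move/negP: aM; apply; rewrite inE /symitv/= -ua mulrAC mulfV ?mul1r//.
by rewrite gt_eqF// (X0 i).
Qed.

(** [U] contains a box around the identity. When [a] over the scale of the base point is in
    [symitv c], the section at height [a] contains a cube of radius [e] times that scale, whose mass
    dominates that of the ball by doubling. *)
Lemma layers_le_fiber_mass U : rel_compact_nbhd1 U -> measurable U ->
  exists c C : R, [/\ (1 < c)%R, (0 < C)%R & forall lam a,
    layers (weights lam) scales (symitv c) a <=
      C%:E * fiber_mass p v (step_fun X U lam) a].
Proof.
move=> cU mU; have [C0 C00 H0] := fiber_mass_sections cU mU.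
have [e [c [e0 c1 Hc]]] := nbhs1_box cU.1.
have [C1 C10 H1] := doubling_le_cube v0 dv e0.
exists c, (C1 * C0)%R; split => // [|lam a]; first exact: mulr_gt0.
rewrite EFinM -muleA.
apply: (@le_trans _ _ (C1%:E * sections U lam a)); last first.
  by apply: lee_wpmul2l; [rewrite lee_fin ltW|exact: (H0 lam a).2].
rewrite /layers -esum_mulrl; last 2 first.
- by rewrite lee_fin ltW.
- by move=> i; apply: mule_ge0; [rewrite lee_fin powR_ge0|exact: wmass_ge0].
apply: le_esum => i _; rewrite /weights -muleA [leRHS]muleCA.
apply: lee_wpmul2l; first by rewrite lee_fin powR_ge0.
rewrite indicE; have [ac|_] := boolP ((a / (X i).2)%R \in symitv c); last first.
  by rewrite mule0 mule_ge0 ?lee_fin ?(ltW C10)//; exact: wmass_ge0.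
rewrite mule1; apply: le_trans (H1 _ _ (X0 i)) _.
apply: lee_wpmul2l; first by rewrite lee_fin ltW.
apply: le_wmass => // x /= xe; apply/axb_translateP; first exact: X0.
rewrite axb_divE; apply: Hc => /= [j|]; last by move: ac; rewrite inE.
have Xi0 := X0 i : (0 < (X i).2)%R.
rewrite !mxE subr0 normrM gtr0_norm ?invr_gt0// mulrC ltr_pdivrMr//.
Qed.

End step_fun_fibers.
End fibers.

(** * Reduction of equivalence to two inequalities *)

Section equivalence.
Context {R : realType}.
Local Open Scope ereal_scope.

(** Both spaces consist of the elements of finite quasi-norm, so the two inequalities also give
    equality of the spaces. *)
Lemma equivalent_qnormed_intro (T : Type) (S1 S2 : set T) (N1 N2 : T -> \bar R) (C1 C2 : R) :
  (0 < C1)%R -> (0 < C2)%R ->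
  (forall f, S1 f <-> N1 f < +oo) -> (forall f, S2 f <-> N2 f < +oo) ->
  (forall f, N2 f <= C1%:E * N1 f) -> (forall f, N1 f <= C2%:E * N2 f) ->
  equivalent_qnormed S1 N1 S2 N2.
Proof.
move=> C10 C20 S1P S2P N21 N12.
have fin (C : R) (y z : \bar R) : (0 < C)%R -> y <= C%:E * z -> z < +oo -> y < +oo.
  move=> C0 yz zoo; apply: (le_lt_trans yz); rewrite ltey.
  apply: contraTneq zoo; case: z {yz} => [z||] //; rewrite ?ltxx//.
  by rewrite gt0_muleNy// lte_fin.
split.
  apply/seteqP; split => f.
    by rewrite S1P S2P; exact: fin C10 (N21 f).
  by rewrite S1P S2P; exact: fin C20 (N12 f).
exists C2^-1%R, C1; split; rewrite ?invr_gt0// => f _; split => //.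
by rewrite lee_pdivrMl.
Qed.

Lemma esum_swap (T1 T2 : choiceType) (f : T1 * T2 -> \bar R) : (forall i, 0 <= f i) ->
  \esum_(i in [set: T1 * T2]) f i = \esum_(j in [set: T2]) \esum_(k in [set: T1]) f (k, j).
Proof.
move=> f0; rewrite (esum_esum (a := fun j k => f (k, j)))//.
rewrite (reindex_esum ([set: T2] `*`` (fun=> [set: T1])) [set: T1 * T2] (fun z => (z.2, z.1)))//.
split => //; first by move=> [j k] [j' k'] _ _ [-> ->].
by move=> [k j] _; exists (j, k).
Qed.

Lemma ess_sup_ge_on d (T : measurableType d) (mu : {measure set T -> \bar R}) (A : set T)
    (f : T -> \bar R) y : measurable A -> 0 < mu A -> (forall t, A t -> y <= f t) ->
  y <= ess_sup mu f.
Proof.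
move=> mA A0 yf; rewrite leNgt; apply/negP => lty.
have [N [mN N0 HN]] := ess_sup_ge mu f.
move: A0; rewrite ltNge => /negP; apply; rewrite -N0; apply: le_measure; rewrite ?inE//.
by move=> t At; apply: HN => /= ft; have := lt_le_trans lty (yf _ At); rewrite ltNge ft.
Qed.

End equivalence.

Section step_qnorm.
Context {R : realType} {n : nat}.
Local Notation GT := ('rV[R]_n * R)%type.
Local Open Scope ereal_scope.
Variables (I : countType) (X : I -> GT) (p : R) (q : \bar R) (v : 'rV[R]_n -> R).
Hypotheses (p0 : (0 < p)%R) (q0 : 0 < q).
Hypotheses (v0 : forall x, (0 < v x)%R) (mv : measurable_fun setT v).
Hypotheses (X0 : forall i, axbG (X i)) (sepX : relatively_separated X).
Hypothesis dv : doubling v.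

Lemma Lpq_d_qnorm_lty U lam : measurable U ->
  Lpq_d p q v X U lam <-> Lpq_d_qnorm p q v X U lam < +oo.
Proof.
move=> mU; split=> [[]//|h]; split => //.
apply: measurable_funTS; exact: measurable_step_fun.
Qed.

Lemma measurable_fiber_step U lam : measurable U ->
  measurable_fun (`]0%R, +oo[%classic : set (measurableTypeR R))
    (fiber_mass p v (step_fun X U lam)).
Proof.
move=> mU; apply: measurable_fiber_mass => //.
apply: measurable_funTS; exact: measurable_step_fun.
Qed.

(** [U] only provides some interval [symitv c]; covering [symitv M] by dilates of it makes [M] free.
    A different neighbourhood or the sequence norm can then dictate [M]. *)
Lemma layers_weights_le U M : rel_compact_nbhd1 U -> measurable U -> (1 < M)%R ->
  exists2 C : R, (0 < C)%R & forall lam,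
    mixed_norm n p q (layers (weights X p v lam) (fun i => (X i).2) (symitv M)) <=
    C%:E * Lpq_d_qnorm p q v X U lam.
Proof.
move=> cU mU M1.
have [c [C [c1 C0 HC]]] := layers_le_fiber_mass p0 v0 mv X0 sepX dv cU mU.
have [ts [ts0 Hts]] := symitv_cover c1 M1.
have [C' C'0 HC'] := @mixed_norm_le_dilates R n p q p0 q0 ts C ts0 (ltW C0).
exists C' => // lam; apply: HC'.
- by move=> a _; apply: layers_ge0 => i; exact: weights_ge0.
- by move=> a _; exact: fiber_mass_ge0.
- exact: measurable_fiber_step.
move=> a a0; apply: le_trans (layers_dilates _ _ _ Hts) _.
  by move=> i; exact: weights_ge0.
rewrite ge0_sume_distrr; last by move=> t _; exact: fiber_mass_ge0.
by apply: lee_sum => t _; exact: HC.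
Qed.

Lemma Lpq_d_qnorm_le_layers U : rel_compact_nbhd1 U -> measurable U ->
  exists M C : R, [/\ (1 < M)%R, (0 < C)%R & forall lam,
    Lpq_d_qnorm p q v X U lam <=
    C%:E * mixed_norm n p q (layers (weights X p v lam) (fun i => (X i).2) (symitv M))].
Proof.
move=> cU mU.
have [M [C [M1 C0 HC]]] := fiber_mass_le_layers p0 v0 mv X0 sepX dv cU mU.
have ts0 t : t \in [:: 1%R] -> (0 < t :> R)%R by rewrite inE => /eqP ->.
have [C' C'0 HC'] := @mixed_norm_le_dilates R n p q p0 q0 [:: 1%R] C ts0 (ltW C0).
exists M, C'; split => // lam; apply: HC'.
- by move=> a _; exact: fiber_mass_ge0.
- by move=> a _; apply: layers_ge0 => i; exact: weights_ge0.
- apply: measurable_layers; first by move=> i; exact: weights_ge0.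
  exact: measurable_symitv.
by move=> a a0; rewrite big_seq1 mul1r; exact: HC.
Qed.

Lemma Lpq_d_qnorm_le U U' : rel_compact_nbhd1 U -> measurable U ->
  rel_compact_nbhd1 U' -> measurable U' ->
  exists2 C : R, (0 < C)%R & forall lam,
    Lpq_d_qnorm p q v X U' lam <= C%:E * Lpq_d_qnorm p q v X U lam.
Proof.
move=> cU mU cU' mU'.
have [M [C [M1 C0 HC]]] := Lpq_d_qnorm_le_layers cU' mU'.
have [C' C'0 HC'] := layers_weights_le cU mU M1.
exists (C * C')%R => [|lam]; first exact: mulr_gt0.
apply: le_trans (HC lam) _; rewrite EFinM -muleA.
by apply: lee_wpmul2l; [rewrite lee_fin ltW|exact: HC'].
Qed.

End step_qnorm.

(** * From the norm on the half-line to sums over scales *)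

Section scales.
Context {R : realType}.
Local Open Scope ereal_scope.
Local Notation leb := (@lebesgue_measure R).
Local Notation Rpos := (`]0%R, +oo[%classic : set (measurableTypeR R)).
Variables (n : nat) (p : R) (q : \bar R) (J : countType) (j0 : J) (a : J -> R).
Hypotheses (p0 : (0 < p)%R) (q0 : 0 < q) (a0 : forall j, (0 < a j)%R).

(** The exponent drops from [n.+1] to [n] because an interval of scales around [a j] has length
    proportional to [a j]. The index type is abstract: it is [int] for the sequence space and [unit]
    for a single box. *)
Definition scale_norm (W : J -> \bar R) : \bar R :=
  match q with
  | r%:E => (\esum_(j in [set: J]) (W j `^ (r / p) * (a j ^- n)%:E)) `^ r^-1
  | _ => ereal_sup [set W j `^ p^-1 | j in [set: J]]
  end.

Lemma lebesgue_symitv (M : R) : (1 < M)%R -> leb (symitv M) = (M - M^-1)%:E.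
Proof.
move=> M1; rewrite (_ : symitv M = `]M^-1%R, M[%classic); last first.
  by apply/seteqP; split => b /=; rewrite in_itv.
have MV : (M^-1 < 1)%R by rewrite invf_lt1// (lt_trans _ M1).
by rewrite lebesgue_measure_itv/= lte_fin (lt_trans MV M1) EFinB.
Qed.

(** On the interval the integrand lies between [M ^- n.+1] and [M ^+ n.+1]; later only positivity
    and finiteness of the value matter. *)
Lemma symitv_integral (M : R) : (1 < M)%R -> exists2 k : R, (0 < k)%R &
  \int[leb]_(b in `]0%R, +oo[) ((\1_(symitv M) b)%:E * (b ^- n.+1)%:E) = k%:E.
Proof.
move=> M1; have M0 : (0 < M)%R by rewrite (lt_trans _ M1).
have MV : (M^-1 < 1)%R by rewrite invf_lt1.
set k := \int[leb]_(b in _) _.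
have cstE (c : R) : (0 <= c)%R ->
    \int[leb]_(b in `]0%R, +oo[) (c%:E * (\1_(symitv M) b)%:E) = (c * (M - M^-1))%:E.
  move=> c0; rewrite ge0_integralZl//.
    rewrite integral_indic//; last exact: measurable_symitv.
    rewrite setIidl; first by rewrite [X in _ * X](lebesgue_symitv M1).
    by move=> b /andP[b1 b2] /=; rewrite in_itv/= andbT (lt_trans _ b1)// invr_gt0.
  - apply/measurable_EFinP; apply: measurable_funTS; apply: measurable_indic.
    exact: measurable_symitv.
have k_le : k <= (M ^+ n.+1 * (M - M^-1))%:E.
  rewrite -cstE; last by rewrite exprn_ge0// ltW.
  apply: ge0_le_integral_nm => b; rewrite /= in_itv/= andbT => b0.
    by rewrite mule_ge0// lee_fin invr_ge0 exprn_ge0// ltW.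
  rewrite muleC indicE; have [|_] := boolP (b \in symitv M); last by rewrite !mule0.
  rewrite inE => /andP[b1 b2]; rewrite !mule1 lee_fin -exprVn lerXn2r ?nnegrE ?invr_ge0 ?(ltW b0) ?(ltW M0)//.
  by rewrite ltW// invf_plt.
have k_ge : (M ^- n.+1 * (M - M^-1))%:E <= k.
  rewrite -cstE; last by rewrite invr_ge0 exprn_ge0// ltW.
  apply: ge0_le_integral_nm => b; rewrite /= in_itv/= andbT => b0.
    by rewrite mule_ge0// lee_fin invr_ge0 exprn_ge0// ltW.
  rewrite [leRHS]muleC indicE; have [|_] := boolP (b \in symitv M); last by rewrite !mule0.
  rewrite inE => /andP[b1 b2]; rewrite !mule1 lee_fin -!exprVn lerXn2r ?nnegrE ?invr_ge0 ?(ltW b0) ?(ltW M0)//.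
  by rewrite lef_pV2 ?posrE// ltW.
have kfin : k \is a fin_num.
  rewrite ge0_fin_numE; first by rewrite (le_lt_trans k_le)// ltry.
  apply: le_trans k_ge; rewrite lee_fin mulr_ge0 ?invr_ge0 ?exprn_ge0 ?(ltW M0)//.
  by rewrite subr_ge0 ltW// (lt_trans MV).
exists (fine k); last by rewrite fineK.
rewrite -lte_fin fineK//; apply: lt_le_trans k_ge.
by rewrite lte_fin mulr_gt0 ?invr_gt0 ?exprn_gt0// subr_gt0 (lt_trans MV).
Qed.

Lemma integral_layers (M : R) : (1 < M)%R -> exists2 k : R, (0 < k)%R &
  forall W : J -> \bar R, (forall j, 0 <= W j) ->
  \int[leb]_(t in `]0%R, +oo[) (layers W a (symitv M) t * (t ^- n.+1)%:E) =
  k%:E * \esum_(j in [set: J]) (W j * (a j ^- n)%:E).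
Proof.
move=> M1; have measurable_normEX : measurable_fun Rpos (fun t : measurableTypeR R => (`|t ^- n.+1|)%:E : \bar R).
  apply/measurable_EFinP; apply: (measurableT_comp (@normr_measurable R setT)).
  by apply/measurable_EFinP; exact: measurable_expfN.
have [k k0 kE] := symitv_integral M1; exists k => // W W0.
have mind j : measurable_fun Rpos (fun t : measurableTypeR R => (\1_(symitv M) (t / a j))%:E : \bar R).
  by apply: measurable_funTS; apply: measurable_indic_dilate; exact: measurable_symitv.
(* The absolute value changes nothing for positive [t]; it makes the terms nonnegative at every real
   [t], as the exchange of sum and integral asks. *)
transitivity (\int[leb]_(t in `]0%R, +oo[) \esum_(j in [set: J])
    (W j * ((\1_(symitv M) (t / a j))%:E * (`|t ^- n.+1|)%:E))).
  apply: eq_integral => t; rewrite inE/= in_itv/= andbT => t0.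
  have t0' : (0 <= t ^- n.+1)%R by rewrite invr_ge0 exprn_ge0// ltW.
  rewrite ger0_norm// muleC /layers -esum_mulrl//; last by move=> j; exact: layers_term_ge0.
  by apply: eq_esum => j _; rewrite muleC -muleA.
rewrite ge0_integral_esum//; last 2 first.
- move=> j; apply: measurable_funeM; apply: emeasurable_funM; first exact: mind.
  exact: measurable_normEX.
- by move=> j t; rewrite !mule_ge0// lee_fin.
rewrite -esum_mulrl; last 2 first.
- by rewrite lee_fin ltW.
- by move=> j; apply: mule_ge0 => //; rewrite lee_fin invr_ge0 exprn_ge0// ltW.
apply: eq_esum => j _.
rewrite ge0_integralZl//; last first.
  apply: emeasurable_funM; first exact: mind.
  exact: measurable_normEX.
rewrite muleCA; congr (_ * _).
(* With [b = t / a j] the density at [t] is [a j ^- n.+1] times the density at [b]; the change of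
   variable contributes [a j], which leaves [a j ^- n]. *)
pose f (b : R) : \bar R := ((a j ^- n.+1)%:E * ((\1_(symitv M) b)%:E * (b ^- n.+1)%:E))%E.
have aj0 := a0 j.
have mf0 : measurable_fun Rpos (fun b : measurableTypeR R => (\1_(symitv M) b)%:E * (b ^- n.+1)%:E).
  apply: emeasurable_funM; last exact: measurable_expfN.
  apply/measurable_EFinP; apply: measurable_funTS; apply: measurable_indic.
  exact: measurable_symitv.
have mf : measurable_fun Rpos f by apply: measurable_funeM.
have f0 b : (0 < b)%R -> 0 <= f b.
  by move=> b0; rewrite /f !mule_ge0// lee_fin invr_ge0 exprn_ge0// ltW.
transitivity (\int[leb]_(t in `]0%R, +oo[) f ((a j)^-1 * t)%R).
  apply: eq_integral => t; rewrite inE/= in_itv/= andbT => t0.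
  rewrite ger0_norm ?invr_ge0 ?exprn_ge0 ?(ltW t0)//.
  rewrite /f [((a j)^-1 * t)%R]mulrC muleCA; congr (_ * _); rewrite -EFinM -invfM -exprMn.
  by rewrite mulrCA mulfV ?mulr1// gt_eqF.
rewrite ge0_integral_scale ?invr_gt0//.
rewrite invrK /f ge0_integralZl//.
- rewrite kE muleA muleC; congr (_ * _); rewrite -EFinM exprS invfM mulrA.
  by rewrite mulfV ?mul1r// gt_eqF.
- by move=> b; rewrite /= in_itv/= andbT => b0; rewrite mule_ge0// lee_fin invr_ge0 exprn_ge0// ltW.
- by rewrite lee_fin invr_ge0 exprn_ge0// ltW.
Qed.

Hypothesis sep : q = p%:E \/ (forall M : R, (1 < M)%R -> exists N : nat, forall t : R,
  ([set j | symitv M (t / a j)%R] #<= `I_N)%card).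

(* If [q = p] the exponent [r / p] is 1; otherwise few layers overlap. *)
Lemma layers_poweR_equiv (r M : R) : q = r%:E -> (1 < M)%R -> exists2 C : R, (0 < C)%R &
  forall (W : J -> \bar R) (t : R), (forall j, 0 <= W j) ->
  layers W a (symitv M) t `^ (r / p) <=
    C%:E * layers (fun j => W j `^ (r / p)) a (symitv M) t /\
  layers (fun j => W j `^ (r / p)) a (symitv M) t <=
    C%:E * layers W a (symitv M) t `^ (r / p).
Proof.
move=> qr M1; have r0 : (0 < r)%R by move: q0; rewrite qr lte_fin.
case: sep => [qp|sepM].
  exists 1%R => // W t W0.
  have -> : (r / p = 1)%R.
    by move: qp; rewrite qr => -[->]; rewrite mulfV// gt_eqF.
  have l0 : 0 <= layers W a (symitv M) t by exact: layers_ge0.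
  rewrite !mul1e poweRe1// (_ : layers _ _ _ _ = layers W a (symitv M) t)//.
  by apply: eq_esum => j _; rewrite poweRe1.
have [N HN] := sepM M M1; have s0 : (0 < r / p)%R by exact: divr_gt0.
exists (N%:R `^ (r / p) + N%:R + 1)%R => [|W t W0].
  by rewrite ltr_wpDl// addr_ge0// powR_ge0.
pose f j := W j * (\1_(symitv M) (t / a j)%R)%:E.
have f0 j : 0 <= f j by apply: mule_ge0 => //; rewrite lee_fin.
have fr j : W j `^ (r / p) * (\1_(symitv M) (t / a j)%R)%:E = f j `^ (r / p).
  rewrite /f indicE; case: (_ \in _) => /=; rewrite ?mule1// ?mule0 poweR0r//.
  by rewrite gt_eqF.
have cf : ([set j | f j != 0%R] #<= `I_N)%card.
  apply: card_le_trans (HN t); apply: subset_card_le => j /=.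
  by apply: contra_neqP => nM; rewrite /f indicE memNset// mule0.
have -> : layers (fun j => W j `^ (r / p)) a (symitv M) t =
  \esum_(j in [set: J]) (f j `^ (r / p)) by exact: eq_esum.
have e0 : 0 <= \esum_(j in [set: J]) (f j `^ (r / p)).
  by apply: esum_ge0 => j _; exact: poweR_ge0.
split.
- apply: le_trans (poweR_esum_le s0 f0 cf) _; apply: lee_wpmul2r => //.
  by rewrite lee_fin -addrA lerDl addr_ge0.
- apply: le_trans (esum_poweR_le s0 f0 cf) _; apply: lee_wpmul2r; first exact: poweR_ge0.
  by rewrite lee_fin addrAC lerDr addr_ge0// powR_ge0.
Qed.

Lemma mixed_norm_layers_le (M : R) : (1 < M)%R -> exists2 C : R, (0 < C)%R &
  forall W : J -> \bar R, (forall j, 0 <= W j) ->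
  mixed_norm n p q (layers W a (symitv M)) <= C%:E * scale_norm W.
Proof.
move=> M1; rewrite /mixed_norm /scale_norm; case E : q q0 => [r|//|//] r0; last first.
  case: sep => [|sepM]; first by rewrite E.
  have [N HN] := sepM M M1.
  exists (N%:R `^ p^-1 + 1)%R => [|W W0]; first by rewrite ltr_wpDl// powR_ge0.
  set S := ereal_sup _.
  (* A supremum over no index would be [-oo]; the index [j0] rules this out. *)
  have S0 : 0 <= S.
    apply: (le_trans (poweR_ge0 (W j0) p^-1)).
    by apply: ereal_sup_ubound; exists j0.
  apply/ess_supP; apply: filterS (ae_Rpos (R := R)) => t t0.
  (* At each scale at most [N] layers are present, each of weight at most the [p]-th power of
     [S]. *)
  apply: (@le_trans _ _ ((N%:R%:E * S `^ p) `^ p^-1)); last first.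
    rewrite poweRM ?poweR_ge0 ?lee_fin// poweRK ?gt_eqF// poweR_EFin.
    by apply: lee_wpmul2r => //; rewrite lee_fin lerDl.
  apply: le_poweR; [by rewrite invr_ge0 ltW|exact: layers_ge0|].
  apply: esum_le_card => //.
  - by move=> j; apply: mule_ge0 => //; rewrite lee_fin.
  - apply: card_le_trans (HN t); apply: subset_card_le => j /=.
    by apply: contra_neqP => nM; rewrite indicE memNset// mule0.
  - exact: poweR_ge0.
  - move=> j; apply: (@le_trans _ _ (W j)).
      by rewrite indicE; case: (_ \in _); rewrite ?mule1// mule0.
    rewrite -(@poweRVK _ (W j) p) ?gt_eqF//; apply: le_poweR; [exact: ltW|exact: poweR_ge0|].
    by apply: ereal_sup_ubound; exists j.
rewrite lte_fin in r0.
have [C C0 HC] := layers_poweR_equiv E M1.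
have [k k0 Hk] := integral_layers M1.
exists ((C * k) `^ r^-1)%R => [|W W0]; first by rewrite powR_gt0// mulr_gt0.
have Wr0 j : 0 <= W j `^ (r / p) by exact: poweR_ge0.
rewrite -poweR_EFin -poweRM ?lee_fin ?mulr_ge0 ?(ltW C0) ?(ltW k0)//; last first.
  by apply: esum_ge0 => j _; apply: mule_ge0 => //; rewrite lee_fin invr_ge0 exprn_ge0// ltW.
have ge0 (g : R -> \bar R) (t : R) : (forall t, 0 <= g t) -> (0 < t)%R -> 0 <= g t * (t ^- n.+1)%:E.
  by move=> g0 t0; apply: mule_ge0 => //; rewrite lee_fin invr_ge0 exprn_ge0// ltW.
apply: le_poweR; first by rewrite invr_ge0 ltW.
  apply: integral_ge0 => t; rewrite /= in_itv/= andbT => t0.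
  by apply: (ge0 (fun t => layers W a (symitv M) t `^ (r / p))) => // t'; exact: poweR_ge0.
rewrite EFinM -muleA -Hk// -ge0_integralZl//.
- apply: ge0_le_integral_nm => t; rewrite /= in_itv/= andbT => t0.
    by apply: (ge0 (fun t => layers W a (symitv M) t `^ (r / p))) => // t'; exact: poweR_ge0.
  rewrite muleA; apply: lee_wpmul2r; first by rewrite lee_fin invr_ge0 exprn_ge0// ltW.
  exact: (HC W t W0).1.
- apply: emeasurable_funM; last exact: measurable_expfN.
  by apply: measurable_layers => //; exact: measurable_symitv.
- move=> t; rewrite /= in_itv/= andbT => t0; apply: ge0 => // t'; exact: layers_ge0.
- by rewrite lee_fin ltW.
Qed.

Lemma scale_norm_le_layers (M : R) : (1 < M)%R -> exists2 C : R, (0 < C)%R &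
  forall W : J -> \bar R, (forall j, 0 <= W j) ->
  scale_norm W <= C%:E * mixed_norm n p q (layers W a (symitv M)).
Proof.
move=> M1; rewrite /mixed_norm /scale_norm; case E : q q0 => [r|//|//] r0; last first.
  exists 1%R => // W W0; rewrite mul1e; apply: ge_ereal_sup => _ [j _ <-].
  (* On this set of scales, an interval of positive measure around [a j], the layers are at least
     [W j], so the essential supremum sees every single term. *)
  pose A : set (measurableTypeR R) := [set t | symitv M (t / a j)%R].
  have aj0 := a0 j; have M0 : (0 < M)%R by rewrite (lt_trans _ M1).
  have MV : (M^-1 < 1)%R by rewrite invf_lt1.
  have AE : A = `](a j / M)%R, (a j * M)%R[%classic.
    rewrite /A /symitv; apply/seteqP; split => t; rewrite /= in_itv/=.
      by rewrite ltr_pdivlMr// ltr_pdivrMr// [(M^-1 * _)%R]mulrC [(M * _)%R]mulrC.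
    by rewrite ltr_pdivlMr// [in X in _ -> X]ltr_pdivrMr// [(M^-1 * _)%R]mulrC [(M * _)%R]mulrC.
  apply: (ess_sup_ge_on (A := A)).
  - by rewrite AE; exact: measurable_itv.
  - change (0 < leb (A `&` Rpos)); rewrite setIidl.
      rewrite AE lebesgue_measure_itv/= lte_fin ltr_pM2l// (lt_trans MV)//.
      by rewrite -EFinB lte_fin subr_gt0 ltr_pM2l// (lt_trans MV).
    move=> t; rewrite AE/= !in_itv/= andbT => /andP[+ _]; apply: lt_trans.
    exact: divr_gt0.
  - move=> t At; apply: le_poweR => //; first by rewrite invr_ge0 ltW.
    rewrite /layers; apply: le_trans (esum_ge1 j _); first by rewrite indicE mem_set// mule1.
    by move=> i; apply: mule_ge0 => //; rewrite lee_fin.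
rewrite lte_fin in r0.
have [C C0 HC] := layers_poweR_equiv E M1.
have [k k0 Hk] := integral_layers M1.
exists ((k^-1 * C) `^ r^-1)%R => [|W W0]; first by rewrite powR_gt0// mulr_gt0// invr_gt0.
have Wr0 j : 0 <= W j `^ (r / p) by exact: poweR_ge0.
have ge0 (g : R -> \bar R) (t : R) : (forall t, 0 <= g t) -> (0 < t)%R -> 0 <= g t * (t ^- n.+1)%:E.
  by move=> g0 t0; apply: mule_ge0 => //; rewrite lee_fin invr_ge0 exprn_ge0// ltW.
have gel t : (0 < t)%R -> 0 <= layers W a (symitv M) t `^ (r / p) * (t ^- n.+1)%:E.
  by apply: (ge0 (fun t => layers W a (symitv M) t `^ (r / p))) => t'; exact: poweR_ge0.
rewrite -poweR_EFin -poweRM ?lee_fin ?mulr_ge0 ?invr_ge0 ?(ltW C0) ?(ltW k0)//; last first.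
  by apply: integral_ge0 => t; rewrite /= in_itv/= andbT; exact: gel.
apply: le_poweR; first by rewrite invr_ge0 ltW.
  by apply: esum_ge0 => j _; apply: mule_ge0 => //; rewrite lee_fin invr_ge0 exprn_ge0// ltW.
rewrite EFinM -muleA -lee_pdivrMl ?invr_gt0// invrK -Hk// -ge0_integralZl//.
- apply: ge0_le_integral_nm => t; rewrite /= in_itv/= andbT => t0.
    by apply: ge0 => // t'; exact: layers_ge0.
  rewrite muleA; apply: lee_wpmul2r; first by rewrite lee_fin invr_ge0 exprn_ge0// ltW.
  exact: (HC W t W0).2.
- apply: emeasurable_funM; last exact: measurable_expfN.
  apply: measurable_fun_poweR.
  by apply: measurable_layers => //; exact: measurable_symitv.
- by move=> t; rewrite /= in_itv/= andbT; exact: gel.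
- by rewrite lee_fin ltW.
Qed.

End scales.

(** * The sequence norm of a family graded by scales *)

Section sequence_norm.
Context {R : realType} {n : nat}.
Local Notation GT := ('rV[R]_n * R)%type.
Local Notation normc := ComplexField.Normc.normc.
Local Open Scope ereal_scope.
Variables (p : R) (q : \bar R) (v : 'rV[R]_n -> R).
Variables (x : 'rV[int]_n -> int -> 'rV[R]_n) (a : int -> R).
Local Notation X := (fun i : 'rV[int]_n * int => (x i.1 i.2, a i.2)).

Lemma scales_overlap : relatively_separated_scales a -> (forall j, (0 < a j)%R) ->
  forall M : R, (1 < M)%R -> exists N : nat, forall t : R,
  ([set j | symitv M (t / a j)%R] #<= `I_N)%card.
Proof.
move=> sep a0 M M1; have M0 : (0 < M)%R by rewrite (lt_trans _ M1).
have [|b /=|N HN] := sep `[M^-1%R, M]%classic; first exact: segment_compact.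
  by rewrite in_itv/= => /andP[+ _]; apply: lt_le_trans; rewrite invr_gt0.
exists N => t.
have inK i : symitv M (t / a i)%R -> (( *%R (a i)) @` `[M^-1%R, M]%classic) t.
  move=> /andP[h1 h2]; exists (t / a i)%R; first by rewrite /= in_itv/= !ltW.
  by rewrite mulrC divfK// gt_eqF.
have [[j Uj]|noj] := pselect (exists j, symitv M (t / a j)%R); last first.
  have -> : [set j | symitv M (t / a j)%R] = set0.
    by apply/seteqP; split => i //= Ui; apply: noj; exists i.
  exact: card_ge0.
apply: card_le_trans (HN j); apply: subset_card_le => i /= Ui.
by exists t; split; exact: inK.
Qed.

Definition level_mass (lam : 'rV[int]_n * int -> R[i]) (j : int) : \bar R :=
  \esum_(k in [set: 'rV[int]_n])
    ((normc (lam (k, j)) `^ p)%:E * wmass v (eball (x k j) (a j))).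

Lemma seq_qnormE lam : seq_qnorm p q v x a lam = scale_norm n p q a (level_mass lam).
Proof. by []. Qed.

Hypothesis v0 : forall x, (0 < v x)%R.

Lemma level_mass_ge0 lam j : 0 <= level_mass lam j.
Proof.
apply: esum_ge0 => k _; apply: mule_ge0; first by rewrite lee_fin powR_ge0.
exact: wmass_ge0.
Qed.

(** The scale depends on [j] alone, so the sum over [k] can be carried out first. *)
Lemma layers_level_mass lam E :
  layers (weights X p v lam) (fun i => (X i).2) E = layers (level_mass lam) a E.
Proof.
apply/funext => t; rewrite /layers esum_swap; last first.
  by move=> i; apply: mule_ge0; [exact: weights_ge0|rewrite lee_fin].
apply: eq_esum => j _ /=; rewrite [RHS]muleC -esum_mulrl ?lee_fin//; last first.
  move=> k; apply: mule_ge0; first by rewrite lee_fin powR_ge0.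
  exact: wmass_ge0.
by apply: eq_esum => k _; rewrite muleC.
Qed.

Hypotheses (p0 : (0 < p)%R) (q0 : 0 < q) (mv : measurable_fun setT v).
Hypotheses (X0 : forall i, axbG (X i)) (sepX : relatively_separated X).
Hypothesis dv : doubling v.

Lemma Lpq_d_equiv_seq : q = p%:E \/ relatively_separated_scales a ->
  forall U : set GT, rel_compact_nbhd1 U -> measurable U ->
  equivalent_qnormed (Lpq_d p q v X U) (Lpq_d_qnorm p q v X U)
                     (seq_space p q v x a) (seq_qnorm p q v x a).
Proof.
move=> qsep U cU mU.
have a0 j : (0 < a j)%R := X0 (0%R, j).
have sep : q = p%:E \/ (forall M : R, (1 < M)%R -> exists N : nat, forall t : R,
    ([set j | symitv M (t / a j)%R] #<= `I_N)%card).
  by case: qsep => [|/scales_overlap h]; [left|right; exact: h].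
have [M [C [M1 C0 HC]]] := Lpq_d_qnorm_le_layers p0 q0 v0 mv X0 sepX dv cU mU.
have [C1 C10 HC1] := @mixed_norm_layers_le R n p q _ 0%R a p0 q0 a0 sep M M1.
have [C2 C20 HC2] := @scale_norm_le_layers R n p q _ a p0 q0 a0 sep M M1.
have [C3 C30 HC3] := layers_weights_le p0 q0 v0 mv X0 sepX dv cU mU M1.
apply: (@equivalent_qnormed_intro _ _ _ _ _ _ (C2 * C3)%R (C * C1)%R).
- exact: mulr_gt0.
- exact: mulr_gt0.
- by move=> lam; exact: Lpq_d_qnorm_lty.
- by [].
- move=> lam; rewrite seq_qnormE.
  apply: le_trans (HC2 _ (level_mass_ge0 lam)) _; rewrite EFinM -muleA.
  apply: lee_wpmul2l; first by rewrite lee_fin ltW.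
  by rewrite -layers_level_mass; exact: HC3.
- move=> lam; rewrite seq_qnormE; apply: le_trans (HC lam) _; rewrite EFinM -muleA.
  apply: lee_wpmul2l; first by rewrite lee_fin ltW.
  by rewrite layers_level_mass; apply: HC1; exact: level_mass_ge0.
Qed.

End sequence_norm.

Lemma Lpq_d_equiv (R : realType) (n : nat) (I : countType) (X : I -> 'rV[R]_n * R)
    (p : R) (q : \bar R) (v : 'rV[R]_n -> R) (U U' : set ('rV[R]_n * R)) :
  0 < p -> (0 < q)%E -> (forall x, 0 < v x) -> measurable_fun setT v -> doubling v ->
  (forall i, axbG (X i)) -> relatively_separated X ->
  rel_compact_nbhd1 U -> measurable U -> rel_compact_nbhd1 U' -> measurable U' ->
  equivalent_qnormed (Lpq_d p q v X U) (Lpq_d_qnorm p q v X U)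
                     (Lpq_d p q v X U') (Lpq_d_qnorm p q v X U').
Proof.
move=> p0 q0 v0 mv dv X0 sepX cU mU cU' mU'.
have [C1 C10 H1] := Lpq_d_qnorm_le p0 q0 v0 mv X0 sepX dv cU mU cU' mU'.
have [C2 C20 H2] := Lpq_d_qnorm_le p0 q0 v0 mv X0 sepX dv cU' mU' cU mU.
by apply: (equivalent_qnormed_intro C10 C20) => // lam; exact: Lpq_d_qnorm_lty.
Qed.

(** * Null sets and control functions *)

Section vol_translation.
Context {R : realType}.
Local Open Scope ereal_scope.

Lemma measurable_rV_addr n (z : 'rV[R]_n) : measurable_fun setT (fun y : 'rV[R]_n => (y + z)%R).
Proof.
apply: measurable_fun_rV => i.
rewrite (_ : (fun _ => _) = (fun y : 'rV[R]_n => y ord0 i + z ord0 i)%R); last first.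
  by apply/funext => y; rewrite mxE.
by apply: measurable_funD => //; exact: measurable_rV_coor.
Qed.

Lemma vol_translate n (z : 'rV[R]_n) (A : set 'rV[R]_n) : measurable A ->
  vol n ((fun y => (y + z)%R) @^-1` A) = vol n A.
Proof.
elim: n z A => [|n ih] z A mA.
  congr (vol 0 _); rewrite (_ : (fun y => _) = id)//.
  by apply/funext => y; apply/rowP => -[].
pose z' : 'rV[R]_n := \row_j z ord0 (lift ord0 j).
pose T (w : measurableTypeR R * 'rV[R]_n) : measurableTypeR R * 'rV[R]_n :=
  ((w.1 + z ord0 ord0)%R, (w.2 + z')%R).
have mB : measurable (@rV_cons _ R n @^-1` A).
  by rewrite -[X in measurable X]setTI; exact: measurable_rV_cons.
transitivity ((lebesgue_measure \x vol n) (T @^-1` (@rV_cons _ R n @^-1` A))).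
  rewrite /= /vol_succ /pushforward; congr (_ _).
  apply/seteqP; split => -[s y] /=.
    rewrite (_ : (rV_cons (s, y) + z)%R = rV_cons (T (s, y)))//.
    by apply/rowP => i; rewrite !mxE; case: unliftP => [j ->|->] /=; rewrite ?mxE.
  rewrite (_ : (rV_cons (s, y) + z)%R = rV_cons (T (s, y)))//.
  by apply/rowP => i; rewrite !mxE; case: unliftP => [j ->|->] /=; rewrite ?mxE.
have mT : measurable_fun setT T.
  apply: measurable_fun_pair.
    by apply: measurable_funD => //; exact: measurable_fst.
  exact: (measurableT_comp (measurable_rV_addr z') measurable_snd).
change (pushforward (lebesgue_measure \x vol n) T (@rV_cons _ R n @^-1` A) =
  (lebesgue_measure \x vol n) (@rV_cons _ R n @^-1` A)).
(* The product measure is determined by rectangles, where the one-dimensional case and the induction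
   hypothesis apply to the factors. *)
apply/esym/product_measure_unique => //.
move=> A1 A2 mA1 mA2.
change ((lebesgue_measure \x vol n) (((fun s => (s + z ord0 ord0)%R) @^-1` A1) `*`
  ((fun y => (y + z')%R) @^-1` A2)) = lebesgue_measure A1 * vol n A2).
rewrite product_measure1E.
- by congr (_ * _); [exact: lebesgue_measure_shift|exact: ih].
- by rewrite -[X in measurable X]setTI; apply: (measurable_funD (f := id) (g := cst (z ord0 ord0))).
- by rewrite -[X in measurable X]setTI; exact: measurable_rV_addr.
Qed.

End vol_translation.

Section haar_null.
Context {R : realType} {n : nat}.
Local Notation GT := ('rV[R]_n * R)%type.
Local Open Scope ereal_scope.
Local Notation mu := (vol n \x (@lebesgue_measure R)).

(** The Haar density is nonzero exactly on the half-space, so there Haar measure and the product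
    measure have the same null sets. *)
Lemma haar_null (N : set GT) : measurable N -> haar N = 0 <-> mu.-negligible (N `&` axbG).
Proof.
move=> mN.
have dE : haar N = \int[mu]_(g in N) `|(haar_density g)%:E|.
  by apply: eq_integral => g _; rewrite gee0_abs// lee_fin haar_density_ge0.
have md : measurable_fun N (fun g : GT => (haar_density g)%:E).
  by apply: measurable_funTS; apply/measurable_EFinP; exact: measurable_haar_density.
rewrite dE; split.
  move/(ae_eq_integral_abs mu mN md) => [N' [mN' N'0 sub]].
  exists N'; split => // g [Ng Gg]; apply: sub => /= /(_ Ng).
  rewrite /haar_density ifT//= => -[] /eqP; rewrite invr_eq0 expf_eq0/= gt_eqF//.
move=> [N' [mN' N'0 sub]]; apply/(ae_eq_integral_abs mu mN md).
exists N'; split => // g /= /not_implyP[Ng] d0; apply: sub; split => //.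
by rewrite /axbG/=; apply: contra_notT d0 => g0; rewrite /haar_density (negbTE g0).
Qed.

Lemma ae_haarE (P : GT -> Prop) :
  (\forall h \ae haar, P h) <-> mu.-negligible ([set h | ~ P h] `&` axbG).
Proof.
split=> [[N [mN N0 PN]]|[N [mN N0 PN]]].
  have := (haar_null mN).1 N0; apply: negligibleS; exact: setSI.
exists (N `|` ~` axbG); split.
- by apply: measurableU => //; apply: measurableC; exact: measurable_axbG.
- apply/haar_null.
    by apply: measurableU => //; apply: measurableC; exact: measurable_axbG.
  exists N; split => // g [[//|]].
  by move=> /[apply].
- move=> h /= Ph; have [hG|] := pselect (axbG h); last by right.
  by left; apply: PN.
Qed.

(** Slices at a fixed scale are taken because right multiplication acts on them by translations of
    the space variable. The absolute value fits the criterion for a vanishing integral. *)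
Lemma measure_ysectionE (A : set GT) : measurable A ->
  mu A = \int[lebesgue_measure]_b `|vol n (ysection A b)|.
Proof.
move=> mA; transitivity ((vol n \x^ (@lebesgue_measure R)) A).
  apply: product_measure_unique => // A1 A2 mA1 mA2.
  exact: product_measure2E.
by apply: eq_integral => b _; rewrite gee0_abs.
Qed.

(** The slice of the preimage at scale [b] is a translate, by a multiple of [g.1], of the slice of
    the set at scale [g.2 * b]; almost every slice stays null because dilations of the scale
    preserve null sets. *)
Lemma negligible_axb_mulr (g : GT) (A : set GT) : axbG g -> mu.-negligible A ->
  mu.-negligible ((axb_mul ^~ g) @^-1` A).
Proof.
move=> g0 [N [mN N0 AN]]; exists ((axb_mul ^~ g) @^-1` N).
have mN' : measurable ((axb_mul ^~ g) @^-1` N).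
  by rewrite -[X in measurable X]setTI; exact: measurable_axb_mulr.
split => //; last by move=> h /AN.
have f0 b : 0 <= vol n (ysection N b) by exact: measure_ge0.
have mf : measurable_fun setT (fun b : measurableTypeR R => vol n (ysection N b)).
  exact: measurable_fun_ysection.
have shiftE b : vol n (ysection ((axb_mul ^~ g) @^-1` N) b) = vol n (ysection N (g.2 * b)%R).
  rewrite -(vol_translate (b *: g.1)%R (A := ysection N (g.2 * b)%R)); last first.
    exact: measurable_ysection.
  congr (vol n _); apply/seteqP; split => y; rewrite /ysection/= !inE/=;
    by rewrite /axb_mul/= mulrC.
rewrite measure_ysectionE//; under eq_integral do rewrite shiftE.
have := N0; rewrite measure_ysectionE//.
move/(ae_eq_integral_abs lebesgue_measure measurableT mf) => [Z [mZ Z0 HZ]].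
have mg : measurable_fun setT (fun b : measurableTypeR R => (g.2 * b)%R : measurableTypeR R).
  exact: measurable_funM.
have mgZ : measurable (( *%R g.2) @^-1` Z : set (measurableTypeR R)).
  by rewrite -[X in measurable X]setTI; exact: mg.
apply/(ae_eq_integral_abs lebesgue_measure measurableT (measurableT_comp mf mg)).
exists (( *%R g.2) @^-1` Z); split => //.
  by apply: (etrans (lebesgue_measure_scale g0 mZ)); rewrite [X in _ * X]Z0 mule0.
by move=> b /= Hb; apply: HZ => /= H; apply: Hb => _; exact: H.
Qed.

Lemma ae_haar_mulr (g : GT) (P : GT -> Prop) : axbG g ->
  (\forall h \ae haar, P h) -> \forall h \ae haar, P (axb_mul h g).
Proof.
move=> g0 /ae_haarE nP; apply/ae_haarE.
apply: negligibleS (negligible_axb_mulr g0 nP) => h [Ph hG]; split => //.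
exact: axbG_mul.
Qed.

End haar_null.

Section product_xsection.
Context {R : realType} (n : nat).
Local Open Scope ereal_scope.
Local Notation mu := (vol n \x (@lebesgue_measure R)).

Lemma sigma_finite_vol_lebesgue : sigma_finite setT mu.
Proof.
have /sigma_finiteP[F [TF ndF Foo]] := sigma_finiteT (vol n : {sigma_finite_measure set 'rV[R]_n -> \bar R}).
have /sigma_finiteP[G [TG ndG Goo]] := sigma_finiteT (@lebesgue_measure R).
exists (fun k => F k `*` G k).
  rewrite -setXTT TF TG predeqE => -[x y]; split.
    move=> [/= [k _ Fkx] [l _ Gly]]; exists (maxn k l) => //; split.
    - by move: x Fkx; exact/subsetPset/ndF/leq_maxl.
    - by move: y Gly; exact/subsetPset/ndG/leq_maxr.
  by move=> [k _ []/= ? ?]; split; exists k.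
move=> k; have [? ?] := Foo k; have [? ?] := Goo k.
split; first exact: measurableX.
by rewrite product_measure1E// lte_mul_pinfty// ge0_fin_numE.
Qed.

Lemma measurable_xsection_vol d (T : measurableType d)
    (B : set (T * ('rV[R]_n * measurableTypeR R))) : measurable B ->
  measurable_fun setT (fun t => mu (xsection B t)).
Proof.
pose mix := Measure_isSigmaFinite.Build _ _ _ mu sigma_finite_vol_lebesgue.
pose mu' : {sigma_finite_measure set ('rV[R]_n * measurableTypeR R)%type -> \bar R} :=
  HB.pack mu mix.
exact: (measurable_fun_xsection mu').
Qed.

End product_xsection.

(** * Measurability of control functions *)

Section control_function.
Context {R : realType} {n : nat}.
Local Notation GT := ('rV[R]_n * R)%type.
Local Notation normc := ComplexField.Normc.normc.
Local Open Scope ereal_scope.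
Local Notation mu := (vol n \x (@lebesgue_measure R)).
Implicit Types (Q K : set GT) (F : GT -> R[i]).

Lemma measurable_normc F : measurable_fun axbG (fun g => complex.Re (F g)) ->
  measurable_fun axbG (fun g => complex.Im (F g)) ->
  measurable_fun axbG (fun g => normc (F g)).
Proof.
move=> mRe mIm.
rewrite (_ : (fun g => normc (F g)) =
  (fun g => Num.sqrt (complex.Re (F g) ^+ 2 + complex.Im (F g) ^+ 2))%R); last first.
  by apply/funext => g; case: (F g).
apply: (measurableT_comp (f := @Num.sqrt R)).
  by apply: continuous_measurable_fun; exact: sqrt_continuous.
by apply: measurable_funD; exact: measurable_funX.
Qed.

(** The quotient of [z.2] by [z.1] on the left, with the inverse scale written as a real power: it
    is measurable on the whole line and agrees with the inverse at positive scales. *)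
Let axb_div (z : GT * GT) : GT :=
  ((z.1.2 `^ (- 1))%R *: (z.2.1 - z.1.1)%R, (z.2.2 * z.1.2 `^ (- 1))%R).

Let measurable_axb_div : measurable_fun setT axb_div.
Proof.
have mp : measurable_fun setT (fun z : GT * GT => (z.1.2 `^ (- 1))%R).
  apply: (measurableT_comp (measurable_powR (- 1))).
  exact: (measurableT_comp measurable_snd measurable_fst).
apply: measurable_fun_pair; last first.
  apply: measurable_funM => //.
  exact: (measurableT_comp measurable_snd measurable_snd).
apply: measurable_fun_rV => i.
rewrite (_ : (fun _ => _) =
  (fun z : GT * GT => z.1.2 `^ (- 1) * (z.2.1 ord0 i - z.1.1 ord0 i))%R); last first.
  by apply/funext => z; rewrite !mxE.
apply: measurable_funM => //; apply: measurable_funB.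
  exact: (measurableT_comp (measurable_rV_coor i) (measurableT_comp measurable_fst measurable_snd)).
exact: (measurableT_comp (measurable_rV_coor i) (measurableT_comp measurable_fst measurable_fst)).
Qed.

(* {g | control_fun Q F g > r} is the set of g for which a section of a
   measurable subset of G x G is not null. *)
Lemma measurable_control_fun Q F : measurable Q ->
  measurable_fun axbG (fun g => normc (F g)) -> measurable_fun axbG (control_fun Q F).
Proof.
move=> mQ mF.
pose f : GT -> R := (fun g => normc (F g)) \_ axbG.
have mf : measurable_fun setT f by apply/(measurable_restrictT _ measurable_axbG).
pose phi (z : GT * GT) : R := (\1_Q (axb_div z) * f z.2)%R.
have mphi : measurable_fun setT phi.
  apply: measurable_funM; last exact: (measurableT_comp mf measurable_snd).
  exact: (measurableT_comp (measurable_indic (D := setT) mQ) measurable_axb_div).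
apply: (measurability _ (ErealGenOInfty.measurableE R)) => // _ [_ [r ->] <-].
pose B : set (GT * GT) := [set z | axbG z.2 /\ (r < phi z)%R].
have mB : measurable B.
  rewrite (_ : B = snd @^-1` axbG `&` (phi @^-1` `]r, +oo[)); last first.
    by apply/seteqP; split => z /=; rewrite /B/= in_itv/= andbT.
  apply: measurableI; rewrite -[X in measurable X]setTI.
    by apply: measurable_snd => //; exact: measurable_axbG.
  by apply: mphi => //; exact: measurable_itv.
rewrite (_ : _ `&` _ = axbG `&` [set g | 0 < mu (xsection B g)]); last first.
  apply/seteqP; split => g [gG] /=; rewrite ?in_itv/= ?andbT => H; split => //.
  - rewrite lt_neqAle measure_ge0 andbT eq_sym; apply/negP => /eqP B0.
    move: H; rewrite ltNge => /negP; apply; apply/ess_supP; apply/ae_haarE.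
    exists (xsection B g); split => //; first exact: measurable_xsection.
    move=> h [/= H hG]; rewrite /xsection/= inE; split => //=.
    rewrite /phi /f patchE mem_set// ltNge; apply/negP => le; apply: H.
    rewrite lee_fin; apply: le_trans le.
    rewrite /axb_L axb_divE /axb_div/=.
    by rewrite powR_inv1//; exact: ltW gG.
  - rewrite ltNge; apply/negP => /ess_supP/ae_haarE[N [mN N0 HN]].
    move: H; rewrite ltNge => /negP; apply; rewrite -N0.
    apply: le_measure; rewrite ?inE//; first exact: measurable_xsection.
    move=> h; rewrite /xsection/= inE => -[/= hG]; rewrite /phi /f patchE mem_set//= => H.
    apply: HN; split => //= /=; rewrite lee_fin leNgt => /negP; apply.
    apply: lt_le_trans H _; rewrite /axb_L axb_divE /axb_div/=.
    by rewrite powR_inv1//; exact: ltW gG.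
apply: emeasurable_fun_o_infty; first exact: measurable_axbG.
apply: measurable_funTS.
exact: measurable_xsection_vol.
Qed.

End control_function.

Section volumes.
Context {R : realType} {n : nat}.
Local Notation GT := ('rV[R]_n * R)%type.
Local Open Scope ereal_scope.

Lemma vol_cube_gt0 (m : nat) (x : 'rV[R]_m) (r : R) : (0 < r)%R -> 0 < vol m (cube x r).
Proof.
move=> r0; elim: m x => [|m ih] x.
  have -> : cube x r = setT by apply/seteqP; split => // y _ [].
  by rewrite /= diracT lte01.
pose x' : 'rV[R]_m := \row_j x ord0 (lift ord0 j).
rewrite (_ : vol m.+1 _ = (lebesgue_measure \x vol m) (ball (x ord0 ord0) r `*` cube x' r)).
  rewrite product_measure1E; [|exact: measurable_ball|exact: measurable_cube].
  apply: mule_gt0; last exact: ih.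
  by rewrite [X in _ < X](lebesgue_measure_ball _ (ltW r0)) lte_fin mulrn_wgt0.
rewrite /= /vol_succ /pushforward; congr (_ _); apply/seteqP; split => -[s y] /=.
  move=> H; split; first by have := H ord0; rewrite mxE unlift_none/= /ball/= distrC.
  by move=> j /=; have := H (lift ord0 j); rewrite !mxE liftK.
move=> [Hs Hy] i; rewrite mxE; case: unliftP => [j ->|->] /=.
  by have := Hy j; rewrite mxE.
by move: Hs; rewrite /ball/= distrC.
Qed.

Lemma haar_box_gt0 (A : set GT) (x : 'rV[R]_n) (a r : R) : measurable A -> (0 < r)%R ->
  (0 < a)%R -> (forall h, cube x r h.1 -> (`|h.2 - a| < r)%R -> A h) -> 0 < haar A.
Proof.
move=> mA r0 a0 HA; rewrite lt_neqAle measure_ge0 andbT eq_sym; apply/negP => /eqP.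
move/(haar_null mA) => [N [mN N0 HN]].
(* The radius in the scale variable is shrunk to at most [a], so that the box stays in the
   half-space. *)
have ra0 : (0 < Num.min r a)%R by rewrite lt_min r0 a0.
have : 0 < (vol n \x (@lebesgue_measure R)) (cube x r `*` ball a (Num.min r a)).
  rewrite product_measure1E; [|exact: measurable_cube|exact: measurable_ball].
  apply: mule_gt0; first exact: vol_cube_gt0.
  by rewrite [X in _ < X](lebesgue_measure_ball _ (ltW ra0)) lte_fin mulrn_wgt0.
rewrite ltNge => /negP; apply; rewrite -N0; apply: le_measure; rewrite ?inE//.
  by apply: measurableX; [exact: measurable_cube|exact: measurable_ball].
move=> [y b] /= [yx]; rewrite /ball/= lt_min => /andP[br ba]; apply: HN.
split; first by apply: HA => //=; rewrite distrC.
by rewrite /axbG/=; move: ba; rewrite ltr_norml => /andP[]; lra.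
Qed.

Lemma haar_setT_gt0 : 0 < haar [set: GT].
Proof. by apply: (@haar_box_gt0 setT 0%R 1%R 1%R). Qed.

Lemma control_fun_ge0 Q (F : GT -> R[i]) g : 0 <= control_fun Q F g.
Proof.
apply: ess_sup_gee; first exact: haar_setT_gt0.
by apply: aeW => h; rewrite lee_fin mulr_ge0// normc_ge0.
Qed.

Lemma ae_forall_count (I : countType) (P : I -> GT -> Prop) :
  (forall i, \forall h \ae haar, P i h) -> \forall h \ae haar, forall i, P i h.
Proof.
move=> H.
have /ae_foralln : forall k : nat, \forall h \ae haar,
    forall i : I, pickle_inv k = Some i -> P i h.
  move=> k; case E : (pickle_inv k) => [i|].
    by apply: filterS (H i) => h Ph j [<-].
  by apply: aeW.
by apply: filterS => h Hh i; apply: (Hh (pickle i)); rewrite pickleK_inv.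
Qed.

End volumes.

(** * The grid of half-open cubes *)

Section grid.
Context {R : realType} {n : nat}.
Implicit Types (x : 'rV[R]_n) (m : 'rV[int]_n) (D : R).

(** Rounding down makes the cells half-open, so that they partition the space exactly and every
    point has one index. *)
Definition cell_idx D x : 'rV[int]_n := \row_i Num.floor (x ord0 i / D).
Definition cell D m : set 'rV[R]_n := [set x | cell_idx D x = m].
Definition cell_center D m : 'rV[R]_n := \row_i (D * ((m ord0 i)%:~R + 2^-1)).

Lemma cell_itv D x i : 0 < D ->
  D * (cell_idx D x ord0 i)%:~R <= x ord0 i < D * (cell_idx D x ord0 i)%:~R + D.
Proof.
move=> D0; rewrite mxE; set k := Num.floor _.
have /andP[h1 h2] := floor_itv (x ord0 i / D).
move: h1 h2; rewrite -/k ler_pdivlMr// ltr_pdivrMr// => h1 h2.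
by rewrite mulrC h1 /=; move: h2; rewrite intrD mulrDl mul1r.
Qed.

Lemma cell_dist D m x y i : 0 < D -> cell D m x -> cell D m y ->
  `|x ord0 i - y ord0 i| < D.
Proof.
move=> D0 <- yx; have := cell_itv x i D0; have := cell_itv y i D0; rewrite yx.
move: (D * _) => k; rewrite ltr_norml; lra.
Qed.

Lemma cell_sub_cube D m : 0 < D -> cell D m `<=` cube (cell_center D m) D.
Proof.
move=> D0 x <- i; have := cell_itv x i D0; rewrite [cell_center _ _ _ _]mxE mulrDr.
move: (D * _%:~R) => k; rewrite ltr_norml; lra.
Qed.

Lemma cube_sub_cell D m : 0 < D -> cube (cell_center D m) (D / 2) `<=` cell D m.
Proof.
move=> D0 x xc; apply/rowP => i; rewrite mxE; apply: floor_def.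
have := xc i; rewrite [cell_center _ _ _ _]mxE mulrDr ltr_norml.
rewrite ler_pdivlMr// ltr_pdivrMr// intrD mulrDl mul1r [_ * D]mulrC.
move: (D * _%:~R) => k; lra.
Qed.

Lemma measurable_cell D m : 0 < D -> measurable (cell D m).
Proof.
move=> D0; rewrite (_ : cell D m = \bigcap_(i in [set: 'I_n]) ((fun y => y ord0 i) @^-1`
    `[D * (m ord0 i)%:~R, D * (m ord0 i)%:~R + D[)).
  apply: fin_bigcap_measurable; first exact: finite_finset.
  move=> i _; rewrite -[X in measurable X]setTI.
  by apply: (@measurable_rV_coor _ _ n i) => //; exact: measurable_itv.
apply/seteqP; split => [x <- i _ /=|x H]; first by rewrite in_itv/=; exact: cell_itv.
apply/rowP => i; rewrite mxE; apply: floor_def.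
have := H i Logic.I; rewrite /= in_itv/=.
by rewrite ler_pdivlMr// ltr_pdivrMr// intrD mulrDl mul1r [_ * D]mulrC.
Qed.

End grid.

(** * Right translation and local boundedness *)

Section right_translation.
Context {R : realType} {n : nat}.
Local Notation GT := ('rV[R]_n * R)%type.
Local Notation normc := ComplexField.Normc.normc.
Local Open Scope ereal_scope.
Implicit Types (Q K : set GT) (F : GT -> R[i]) (g : GT).

Lemma axb_compact_mulr K g : axb_compact K -> axbG g -> axb_compact ((axb_mul ^~ g) @` K).
Proof.
move=> [cK KG] gG; split; last by move=> _ [h /KG hG <-]; exact: axbG_mul.
apply: continuous_compact cK; apply: continuous_subspaceT => h.
have c1 : (fun w : GT => w.1 + w.2 *: g.1)%R @ h --> (h.1 + h.2 *: g.1)%R.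
  apply: cvgD; first exact: cvg_fst.
  by apply: cvgZr_tmp; exact: cvg_snd.
have c2 : (fun w : GT => w.2 * g.2)%R @ h --> (h.2 * g.2)%R.
  by apply: cvgM; [exact: cvg_snd|exact: cvg_cst].
exact: (cvg_pair c1 c2).
Qed.

Lemma measurable_axb_R (f : GT -> R) g : axbG g -> measurable_fun axbG f ->
  measurable_fun axbG (fun h => f (axb_mul h g)).
Proof.
move=> gG mf; apply: (@measurable_comp _ _ _ _ _ _ axbG) => //.
- exact: measurable_axbG.
- by move=> _ [h hG <-]; exact: axbG_mul.
- by apply: measurable_funTS; exact: measurable_axb_mulr.
Qed.

(** On [K] the translate takes the values of [F] on the compact set of products of [K] by [g], and
    right multiplication pulls null sets back to null sets. *)
Lemma Linf_loc_R F g : axbG g -> Linf_loc F -> Linf_loc (axb_R g F).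
Proof.
move=> gG [mRe mIm bF]; split.
- exact: (measurable_axb_R gG mRe).
- exact: (measurable_axb_R gG mIm).
move=> K cK; apply: (le_lt_trans _ (bF _ (axb_compact_mulr cK gG))).
apply/ess_supP.
set M := ess_sup _ _.
have : \forall h \ae haar, (\1_((axb_mul ^~ g) @` K) h * normc (F h))%:E <= M.
  exact: ess_sup_ge.
move/(ae_haar_mulr gG); apply: filterS => h /=; apply: le_trans.
rewrite lee_fin ler_wpM2r ?normc_ge0// !indicE.
have [hK|//] := boolP (h \in K); rewrite mem_set//.
by exists h => //; rewrite inE in hK.
Qed.

End right_translation.

(** * Doubling and right translation invariance *)

Section doubling_right_invariant.
Context {R : realType} {n : nat}.
Local Notation GT := ('rV[R]_n * R)%type.
Local Notation normc := ComplexField.Normc.normc.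
Local Open Scope ereal_scope.
Variables (p : R) (v : 'rV[R]_n -> R).
Hypotheses (p0 : (0 < p)%R) (v0 : forall x, (0 < v x)%R) (mv : measurable_fun setT v).

Lemma measurable_fiber_fun (F : GT -> \bar R) (a : R) : (0 < a)%R ->
  measurable_fun axbG F -> measurable_fun setT (fun x => `|F (x, a)| `^ p * (v x)%:E).
Proof.
move=> a0 mF; apply: emeasurable_funM; last exact/measurable_EFinP.
apply: measurable_fun_poweR; apply: measurableT_comp => //.
apply: (@measurable_comp _ _ _ _ _ _ axbG F _ (fun x => (x, a))) => //.
- exact: measurable_axbG.
- by move=> _ [x _ <-].
Qed.

Lemma esum_cells_le (D : R) (H : 'rV[R]_n -> \bar R) : (0 < D)%R ->
  measurable_fun setT H -> (forall x, 0 <= H x) ->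
  \esum_(m in [set: 'rV[int]_n]) \int[vol n]_x ((\1_(cell D m) x)%:E * H x) <=
  \int[vol n]_x H x.
Proof.
move=> D0 mH H0; rewrite -ge0_integral_esum//; last 2 first.
- move=> m; apply: emeasurable_funM => //; apply/measurable_EFinP.
  by apply: measurable_indic; exact: measurable_cell.
- by move=> m x; apply: mule_ge0 => //; rewrite lee_fin.
apply: ge0_le_integral_nm => x _.
  by apply: esum_ge0 => m _; apply: mule_ge0 => //; rewrite lee_fin.
rewrite -[leRHS]mul1e; apply: (@esum_le_card _ _ _ 1 (H x)) => //.
- by move=> m; apply: mule_ge0 => //; rewrite lee_fin.
- have sub : [set m | (\1_(cell D m) x)%:E * H x != 0] `<=` [set cell_idx D x].
    move=> m /=; apply: contra_neqP => /eqP mx.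
    rewrite indicE memNset ?mul0e// /cell/= => xm; move: mx; rewrite xm eqxx.
    by [].
  apply: card_le_trans (subset_card_le sub) _.
  by have := @card_set1 _ (cell_idx D x); rewrite card_eq_le => /andP[].
- by move=> m; rewrite indicE; case: (_ \in _); rewrite ?mul1e// mul0e.
Qed.

Hypothesis dv : doubling v.

Lemma fiber_mass_control_R (Q : set GT) (g0 : GT) : rel_compact_nbhd1 Q -> measurable Q ->
  axbG g0 -> exists (ts : seq R) (C : R), [/\ (forall t, t \in ts -> (0 < t)%R), (0 < C)%R &
  forall F : GT -> R[i], measurable_fun axbG (fun g => normc (F g)) ->
  forall a, (0 < a)%R ->
  fiber_mass p v (control_fun Q (axb_R g0 F)) a <=
    C%:E * \sum_(t <- ts) fiber_mass p v (control_fun Q F) (t * a)%R].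
Proof.
move=> cQ mQ g0G; have t0 : (0 < g0.2)%R := g0G.
have [M M1 QM] := rel_compact_bounds cQ.
have [e [c [e0 c1 Qe]]] := nbhs1_box cQ.1.
have M0 : (0 < M)%R by rewrite (lt_trans _ M1).
(* Right multiplication by [g0] multiplies scales by [g0.2]; [M2] dominates both [M * g0.2] and
   [M / g0.2], so ratios from [symitv M] land in [symitv M2]. *)
pose M2 := (M * (1 + g0.2 + g0.2^-1))%R.
have tV0 : (0 < g0.2^-1)%R by rewrite invr_gt0.
have M21 : (1 < M2)%R.
  apply: (lt_le_trans M1); rewrite /M2 ler_peMr ?(ltW M0)//; lra.
have M20 : (0 < M2)%R by rewrite (lt_trans _ M21).
have [ss [ss0 Hss]] := symitv_cover c1 M21.
pose S := (1 + \sum_(s <- ss) s)%R.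
have S0 : (0 < S)%R.
  by rewrite ltr_wpDr// big_seq sumr_ge0// => s /ss0 /ltW.
have leS s : s \in ss -> (s <= S)%R.
  move=> sss; rewrite /S (big_rem s)//= addrCA lerDl addr_ge0//.
  by rewrite big_seq sumr_ge0// => s' /mem_rem /ss0 /ltW.
(* Cells will have side [d * a]. Since [s <= S], two points of a cell differ by at most [e] in units
   of the scale [a / s], which fits into the box contained in [Q]. *)
pose d := (e / S)%R; have d0 : (0 < d)%R by exact: divr_gt0.
pose Z := (1 + \sum_i `|g0.1 ord0 i|)%R.
have Z0 : (0 < Z)%R by rewrite ltr_wpDr// sumr_ge0.
have leZ i : (`|g0.1 ord0 i| <= Z)%R.
  by rewrite /Z (bigD1 i)//= addrCA lerDl addr_ge0// sumr_ge0.
(* In units of [a]: [M] bounds the distance from the base point to a point of its translate of [Q],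
   [M * Z] the displacement by [g0], and [d] the distance to the centre of the cell reached. *)
pose M3 := (M + M * Z + d)%R.
have M30 : (0 < M3)%R by rewrite addr_gt0// addr_gt0// mulr_gt0.
have d20 : (0 < d / 2)%R by exact: divr_gt0.
(* The inner cube of radius [d / 2], in units of [a], is the one contained in a cell. *)
have [C C0 HC] := doubling_cubes v0 dv M30 d20.
exists [seq s^-1%R | s <- ss], C; split => //.
  by move=> _ /mapP[s /ss0 s0 ->]; rewrite invr_gt0.
move=> F mF a a0; pose D := (d * a)%R; have D0 : (0 < D)%R by exact: mulr_gt0.
pose A (s : R) (m : 'rV[int]_n) : set GT := [set h | cell D m h.1 /\ symitv c (s * h.2 / a)%R].
pose Fm (s : R) (m : 'rV[int]_n) := ess_sup haar (fun h : GT => (\1_(A s m) h * normc (F h))%:E).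
have Fm0 s m : 0 <= Fm s m.
  apply: ess_sup_gee; first exact: haar_setT_gt0.
  by apply: aeW => h; rewrite lee_fin mulr_ge0// normc_ge0.
pose chi (m : 'rV[int]_n) (x : 'rV[R]_n) : \bar R := (\1_(cube (cell_center D m) (M3 * a)) x)%:E.
have chi0 m x : 0 <= chi m x by rewrite lee_fin.
(* |F| on the cell m, at scale a / s, is controlled from every base point of the cell. *)
have Fm_le s m x : s \in ss -> cell D m x -> Fm s m <= control_fun Q F (x, (s^-1 * a)%R).
  move=> sss xm; have s0 := ss0 _ sss.
  apply: le_ess_sup; apply: aeW => h; rewrite lee_fin ler_wpM2r ?normc_ge0//.
  rewrite /axb_L !indicE; have [|//] := boolP (h \in A s m); rewrite inE => -[hm hs].
  rewrite mem_set// axb_divE; apply: Qe => /=; last first.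
    by move: hs; rewrite /symitv/= invfM invrK mulrA [(h.2 * s)%R]mulrC.
  move=> i; rewrite !mxE subr0 normrM invfM invrK.
  have h1x := cell_dist i D0 hm xm.
  rewrite gtr0_norm; last by rewrite divr_gt0.
  apply: (@lt_le_trans _ _ (s / a * D)%R); first by rewrite ltr_pM2l// divr_gt0.
  rewrite /D mulrAC -mulrA mulfK ?gt_eqF// /d mulrA ler_pdivrMr// mulrC.
  by rewrite ler_wpM2l ?(ltW e0)// leS.
have K_le x : `|control_fun Q (axb_R g0 F) (x, a)| `^ p <=
    \sum_(s <- ss) \esum_(m in [set: 'rV[int]_n]) (chi m x * Fm s m `^ p).
  have term0 s m : 0 <= chi m x * Fm s m `^ p by apply: mule_ge0 => //; exact: poweR_ge0.
  set B := \sum_(s <- ss) _.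
  have B0 : 0 <= B by apply: sume_ge0 => s _; exact: esum_ge0.
  rewrite gee0_abs ?control_fun_ge0//.
  rewrite -[leRHS](@poweRVK _ B p) ?gt_eqF//; apply: le_poweR; [exact: ltW|exact: control_fun_ge0|].
  apply/ess_supP.
  (* The pieces are indexed by cells and positions in the list, a countable type, so that one null
     set serves all of them before right multiplication is applied. *)
  have : \forall h \ae haar, forall i : 'rV[int]_n * nat,
      (\1_(A (nth 1%R ss i.2) i.1) h * normc (F h))%:E <= Fm (nth 1%R ss i.2) i.1.
    by apply: ae_forall_count => i; exact: ess_sup_ge.
  move/(ae_haar_mulr g0G); apply: filterS => h /= Hh.
  rewrite /axb_L indicE.
  have [|_] := boolP (_ \in Q); last by rewrite mul0r poweR_ge0.
  rewrite inE axb_divE => /QM[/= h1 /andP[h2 h3]]; rewrite mul1r /axb_R.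
  set h' := axb_mul h g0.
  have ha0 : (0 < h.2 / a)%R by apply: lt_trans h2; rewrite invr_gt0.
  have h20 : (0 < h.2)%R by move: ha0; rewrite pmulr_lgt0// invr_gt0.
  have [s sss hs] : exists2 s, s \in ss & symitv c (s * (h'.2 / a))%R.
    apply: Hss; rewrite /h'/= mulrAC.
    set b := (h.2 / a)%R in ha0 h2 h3 *.
    apply/andP; split.
      rewrite invf_plt ?posrE//; last exact: mulr_gt0.
      rewrite invfM; apply: (@lt_le_trans _ _ (M * g0.2^-1)%R).
        by rewrite ltr_pM2r// invf_plt ?posrE.
      by rewrite ler_pM2l//; lra.
    apply: (@lt_le_trans _ _ (M * g0.2)%R); first by rewrite ltr_pM2r.
    by rewrite ler_pM2l//; lra.
  pose m := cell_idx D h'.1.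
  have := Hh (m, index s ss); rewrite /= nth_index// indicE mem_set; last first.
    by split => //; rewrite -mulrA.
  rewrite mul1r => /le_trans; apply.
  have chi1 : chi m x = 1.
    rewrite /chi indicE mem_set// => i.
    have hc := cell_sub_cube D0 (erefl : cell D m h'.1) i.
    have hx : (`|x ord0 i - h'.1 ord0 i| < (M + M * Z) * a)%R.
      rewrite distrC /h' !mxE /= addrAC.
      apply: (le_lt_trans (ler_normD _ _)); rewrite mulrDl ltr_leD//.
        have := h1 i; rewrite !mxE subr0 normrM gtr0_norm ?invr_gt0//.
        by rewrite mulrC ltr_pdivrMr.
      rewrite normrM gtr0_norm// mulrAC ler_pM ?(ltW h20)//.
      by rewrite ltW// -ltr_pdivrMr.
    rewrite (_ : _ - _ = (x ord0 i - h'.1 ord0 i) + (h'.1 ord0 i - cell_center D m ord0 i))%R; last by ring.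
    apply: (le_lt_trans (ler_normD _ _)).
    by rewrite /M3 mulrDl ltrD.
  rewrite -(@poweRK _ (Fm s m) p) ?gt_eqF//; apply: le_poweR.
  - by rewrite invr_ge0 ltW.
  - exact: poweR_ge0.
  rewrite /B (big_rem s)//=; apply: (@le_trans _ _ (\esum_(m in [set: 'rV[int]_n]) (chi m x * Fm s m `^ p))).
    apply: le_trans (esum_ge1 m _) => //.
    by rewrite chi1 mul1e.
  by rewrite leeDl// sume_ge0// => s' _; exact: esum_ge0.
have mK : measurable_fun axbG (control_fun Q F) by exact: measurable_control_fun.
have mchi m : measurable_fun setT (chi m).
  by apply/measurable_EFinP; apply: measurable_indic; exact: measurable_cube.
apply: (@le_trans _ _ (\sum_(s <- ss) \esum_(m in [set: 'rV[int]_n])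
    (Fm s m `^ p * wmass v (cube (cell_center D m) (M3 * a))))).
  apply: (@le_trans _ _ (\int[vol n]_x \sum_(s <- ss) \esum_(m in [set: 'rV[int]_n])
     (Fm s m `^ p * (chi m x * (v x)%:E)))).
    apply: ge0_le_integral_nm => x _.
      by apply: mule_ge0; [exact: poweR_ge0|rewrite lee_fin ltW].
    apply: (@le_trans _ _ ((\sum_(s <- ss) \esum_(m in [set: 'rV[int]_n]) (chi m x * Fm s m `^ p)) * (v x)%:E)).
      by apply: lee_wpmul2r => //; rewrite lee_fin ltW.
    rewrite ge0_sume_distrl; last first.
      by move=> s _; apply: esum_ge0 => m _; apply: mule_ge0 => //; exact: poweR_ge0.
    apply: lee_sum => s _; rewrite muleC -esum_mulrl; last 2 first.
    - by rewrite lee_fin ltW.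
    - by move=> m; apply: mule_ge0 => //; exact: poweR_ge0.
    by apply: le_esum => m _; rewrite [leLHS]muleC [chi m x * Fm s m `^ p]muleC -muleA.
  have cv0 m x : 0 <= chi m x * (v x)%:E by apply: mule_ge0 => //; rewrite lee_fin ltW.
  have mcv m : measurable_fun setT (fun x => chi m x * (v x)%:E).
    by apply: emeasurable_funM => //; exact/measurable_EFinP.
  have t_ge0 s m x : 0 <= Fm s m `^ p * (chi m x * (v x)%:E).
    by apply: mule_ge0 => //; exact: poweR_ge0.
  have mt s m : measurable_fun setT (fun x => Fm s m `^ p * (chi m x * (v x)%:E)).
    exact: measurable_funeM.
  rewrite ge0_integral_sum//; last 2 first.
  - by move=> s; apply: measurable_fun_esum.
  - by move=> s x _; apply: esum_ge0.
  apply: lee_sum => s _; rewrite ge0_integral_esum//.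
  apply: le_esum => m _; rewrite ge0_integralZl//; last exact: poweR_ge0.
  by rewrite wmass_indic.
rewrite big_map ge0_sume_distrr; last by move=> s _; exact: fiber_mass_ge0.
rewrite !big_seq; apply: lee_sum => s sss; have s0 := ss0 _ sss.
have sa0 : (0 < s^-1 * a)%R by rewrite mulr_gt0// invr_gt0.
have cell0 m : 0 <= Fm s m `^ p * wmass v (cell D m).
  by apply: mule_ge0; [exact: poweR_ge0|exact: wmass_ge0].
(* Doubling shrinks each enlarged cube to its cell; the cells are disjoint, so their contributions
   add up to at most one fibre integral. *)
apply: (@le_trans _ _ (C%:E * \esum_(m in [set: 'rV[int]_n]) (Fm s m `^ p * wmass v (cell D m)))).
  rewrite -esum_mulrl ?lee_fin ?(ltW C0)//; apply: le_esum => m _.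
  rewrite muleCA; apply: lee_wpmul2l; first exact: poweR_ge0.
  apply: le_trans (HC _ _ a0) _; apply: lee_wpmul2l; first by rewrite lee_fin ltW.
  by apply: le_wmass => //; rewrite mulrAC; exact: cube_sub_cell.
apply: lee_wpmul2l; first by rewrite lee_fin ltW.
apply: le_trans (esum_cells_le D0 (measurable_fiber_fun sa0 mK) _); last first.
  by move=> x; apply: mule_ge0; [exact: poweR_ge0|rewrite lee_fin ltW].
apply: le_esum => m _; rewrite -wmass_indic -ge0_integralZl//.
- apply: ge0_le_integral_nm => x _.
    by rewrite !mule_ge0 ?poweR_ge0 ?lee_fin// ltW.
  rewrite indicE; have [|_] := boolP (x \in cell D m); last by rewrite !mul0e mule0.
  rewrite inE => xm; rewrite !mul1e; apply: lee_wpmul2r; first by rewrite lee_fin ltW.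
  apply: le_poweR; [exact: ltW|exact: Fm0|].
  by rewrite gee0_abs ?control_fun_ge0//; exact: Fm_le.
- apply: emeasurable_funM; last exact/measurable_EFinP.
  by apply/measurable_EFinP; apply: measurable_indic; exact: measurable_cell.
- by move=> x _; rewrite mule_ge0// lee_fin// ltW.
- exact: poweR_ge0.
Qed.

Lemma doubling_right_invariant (q : \bar R) : 0 < q -> wiener_right_invariant p q v.
Proof.
move=> q0 Q cQ mQ g gG.
have [ts [C [ts0 C0 HC]]] := fiber_mass_control_R cQ mQ gG.
have [C' C'0 HC'] := @mixed_norm_le_dilates R n p q p0 q0 ts C ts0 (ltW C0).
exists C' => F [LF [mKF KFoo]].
have LRF := Linf_loc_R gG LF.
have mF : measurable_fun axbG (fun g => normc (F g)).
  by case: LF => mRe mIm _; exact: measurable_normc.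
have mRF : measurable_fun axbG (fun h => normc (axb_R g F h)).
  by case: LRF => mRe mIm _; exact: measurable_normc.
have le : wiener_qnorm p q v Q (axb_R g F) <= C'%:E * wiener_qnorm p q v Q F.
  apply: HC'.
  - by move=> a _; exact: fiber_mass_ge0.
  - by move=> a _; exact: fiber_mass_ge0.
  - exact: measurable_fiber_mass.
  - by move=> a a0; exact: HC.
split; last exact: le.
split; first exact: LRF.
split; first exact: measurable_control_fun.
apply: (le_lt_trans le); rewrite ltey.
move: KFoo; rewrite -/(wiener_qnorm p q v Q F); case: (wiener_qnorm _ _ _ _ _) => [z||] // _.
by rewrite gt0_muleNy// lte_fin.
Qed.

End doubling_right_invariant.

(** * From right invariance to doubling, by indicator functions of boxes *)

Section right_invariant_doubling.
Context {R : realType} {n : nat}.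
Local Notation GT := ('rV[R]_n * R)%type.
Local Notation normc := ComplexField.Normc.normc.
Local Open Scope ereal_scope.
Variables (p : R) (q : \bar R) (v : 'rV[R]_n -> R).
Hypotheses (p0 : (0 < p)%R) (q0 : 0 < q).
Hypotheses (v0 : forall x, (0 < v x)%R) (mv : measurable_fun setT v).
Hypothesis vfin : forall K, compact K -> wmass v K < +oo.

Lemma wmass_cube_fin x r : wmass v (cube x r) \is a fin_num.
Proof.
rewrite ge0_fin_numE; last exact: wmass_ge0.
pose K : set 'rV[R]_n := [set y | forall i, `[(x ord0 i - r)%R, (x ord0 i + r)%R]%classic (y ord0 i)].
have cK : compact K.
  apply: (@rV_compact R n (fun i => `[(x ord0 i - r)%R, (x ord0 i + r)%R]%classic)) => i.
  exact: segment_compact.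
apply: (le_lt_trans _ (vfin cK)); apply: le_wmass => // y yx i.
by have := yx i; rewrite /= in_itv/= ltr_norml; lra.
Qed.

(** Used in two roles: around the identity, with [s = 1], as the neighbourhood [Q], and elsewhere as
    the support of the test function. *)
Definition slab (x : 'rV[R]_n) (r s c : R) : set GT :=
  [set h | cube x r h.1 /\ symitv c (h.2 / s)%R].

Lemma measurable_slab x r s c : measurable (slab x r s c).
Proof.
have mS : measurable ((fun b : measurableTypeR R => (b / s)%R) @^-1` symitv c : set (measurableTypeR R)).
  rewrite -[X in measurable X]setTI.
  have : measurable_fun setT (fun b : measurableTypeR R => (b / s)%R : measurableTypeR R).
    exact: measurable_funM.
  by apply => //; exact: measurable_symitv.
rewrite (_ : slab x r s c = cube x r `*` ((fun b => b / s)%R @^-1` symitv c))//.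
by apply: measurableX => //; exact: measurable_cube.
Qed.

Definition slab_fun x r s c (h : GT) : R[i] := Complex (\1_(slab x r s c) h) 0%R.

Lemma normc_slab_fun x r s c h : normc (slab_fun x r s c h) = \1_(slab x r s c) h :> R.
Proof.
by rewrite /slab_fun/= expr0n/= addr0 sqrtr_sqr ger0_norm// indicE.
Qed.

Lemma Linf_loc_slab_fun x r s c : Linf_loc (slab_fun x r s c).
Proof.
split.
- apply: measurable_funTS => /=; apply: measurable_indic; exact: measurable_slab.
- exact: measurable_cst.
- move=> K cK; apply: (@le_lt_trans _ _ 1); last by rewrite ltry.
  apply/ess_supP; apply: aeW => h; rewrite lee_fin normc_slab_fun !indicE.
  by case: (_ \in _); case: (_ \in _); rewrite ?mulr0 ?mul0r ?mulr1.
Qed.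

(** A single layer, indexed by [unit] so that the estimates for [layers] apply. *)
Let layer (V : \bar R) (s M : R) := layers (fun _ : unit => V) (fun _ : unit => s) (symitv M).

Lemma layerE V s M a : 0 <= V -> layer V s M a = V * (\1_(symitv M) (a / s)%R)%:E.
Proof.
move=> V0; rewrite /layer /layers.
rewrite (_ : [set: unit] = [set tt]); last by apply/seteqP; split => // -[].
by rewrite esum_set1// mule_ge0// lee_fin.
Qed.

Lemma fiber_mass_slab_le e x r s c a : (0 < s)%R -> (0 < a)%R -> (1 < c)%R -> (0 < e)%R ->
  fiber_mass p v (control_fun (slab 0%R e 1%R c) (slab_fun x r s c)) a <=
  layer (wmass v (cube x (r + e * (c * c * s)))) s (c * c) a.
Proof.
move=> s0 a0 c1 e0; have c0 : (0 < c)%R by rewrite (lt_trans _ c1).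
rewrite layerE; last exact: wmass_ge0.
rewrite muleC indicE.
have K1 y : control_fun (slab 0%R e 1%R c) (slab_fun x r s c) (y, a) <= 1.
  apply/ess_supP; apply: aeW => h; rewrite lee_fin normc_slab_fun /axb_L !indicE.
  by case: (_ \in _); case: (_ \in _); rewrite ?mulr0 ?mul0r ?mulr1.
(* A nonzero value requires a point [h] of the support in the translate of [Q] by [(y, a)]. Then
   [a < c * h.2 < c * c * s], and [y] is within [e * a] of [h.1] in each coordinate. *)
have K0 y : ~ (cube x (r + e * (c * c * s)) y /\ symitv (c * c) (a / s)%R) ->
    control_fun (slab 0%R e 1%R c) (slab_fun x r s c) (y, a) = 0.
  move=> H; apply/eqP; rewrite eq_le control_fun_ge0 andbT.
  apply/ess_supP; apply: aeW => h; rewrite lee_fin normc_slab_fun /axb_L !indicE.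
  have [|_] := boolP (_ \in slab 0%R e 1%R c); last by rewrite mul0r.
  rewrite inE axb_divE => -[/= h1]; rewrite divr1 => /andP[h2 h3].
  have [|_] := boolP (h \in _); last by rewrite mulr0.
  rewrite inE => -[h1' /andP[h2' h3']]; exfalso; apply: H.
  have h20 : (0 < h.2)%R.
    have : (0 < h.2 / a)%R by apply: lt_trans h2; rewrite invr_gt0.
    by rewrite pmulr_lgt0// invr_gt0.
  move: h2 h3 h2' h3'; rewrite ltr_pdivlMr// ltr_pdivrMr// ltr_pdivlMr// ltr_pdivrMr// => h2 h3 h2' h3'.
  have ca : (a < c * h.2)%R by rewrite -ltr_pdivrMl.
  have cs : (s < c * h.2)%R by rewrite -ltr_pdivrMl.
  split.
    move=> i; rewrite (_ : _ - _ = (y ord0 i - h.1 ord0 i) + (h.1 ord0 i - x ord0 i))%R; last by ring.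
    apply: (le_lt_trans (ler_normD _ _)); rewrite addrC; apply: ltrD; first exact: h1'.
    rewrite distrC; have := h1 i; rewrite !mxE subr0 normrM gtr0_norm ?invr_gt0// mulrC ltr_pdivrMr//.
    move/lt_le_trans; apply; rewrite ler_pM2l// -mulrA; apply: ltW; apply: (lt_trans ca).
    by rewrite ltr_pM2l.
  apply/andP; split.
    rewrite ltr_pdivlMr// invfM -mulrA.
    have : (c^-1 * s < h.2)%R by [].
    rewrite -(ltr_pM2l (_ : 0 < c^-1)%R) ?invr_gt0// => /lt_trans; apply.
    by rewrite ltr_pdivrMl.
  rewrite ltr_pdivrMr// -mulrA; apply: (lt_trans ca); by rewrite ltr_pM2l.
have [aM|aM] := boolP ((a / s)%R \in symitv (c * c)); last first.
  rewrite mul0e /fiber_mass integral0_eq// => y _.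
  rewrite K0 ?abse0 ?poweR0r ?mul0e// ?gt_eqF//.
  by move=> [_]; move/negP: aM; rewrite inE.
rewrite mul1e -wmass_indic; apply: ge0_le_integral_nm => y _.
  by apply: mule_ge0; [exact: poweR_ge0|rewrite lee_fin ltW].
apply: lee_wpmul2r; first by rewrite lee_fin ltW.
rewrite indicE; have [_|yx] := boolP (y \in _).
  rewrite -(@poweR1r R p); apply: le_poweR; [exact: ltW|by []|].
  by rewrite gee0_abs ?control_fun_ge0.
rewrite K0 ?abse0 ?poweR0r ?gt_eqF//.
by move=> [yx' _]; move/negP: yx; rewrite inE.
Qed.

(** The product of [(y, a)] with [(z, 1)] is [(y + a *: z, a)]: at height [a] the support of the
    translate is the original one moved by [- a *: z], and there the control function is at least
    1. *)
Lemma fiber_mass_slab_ge e x r s c z a : (0 < s)%R -> (0 < a)%R -> (1 < c)%R -> (0 < e)%R ->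
  layer (wmass v (cube (x - a *: z)%R r)) s c a <=
  fiber_mass p v (control_fun (slab 0%R e 1%R c) (axb_R (z, 1%R) (slab_fun x r s c))) a.
Proof.
move=> s0 a0 c1 e0; have c0 : (0 < c)%R by rewrite (lt_trans _ c1).
have cV : (c^-1 < 1)%R by rewrite invf_lt1.
rewrite layerE; last exact: wmass_ge0.
rewrite muleC indicE; have [|_] := boolP (_ \in _); last by rewrite mul0e fiber_mass_ge0.
rewrite inE => /andP[ac ac']; rewrite mul1e -wmass_indic.
apply: ge0_le_integral_nm => y _; first by rewrite mule_ge0// lee_fin// ltW.
apply: lee_wpmul2r; first by rewrite lee_fin ltW.
rewrite indicE; have [|_] := boolP (y \in _); last exact: poweR_ge0.
rewrite inE => yx; rewrite -(@poweR1r R p); apply: le_poweR; [exact: ltW|by []|].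
rewrite gee0_abs ?control_fun_ge0//.
(* Near (y, a) both indicator functions equal 1. *)
pose A : set GT := [set h | slab 0%R e 1%R c (axb_mul (axb_inv (y, a)) h) /\
   slab x r s c (axb_mul h (z, 1%R))].
have mA : measurable A.
  rewrite (_ : A = axb_mul (axb_inv (y, a)) @^-1` slab 0%R e 1%R c `&`
    (axb_mul ^~ (z, 1%R)) @^-1` slab x r s c)//.
  apply: measurableI; rewrite -[X in measurable X]setTI.
    by apply: measurable_axb_mull => //; exact: measurable_slab.
  by apply: measurable_axb_mulr => //; exact: measurable_slab.
apply: (ess_sup_ge_on (A := A)) => //; last first.
  move=> h [h1 h2]; rewrite lee_fin normc_slab_fun /axb_L !indicE.
  by rewrite !mem_set// mulr1.
pose Z := (1 + \sum_i `|z ord0 i|)%R.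
have Z0 : (0 < Z)%R by rewrite ltr_wpDr// sumr_ge0.
have leZ i : (`|z ord0 i| <= Z)%R.
  by rewrite /Z (bigD1 i)//= addrCA lerDl addr_ge0// sumr_ge0.
pose g i := (r - `|y ord0 i - (x - a *: z)%R ord0 i|)%R.
have g0 i : (0 < g i)%R by rewrite subr_gt0; exact: yx.
(* [b] is the smallest slack of [y] in the open cube, over all coordinates. *)
have [b b0 bg] : exists2 b : R, (0 < b)%R & forall i, (b <= g i)%R.
  exists (\big[Num.min/1%R]_i g i); last by move=> i; exact: bigmin_le.
  by apply/bigmin_gtP; split.
move: ac ac'; rewrite ltr_pdivlMr// ltr_pdivrMr// => ac ac'.
have h1 : (0 < a - c^-1 * s)%R by rewrite subr_gt0.
have h2 : (0 < c * s - a)%R by rewrite subr_gt0.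
have h3 : (0 < a * (1 - c^-1))%R by rewrite mulr_gt0// subr_gt0.
have h4 : (0 < a * (c - 1))%R by rewrite mulr_gt0// subr_gt0.
have h5 : (0 < a * e)%R by rewrite mulr_gt0.
have h6 : (0 < b / (1 + Z))%R by rewrite divr_gt0// addr_gt0.
(* In order: the scale stays in the support, the scale and then the position stay in the translate
   of [Q], and the displacement in space, including the change of shift caused by a change of scale,
   stays below the slack [b]. *)
pose d := (Num.min (Num.min (a - c^-1 * s) (c * s - a)) (Num.min (Num.min (a * (1 - c^-1)) (a * (c - 1)))
   (Num.min (a * e) (b / (1 + Z)))))%R.
have d0 : (0 < d)%R by rewrite !lt_min h1 h2 h3 h4 h5 h6.
apply: (@haar_box_gt0 R n A y a d) => // -[w t] /= wy ta.
have : (d <= d)%R by []; rewrite {2}/d !le_min => /andP[/andP[d1 d2] /andP[/andP[d3 d4] /andP[d5 d6]]].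
move: ta; rewrite ltr_norml => /andP[ta1 ta2].
split; last split.
- rewrite axb_divE; split => /=.
    move=> i; rewrite !mxE subr0 normrM gtr0_norm ?invr_gt0// mulrC ltr_pdivrMr//.
    by apply: (lt_le_trans (wy i)); rewrite mulrC.
  rewrite divr1; apply/andP; split; first by rewrite ltr_pdivlMr//; move: d3; rewrite mulrBr mulr1; lra.
  by rewrite ltr_pdivrMr//; move: d4; rewrite mulrBr mulr1; lra.
- move=> i; rewrite /= !mxE.
  rewrite (_ : _ - _ = (y ord0 i - (x ord0 i - a * z ord0 i)) + ((w ord0 i - y ord0 i) + (t - a) * z ord0 i))%R; last by ring.
  apply: (le_lt_trans (ler_normD _ _)).
  have : (`|w ord0 i - y ord0 i + (t - a) * z ord0 i| < b)%R.
    apply: (le_lt_trans (ler_normD _ _)).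
    have -> : b = (b / (1 + Z) + b / (1 + Z) * Z)%R.
      by rewrite -[X in (X + _)%R]mulr1 -mulrDr divfK// gt_eqF// addr_gt0.
    apply: ltr_leD; first exact: lt_le_trans (wy i) d6.
    rewrite normrM; apply: ler_pM => //; apply: ltW; apply: lt_le_trans d6.
    by rewrite ltr_norml ta1 ta2.
  have := bg i; rewrite /g !mxE; lra.
- rewrite /= mulr1; apply/andP; split; first by rewrite ltr_pdivlMr//; lra.
  by rewrite ltr_pdivrMr//; lra.
Qed.

Lemma measurable_layer V s M : 0 <= V ->
  measurable_fun (`]0%R, +oo[%classic : set (measurableTypeR R)) (layer V s M).
Proof. by move=> V0; apply: measurable_layers => //; exact: measurable_symitv. Qed.

(** Finiteness and positivity let this factor cancel when two boxes at the same scale are compared;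
    both follow from the comparison with a scale norm over one index. *)
Lemma mixed_norm_layer s c : (0 < s)%R -> (1 < c)%R ->
  exists2 k : R, (0 < k)%R & mixed_norm n p q (layer 1 s c) = k%:E.
Proof.
move=> s0 c1.
have sep : q = p%:E \/ (forall M : R, (1 < M)%R -> exists N : nat, forall t : R,
    ([set j : unit | symitv M (t / s)%R] #<= `I_N)%card).
  right => M _; exists 1%N => t.
  have sub : [set j : unit | symitv M (t / s)%R] `<=` [set tt] by move=> [].
  apply: card_le_trans (subset_card_le sub) _.
  by have := @card_set1 _ tt; rewrite card_eq_le => /andP[].
have s0' : forall j : unit, (0 < (fun _ => s) j)%R by [].
have [C1 C10 HC1] := @mixed_norm_layers_le R n p q _ tt (fun _ => s) p0 q0 s0' sep c c1.
have [C2 C20 HC2] := @scale_norm_le_layers R n p q _ (fun _ => s) p0 q0 s0' sep c c1.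
have [k k0 kE] : exists2 k : R, (0 < k)%R & scale_norm n p q (fun _ => s) (fun _ : unit => 1) = k%:E.
  rewrite /scale_norm (_ : [set: unit] = [set tt]); last by apply/seteqP; split => // -[].
  case: q q0 => [r r0|_|//]; last first.
    by exists 1%R => //; rewrite image_set1 ereal_sup1 poweR1r.
  exists ((s ^- n) `^ r^-1)%R; first by rewrite powR_gt0// invr_gt0 exprn_gt0.
  rewrite esum_set1 poweR1r mul1e//.
  by rewrite lee_fin invr_ge0 exprn_ge0// ltW.
have := HC1 (fun _ => 1) (fun _ => lee01); rewrite kE => le1.
have := HC2 (fun _ => 1) (fun _ => lee01); rewrite kE => le2.
have fin : mixed_norm n p q (layer 1 s c) \is a fin_num.
  rewrite ge0_fin_numE; last exact: mixed_norm_ge0.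
  by apply: (le_lt_trans le1); rewrite -EFinM ltry.
exists (fine (mixed_norm n p q (layer 1 s c))); last by rewrite fineK.
rewrite -lte_fin fineK// lt_neqAle mixed_norm_ge0// andbT eq_sym.
apply/eqP => m0; move: le2; rewrite -/(layer 1 s c) m0 mule0 lee_fin.
by rewrite leNgt k0.
Qed.

Lemma slab_nbhd1 e c : (0 < e)%R -> (1 < c)%R -> rel_compact_nbhd1 (slab 0%R e 1%R c).
Proof.
move=> e0 c1; have c0 : (0 < c)%R by rewrite (lt_trans _ c1).
have cV : (c^-1 < 1)%R by rewrite invf_lt1.
split.
  have d1 : (0 < 1 - c^-1)%R by rewrite subr_gt0.
  have d2 : (0 < c - 1)%R by rewrite subr_gt0.
  apply/nbhs_ballP; exists (Num.min e (Num.min (1 - c^-1) (c - 1)))%R => /=.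
    by rewrite !lt_min e0 d1 d2.
  move=> [y b] [/= [_ yb] bb]; split => /=.
    by move=> i; have := yb ord0 i; rewrite /ball/= lt_min distrC => /andP[].
  move: bb; rewrite /ball/= !lt_min => /andP[_ /andP[]].
  rewrite divr1 !ltr_norml => /andP[b1 b2] /andP[b3 b4].
  by rewrite /symitv/=; apply/andP; split; lra.
pose K1 : set 'rV[R]_n := [set y | forall i, `[(- e)%R, e]%classic (y ord0 i)].
exists (K1 `*` `[c^-1%R, c]).
  split.
    apply: compact_setX; last exact: segment_compact.
    apply: (@rV_compact R n (fun i => `[(- e)%R, e]%classic)) => i.
    exact: segment_compact.
  move=> [y b] [_] /=; rewrite in_itv/= => /andP[b1 _].
  by rewrite /axbG/= (lt_le_trans _ b1)// invr_gt0.
move=> [y b] [/= yb]; rewrite divr1 => /andP[b1 b2]; split => /=.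
  by move=> i; have := yb i; rewrite mxE subr0 /= in_itv/= ltr_norml => /andP[y1 y2]; rewrite !ltW.
by rewrite in_itv/= !ltW.
Qed.

Lemma mixed_norm_layerZ (V s c : R) : (0 <= V)%R -> (0 < s)%R ->
  mixed_norm n p q (layer V%:E s c) = (V `^ p^-1)%:E * mixed_norm n p q (layer 1 s c).
Proof.
move=> V0 s0; rewrite -mixed_normZ//.
- by congr mixed_norm; apply/funext => a; rewrite !layerE ?lee_fin// mul1e.
- by move=> a _; apply: layers_ge0.
- exact: measurable_layer.
Qed.

Hypothesis RI : wiener_right_invariant p q v.

Lemma right_invariant_cubes (z : 'rV[R]_n) : exists2 C : R, (0 < C)%R &
  forall x r, (0 < r)%R ->
    wmass v (cube (x - r *: z)%R (r / 4)) <= C%:E * wmass v (cube x r).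
Proof.
pose Z := (1 + \sum_i `|z ord0 i|)%R.
have Z1 : (1 <= Z)%R by rewrite lerDl sumr_ge0.
have Z0 : (0 < Z)%R by rewrite (lt_le_trans _ Z1).
have leZ i : (`|z ord0 i| <= Z)%R.
  by rewrite /Z (bigD1 i)//= addrCA lerDl addr_ge0// sumr_ge0.
have Z4 : (0 < (4 * Z)^-1)%R by rewrite invr_gt0 mulr_gt0.
(* For [a / r] in [symitv c], the shifts [a *: z] and [r *: z] then differ by at most [r / 4] in
   every coordinate. *)
pose c := (1 + (4 * Z)^-1)%R.
have c1 : (1 < c)%R by rewrite ltrDl.
have c0 : (0 < c)%R by rewrite (lt_trans _ c1).
have cc0 : (0 < c * c)%R by exact: mulr_gt0.
have cc1 : (1 < c * c)%R by apply: (lt_trans c1); rewrite ltr_pMl.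
(* Chosen so that the cube of radius [r / 2], spread by the control function, has radius
   [r / 2 + e * (c * c * r) = r]. *)
pose e := ((c * c)^-1 / 2)%R.
have e0 : (0 < e)%R by rewrite divr_gt0// invr_gt0.
pose Q := slab 0%R e 1%R c : set GT.
have mQ : measurable Q by exact: measurable_slab.
have cQ : rel_compact_nbhd1 Q by exact: slab_nbhd1.
have zG : axbG ((z, 1%R) : GT) by rewrite /axbG/=.
have [C HC] := RI cQ mQ zG.
(* The upper bound lives on [symitv (c * c)] and the lower one on [symitv c]; dilates bring both to
   the same layer, whose norm cancels. *)
have [ts [ts0 Hts]] := symitv_cover c1 cc1.
have [C1 C10 HC1] := @mixed_norm_le_dilates R n p q p0 q0 ts 1 ts0 ler01.
pose C' := (`|C| * C1)%R.
have C'0 : (0 <= C')%R by rewrite mulr_ge0// ltW.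
exists (C' `^ p + 1)%R => [|x r r0]; first by rewrite ltr_wpDl// powR_ge0.
pose F := slab_fun x (r / 2) r c.
have LF : Linf_loc F by exact: Linf_loc_slab_fun.
have mF : measurable_fun axbG (fun g => normc (F g)).
  by case: LF => mRe mIm _; exact: measurable_normc.
have mKF : measurable_fun axbG (control_fun Q F) by exact: measurable_control_fun.
have [k k0 kE] := mixed_norm_layer r0 c1.
pose V := fine (wmass v (cube x r)).
pose V' := fine (wmass v (cube (x - r *: z)%R (r / 4))).
have VE : wmass v (cube x r) = V%:E by rewrite fineK// wmass_cube_fin.
have V'E : wmass v (cube (x - r *: z)%R (r / 4)) = V'%:E by rewrite fineK// wmass_cube_fin.
have V0 : (0 <= V)%R by rewrite -lee_fin -VE; exact: wmass_ge0.
have V'0 : (0 <= V')%R by rewrite -lee_fin -V'E; exact: wmass_ge0.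
have leF : wiener_qnorm p q v Q F <= (C1 * (V `^ p^-1 * k))%:E.
  rewrite EFinM (EFinM (V `^ _)) -kE -mixed_norm_layerZ//; apply: HC1.
  - by move=> a _; exact: fiber_mass_ge0.
  - by move=> a _; apply: layers_ge0 => i; rewrite lee_fin.
  - exact: measurable_layer.
  - move=> a a0; rewrite mul1e.
    apply: (@le_trans _ _ (layer V%:E r (c * c) a)).
      have := @fiber_mass_slab_le e x (r / 2) r c a r0 a0 c1 e0.
      rewrite (_ : (r / 2 + e * (c * c * r))%R = r) ?VE//.
      have cn0 : c != 0%R by rewrite gt_eqF.
      by rewrite /e; field.
    by apply: layers_dilates => //; exact: Hts.
have wF : wiener p q v Q F.
  split; first exact: LF.
  by split; [exact: mKF|exact: (le_lt_trans leF (ltry _))].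
have [wRF leRF] := HC F wF.
have geRF : mixed_norm n p q (layer V'%:E r c) <= wiener_qnorm p q v Q (axb_R (z, 1%R) F).
  apply: le_mixed_norm => // a a0; first by apply: layers_ge0 => i; rewrite lee_fin.
  apply: le_trans (@fiber_mass_slab_ge e x (r / 2) r c z a r0 a0 c1 e0).
  rewrite !layerE ?lee_fin//; last exact: wmass_ge0.
  rewrite indicE; have [|_] := boolP (_ \in _); last by rewrite !mule0.
  rewrite inE => /andP[a1 a2]; rewrite !mule1 -V'E; apply: le_wmass => //.
  (* The cube of radius [r / 4] around the fixed centre, shifted by at most [r / 4], stays in the
     cube of radius [r / 2] around the moving centre. *)
  apply: (@sub_cube _ _ _ _ _ (r / 4)); last lra.
  move=> i; rewrite !mxE.
  rewrite (_ : _ - _ = (a - r) * z ord0 i)%R; last by ring.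
  move: a1 a2; rewrite ltr_pdivlMr// ltr_pdivrMr// => a1 a2.
  have cV : (1 - c^-1 <= (4 * Z)^-1)%R.
    by rewrite -(ler_pM2r c0) mulrBl mul1r mulVf ?gt_eqF// {1}/c [(1 + _)%R]addrC addrK ler_peMr// ltW.
  have ar : (`|a - r| <= (4 * Z)^-1 * r)%R.
    rewrite ler_norml; apply/andP; split.
      have : ((1 - c^-1) * r <= (4 * Z)^-1 * r)%R by rewrite ler_pM2r.
      by rewrite mulrBl mul1r; lra.
    by move: a2; rewrite /c mulrDl mul1r; lra.
  rewrite normrM; apply: (@le_trans _ _ ((4 * Z)^-1 * r * Z)%R); first exact: ler_pM.
  by rewrite mulrAC invfM -[(4^-1 / Z * Z)%R]mulrA mulVf ?gt_eqF// mulr1 mulrC.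
have key : (V' `^ p^-1 * k <= C' * (V `^ p^-1 * k))%R.
  rewrite -lee_fin EFinM -kE -mixed_norm_layerZ//; apply: (le_trans geRF).
  apply: (le_trans leRF); rewrite /C' -mulrA EFinM; apply: (@le_trans _ _ (`|C|%:E * wiener_qnorm p q v Q F)).
    apply: lee_wpmul2r; first exact: mixed_norm_ge0.
    by rewrite lee_fin ler_norm.
  by apply: lee_wpmul2l; rewrite ?lee_fin.
rewrite VE V'E -EFinM lee_fin.
have {}key : (V' `^ p^-1 <= C' * V `^ p^-1)%R by move: key; rewrite mulrA ler_pM2r.
have pw (W : R) : (0 <= W)%R -> ((W `^ p^-1) `^ p)%R = W.
  by move=> W0; rewrite -powRrM mulVf ?gt_eqF// powRr1.
have : (V' <= C' `^ p * V)%R.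
  rewrite -(pw V')// -[X in (_ <= _ * X)%R](pw V)// -powRM ?powR_ge0//.
  apply: ge0_ler_powR => //; rewrite ?nnegrE ?(ltW p0) // ?powR_ge0 //.
  by apply: mulr_ge0 => //; exact: powR_ge0.
by move/le_trans; apply; rewrite mulrDl mul1r lerDl.
Qed.

Lemma wmass_cover (I : finType) (A : set 'rV[R]_n) (B : I -> set 'rV[R]_n) :
  (forall i, measurable (B i)) -> (forall y, A y -> exists i, B i y) ->
  wmass v A <= \sum_i wmass v (B i).
Proof.
move=> mB AB; rewrite -wmass_indic; under eq_bigr do rewrite -wmass_indic.
rewrite -ge0_integral_sum//.
- apply: ge0_le_integral_nm => y _; first by rewrite mule_ge0// lee_fin// ltW.
  have t0 i : 0 <= (\1_(B i) y)%:E * (v y)%:E by rewrite mule_ge0// lee_fin// ltW.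
  rewrite indicE; have [|_] := boolP (y \in A); last by rewrite mul0e sume_ge0.
  rewrite inE => /AB[i By]; rewrite (bigD1 i)//= [in leRHS]indicE mem_set//.
  by rewrite leeDl// sume_ge0.
- move=> i; apply: emeasurable_funM; last exact/measurable_EFinP.
  by apply/measurable_EFinP; apply: measurable_indic.
- by move=> i y _; rewrite mule_ge0// lee_fin// ltW.
Qed.

Lemma right_invariant_doubling : doubling v.
Proof.
(* In units of [r' = r / n.+1], for which the cube of radius [r'] lies in the ball of radius [r],
   the ball of radius [2 * r] lies in the cube of radius [N]. *)
pose N : nat := (2 * n.+1)%N.
(* The centres [x - r' *: z k] form a grid of mesh [r' / 4]; [8 * N] steps per coordinate run from
   [- N] up to [N] in units of [r']. *)
pose z (k : {ffun 'I_n -> 'I_(8 * N)}) : 'rV[R]_n := (\row_i (N%:R - (k i)%:R / 4))%R.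
pose C k := sval (cid2 (right_invariant_cubes (z k))).
have C0 k : (0 < C k)%R by rewrite /C; case: cid2.
have HC k x r : (0 < r)%R ->
    wmass v (cube (x - r *: z k)%R (r / 4)) <= (C k)%:E * wmass v (cube x r).
  by move=> r0; rewrite /C; case: cid2 => /= C' _; exact.
exists (\sum_k C k)%R => x r r0.
pose r' := (r / n.+1%:R)%R; have r'0 : (0 < r')%R by exact: divr_gt0.
have rr' : (n.+1%:R * r' = r)%R by rewrite mulrC divfK// gt_eqF.
apply: (@le_trans _ _ (wmass v (cube x (N%:R * r')))).
  apply: le_wmass => //; apply: subset_trans (@eball_cube _ _ _ _) _.
  by rewrite /N natrM -mulrA rr'.
apply: (@le_trans _ _ (\sum_k wmass v (cube (x - r' *: z k)%R (r' / 4)))).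
  apply: wmass_cover => [k|y yx]; first exact: measurable_cube.
  pose u i := ((y ord0 i - x ord0 i) / r')%R.
  have uN i : (0 <= 4 * (u i + N%:R) < (8 * N)%:R)%R.
    have := yx i; rewrite -ltr_pdivrMr// -[X in (_ / X)%R](gtr0_norm r'0) -normf_div -/(u i).
    by rewrite ltr_norml natrM => /andP[u1 u2]; apply/andP; split; lra.
  have kN i : (Num.truncn (4 * (u i + N%:R))%R < 8 * N)%N.
    have /andP[u1 u2] := uN i; rewrite -(ltr_nat R); apply: le_lt_trans u2.
    by rewrite truncn_le.
  (* Truncating [4 * (u i + N%:R)] picks the grid point just below [y] in each coordinate, at
     distance less than [r' / 4]. *)
  exists [ffun i => Ordinal (kN i)] => i; rewrite !mxE ffunE /=.
  set k := Num.truncn _; have /andP[u1 u2] := uN i.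
  have k1 : (k%:R <= 4 * (u i + N%:R))%R by rewrite truncn_le.
  have k2 : (4 * (u i + N%:R) < k.+1%:R)%R by exact: truncnS_gt.
  rewrite (_ : _ - _ = r' * (u i + N%:R - k%:R / 4))%R; last first.
    have r'n0 : r' != 0%R by rewrite gt_eqF.
    by rewrite /u; field.
  rewrite normrM gtr0_norm// ltr_pM2l//.
  move: k1 k2; rewrite -[k.+1%:R]natr1 ltr_norml.
  move: (k%:R : R) (u i) (N%:R : R) => kr ur Nr k1 k2.
  by apply/andP; split; lra.
rewrite -sumEFin ge0_sume_distrl; last by move=> k _; rewrite lee_fin ltW.
apply: lee_sum => k _; apply: le_trans (HC k x _ r'0) _.
apply: lee_wpmul2l; first by rewrite lee_fin ltW.
apply: le_wmass => //; apply: subset_trans (cube_eball r'0) _.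
by rewrite rr'.
Qed.

End right_invariant_doubling.

Theorem lemma6p1 (R : realType) (n : nat) (p : R) (q : \bar R)
    (v : 'rV[R]_n -> R)
    (x : 'rV[int]_n -> int -> 'rV[R]_n) (a : int -> R) :
  (0 < n)%N -> 0 < p -> (0 < q)%E -> weight v ->
  let X := fun i : 'rV[int]_n * int => (x i.1 i.2, a i.2) in
  well_spread X ->
  (doubling v ->
     (forall U U' : set ('rV[R]_n * R),
        rel_compact_nbhd1 U -> measurable U ->
        rel_compact_nbhd1 U' -> measurable U' ->
        equivalent_qnormed (Lpq_d p q v X U) (Lpq_d_qnorm p q v X U)
                           (Lpq_d p q v X U') (Lpq_d_qnorm p q v X U')) /\
     (q = p%:E \/ relatively_separated_scales a ->
      forall U : set ('rV[R]_n * R),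
        rel_compact_nbhd1 U -> measurable U ->
        equivalent_qnormed (Lpq_d p q v X U) (Lpq_d_qnorm p q v X U)
                           (seq_space p q v x a) (seq_qnorm p q v x a))) /\
  (wiener_right_invariant p q v <-> doubling v).
Proof.
move=> n0 p0 q0 [v0 mv vfin] X [X0 sepX _]; split.
  move=> dv; split=> [U U' cU mU cU' mU'|qsep U cU mU].
    exact: Lpq_d_equiv.
  exact: Lpq_d_equiv_seq.
split=> [RI|dv]; first exact: (right_invariant_doubling p0 q0).
exact: doubling_right_invariant.
Qed.
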